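(* Let $\mathcal G=(\mathcal V,\mathcal E)$ be an infinite, connected, locally finite metric graph with $j:=\sup_{e\in\mathcal E}l_e<\infty$ and $r:=\inf_{e\in\mathcal E}l_e>0$. Let $x_0\in\mathcal V$ be such that there is a sequence $\{x_n\}\subset\mathcal V$ with $d(x_0,x_n)\to+\infty$ and such that for every $R>0$ the ball $B_R=B_R(x_0)$ is finite (consists of finitely many vertices and edges), and assume there is a constant $C_0>0$ with $\sum_{y\sim x}\omega(x,y)\le C_0\,\mu_{\mathcal V}(x)$ for all $x\in\mathcal V$. Put $R_0:=\max\{2j,1\}$. Let $\sigma>1$, $\delta>0$, and for $R\ge R_0$ let $\alpha=\alpha(R)=\delta/R$. Let $h:\mathcal G\times[0,\infty)\to\mathbb R$ be positive and suppose there is a constant $C>0$ such that for every $R\ge R_0$, with $\alpha=\delta/R$, $$\int_{R^{1/2}}^{2R^{1/2}}\Big\{\sum_{x\in\mathcal V\cap B_R}\mu_{\mathcal V}(x)h^{-\frac1{\sigma-1}}(x,t)e^{-\alpha d(x,x_0)}\Big\}dt\le CR^{\frac\sigma{\sigma-1}},$$ $$\int_{R^{1/2}}^{2R^{1/2}}\Big\{\sum_{e\in\mathcal E}\int_0^{l_e}h_e^{-\frac1{\sigma-1}}(x,t)e^{-\alpha d(x,x_0)}\mathbf 1_{B_R}(x)\,dx\Big\}dt\le CR^{\frac\sigma{\sigma-1}},$$ $$\int_0^{2R^{1/2}}\Big\{\sum_{x\in\mathcal V\cap B_R^c}\mu_{\mathcal V}(x)h^{-\frac1{\sigma-1}}(x,t)e^{-\alpha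 d(x,x_0)}\Big\}dt\le CR^{\frac\sigma{\sigma-1}},$$ $$\int_0^{2R^{1/2}}\Big\{\sum_{e\in\mathcal E}\int_0^{l_e}h_e^{-\frac1{\sigma-1}}(x,t)e^{-\alpha d(x,x_0)}\mathbf 1_{B_R^c}(x)\,dx\Big\}dt\le CR^{\frac\sigma{\sigma-1}}.$$ Let $u:\mathcal G\times[0,\infty)\to\mathbb R$ be a very weak solution (of no prescribed sign) of $$u_{tt}\ge\Delta_{\mathcal G}u+h|u|^\sigma\ \text{ on }\mathcal G\times(0,\infty),\qquad u(x,0)=u_0(x),\quad u_t(x,0)=u_1(x),\ x\in\mathcal G,$$ such that $$\int_{\mathcal G}u_1(x)\,d\mu_{\mathcal G}\ge0,$$ and $u_0,u_1\in X_\alpha$, $u\in L^1_{\rm loc}([0,\infty);X_\alpha)$ (for $\alpha=\delta/R$, every $R\ge R_0$). Then $u\equiv0$ on $\mathcal G\times[0,\infty)$.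
   Context: Metric graph: $\mathcal V$ and $\mathcal E$ are countable sets of vertices and edges. Each edge $e$ has a length $l_e\in(0,\infty)$ and is identified with $I_e=(0,l_e)$, its closure with $[0,l_e]$, where $0$ corresponds to the initial vertex $i(e)$ and $l_e$ to the final vertex $j(e)$ (the number $j$ and the map $j(\cdot)$ are different objects); the intervals are glued at the vertices. $e\ni x$ means that the vertex $x$ is an endpoint of $e$; $x\sim y$ means that $x,y$ are joined by an edge. Locally finite: every vertex has finite degree. $d$ is the path metric (infimum of lengths of connecting paths), $B_R(x_0)=\{x\in\mathcal G:d(x,x_0)<R\}$, $B_R^c=\mathcal G\setminus B_R(x_0)$. A function $f$ on $\mathcal G$ is identified with the family $(f_e)_{e\in\mathcal E}$, $f_e:[0,l_e]\to\mathbb R$, with values agreeing at common vertices; $f\in C(\mathcal G)$ if each $f_e$ is continuous. Primes denote derivatives in the space variable. $\mu_{\mathcal V}:\mathcal V\to(0,\infty)$ is a vertex measure, and $\omega:\mathcal V\times\mathcal V\to[0,\infty)$ is symmetric with $\omega(x,y)>0$ iff $x\sim y$. Integrals: $\int_{\mathcal G}f\,d\mu_{\mathcal G}:=\sum_{x\in\mathcal V}\mu_{\mathcal V}(x)f(x)+\sum_{e\in\mathcal E}\int_0^{l_e}f_e(x)\,dx$. Weighted space: $X_\alpha:=L^1_{e^{-\alpha d(x,x_0)}}(\mathcal G)$, the space of functions $f$ on $\mathcal G$ with $\|f\|_{X_\alpha}=\sum_{x\in\mathcal V}\mu_{\mathcal V}(x)e^{-\alpha d(x,x_0)}|f(x)|+\sum_{e\in\mathcal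 E}\int_0^{l_e}|f_e(x)|e^{-\alpha d(x,x_0)}dx<\infty$. Laplacian: $\Delta_{\mathcal V}f(x)=\frac1{\mu_{\mathcal V}(x)}\sum_{y\sim x}\omega(x,y)(f(y)-f(x))$ for $x\in\mathcal V$; $\Delta_{\mathcal E}f=f_e''$ on each $I_e$; $\Delta_{\mathcal G}f$ is understood through $\int_{\mathcal G}g\,\Delta_{\mathcal G}f\,d\mu_{\mathcal G}:=\sum_{x\in\mathcal V}\mu_{\mathcal V}(x)g(x)\Delta_{\mathcal V}f(x)+\sum_{e\in\mathcal E}\int_0^{l_e}g_e f_e''\,dx$. $\mathcal D(\mathcal G)$ is the set of $f\in C(\mathcal G)$ with $f_e\in C^2(I_e)\cap C^1([0,l_e])$ and $f_e''\in L^\infty(I_e)$ for all $e$. The Kirchhoff operator at $x\in\mathcal V$ is $[\mathcal K(f)](x)=\sum_{e\ni x}\frac{df_e(x)}{dn}$, where $\frac{df_e(x)}{dn}=f_e'(x)$ if $j(e)=x$ and $-f_e'(x)$ if $i(e)=x$. Very weak solution of the hyperbolic problem: $u:\mathcal G\times[0,\infty)\to\mathbb R$ such that (1) for every $x\in\mathcal G$, $u(x,\cdot)\in L^1_{\rm loc}([0,\infty))\cap L^\sigma_{\rm loc}([0,\infty),h(x,\cdot)dt)$; (2) for every $t\ge0$, $u(\cdot,t)\in\mathcal D(\mathcal G)$ and $[\mathcal K(u)](x,t)=0$ for all $x\in\mathcal V$; (3) for every nonnegative $\varphi:\mathcal G\times[0,\infty)\to\mathbb R$ with $\mathrm{supp}\,\varphi\subset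 A\times[0,T]$ for some $T>0$ and compact $A\subset\mathcal G$, and $\varphi(x,\cdot)\in C^2([0,\infty))$ for all $x\in\mathcal G$, $$-\int_0^\infty\!\!\int_{\mathcal G}\varphi_{tt}u\,d\mu_{\mathcal G}dt+\int_0^\infty\!\!\int_{\mathcal G}\varphi\,\Delta_{\mathcal G}u\,d\mu_{\mathcal G}dt+\int_0^\infty\!\!\int_{\mathcal G}h|u|^\sigma\varphi\,d\mu_{\mathcal G}dt+\int_{\mathcal G}u_1(x)\varphi(x,0)\,d\mu_{\mathcal G}-\int_{\mathcal G}u_0(x)\varphi_t(x,0)\,d\mu_{\mathcal G}\le0.$$ Here $u_0,u_1:\mathcal G\to\mathbb R$ are the given initial data.
   Formalization: The conclusion is proved as: for almost every t ≥ 0, u(x,t)=0 for all x in G; ''u ≡ 0 on G×[0,∞)'' at every t is false, since u=1 at t=5 and 0 at all other times (u_0=u_1=0) meets every hypothesis of a very weak solution. *)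

(* Defs.v *)
From HB Require Import structures.
From mathcomp Require Import all_boot all_order all_algebra.
From mathcomp Require Import all_classical all_reals all_analysis.

Set Implicit Arguments.
Unset Strict Implicit.
Unset Printing Implicit Defensive.

Import Order.TTheory GRing.Theory Num.Theory.
Import numFieldNormedType.Exports.

Local Open Scope classical_set_scope.
Local Open Scope ring_scope.

(* Derivative of [f] at [x] along [I]: the ordinary one at interior points of
   [I], the one-sided one at an endpoint belonging to [I]. *)
Definition derivable_on (R : realType) (I : set R) (f : R -> R) (x : R) : Prop :=
  cvg ((fun y => (f y - f x) / (y - x)) @ within I x^').

Definition deriv_on (R : realType) (I : set R) (f : R -> R) (x : R) : R :=
  lim ((fun y => (f y - f x) / (y - x)) @ within I x^').

Fixpoint Ck_on (R : realType) (I : set R) (k : nat) (f : R -> R) : Prop :=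
  match k with
  | 0 => {within I, continuous f}
  | k'.+1 => (forall x, I x -> derivable_on I f x) /\ Ck_on I k' (deriv_on I f)
  end.

(* Parallel edges and loops are allowed. *)
Record metricGraph (R : realType) := MetricGraph {
  vertex : countType;
  edge : countType;
  initial : edge -> vertex;
  final : edge -> vertex;
  len : edge -> R;
  len_gt0 : forall e, 0 < len e }.

(* The glued space: the vertices together with the open edges. *)
Inductive gpoint (R : realType) (G : metricGraph R) :=
  | Vtx of vertex G
  | Inner (e : edge G) of {s : R | 0 < s < len e}.
Arguments Vtx {R G}.
Arguments Inner {R G}.

HB.instance Definition _ (R : realType) (G : metricGraph R) :=
  gen_eqMixin (gpoint G).
HB.instance Definition _ (R : realType) (G : metricGraph R) :=
  gen_choiceMixin (gpoint G).

(* The canonical map of the closed edge [0, len e] to the graph, extended by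
   constants to [R].  For [f : gpoint G -> R], the component [f_e] of the usual
   edgewise notation is [f \o pt e]; the components automatically agree at
   common vertices. *)
Definition pt (R : realType) (G : metricGraph R) (e : edge G) (s : R) : gpoint G :=
  if insub s is Some s' then Inner e s'
  else if s <= 0 then Vtx (initial e) else Vtx (final e).

(* [walk x y L]: there is a path of length [L] from [x] to [y], obtained by
   concatenating finitely many segments of closed edges. *)
Inductive walk (R : realType) (G : metricGraph R) :
    gpoint G -> gpoint G -> R -> Prop :=
  | walk_nil x : walk x x 0
  | walk_cons e s t y L :
      0 <= s <= len e -> 0 <= t <= len e -> walk (pt e t) y L ->
      walk (pt e s) y (`|s - t| + L).

Definition gdist (R : realType) (G : metricGraph R) (x y : gpoint G) : R :=
  inf [set L | walk x y L].

Definition gball (R : realType) (G : metricGraph R) (x : gpoint G) (r : R) :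
    set (gpoint G) :=
  [set y | gdist y x < r].

Definition gopen (R : realType) (G : metricGraph R) (U : set (gpoint G)) : Prop :=
  forall x, U x -> exists2 r, 0 < r & gball x r `<=` U.

Lemma gopenT (R : realType) (G : metricGraph R) : @gopen R G setT.
Proof. by move=> x _; exists 1. Qed.

Lemma gopenI (R : realType) (G : metricGraph R) : setI_closed (@gopen R G).
Proof.
move=> U W oU oW x [Ux Wx].
have [r r0 rU] := oU x Ux; have [s s0 sW] := oW x Wx.
exists (Num.min r s); first by rewrite lt_min r0 s0.
by move=> y; rewrite /gball /= lt_min => /andP[yr ys]; split; [exact: rU|exact: sW].
Qed.

Lemma gopen_bigU (R : realType) (G : metricGraph R) (I : Type)
    (f : I -> set (gpoint G)) :
  (forall i, gopen (f i)) -> gopen (\bigcup_i f i).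
Proof.
move=> of_ x [i _ fix_]; have [r r0 rf] := of_ i x fix_.
by exists r => // y /rf fiy; exists i.
Qed.

HB.instance Definition _ (R : realType) (G : metricGraph R) :=
  isOpenTopological.Build (gpoint G)
    (@gopenT R G) (@gopenI R G) (@gopen_bigU R G).

Section graph_properties.
Context (R : realType) (G : metricGraph R).

Definition adj (x y : vertex G) : Prop :=
  exists e : edge G,
    (initial e = x /\ final e = y) \/ (initial e = y /\ final e = x).

Definition graph_connected : Prop :=
  forall x y : gpoint G, exists L, walk x y L.

Definition locally_finite : Prop :=
  forall x : vertex G, finite_set [set e : edge G | initial e = x \/ final e = x].

Definition finite_part (A : set (gpoint G)) : Prop :=
  finite_set [set x : vertex G | A (Vtx x)] /\
  finite_set [set e : edge G | exists s, A (Inner e s)].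

End graph_properties.

Section integration.
Context (R : realType) (G : metricGraph R) (mu : vertex G -> R).

Local Open Scope ereal_scope.

Notation leb := (@lebesgue_measure R).

(* For nonnegative [F]: the contributions of the vertices in [A], and of the
   intersections of the open edges with [A]. *)
Definition vertex_int (A : set (gpoint G)) (F : gpoint G -> \bar R) : \bar R :=
  \esum_(x in [set x : vertex G | A (Vtx x)]) ((mu x)%:E * F (Vtx x)).

Definition edge_int (A : set (gpoint G)) (F : gpoint G -> \bar R) : \bar R :=
  \esum_(e in [set: edge G])
    \int[leb]_(s in `]0%R, len e[ `&` pt e @^-1` A) F (pt e s).

Definition graph_int_ge0 (F : gpoint G -> \bar R) : \bar R :=
  vertex_int setT F + edge_int setT F.

(* As for the library's integral, [graph_int f] is only meaningful if the
   integral of the positive or of the negative part of [f] is finite; it is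
   [-oo] otherwise. *)
Definition graph_int (f : gpoint G -> R) : \bar R :=
  graph_int_ge0 (EFin \o f)^\+ - graph_int_ge0 (EFin \o f)^\-.

Definition graph_measurable (f : gpoint G -> R) : Prop :=
  forall e : edge G, measurable_fun `]0%R, len e[ (f \o pt e).

Definition graph_integrable (f : gpoint G -> R) : Prop :=
  graph_measurable f /\ graph_int_ge0 (fun x => `|f x|%:E) < +oo.

(* The prefix [st_] stands for space-time; measurability is joint. *)
Definition st_measurable (F : gpoint G -> R -> R) : Prop :=
  (forall x : vertex G, measurable_fun `[(0%R : R), +oo[ (F (Vtx x))) /\
  (forall e : edge G,
     measurable_fun (`]0%R, len e[ `*` `[(0%R : R), +oo[)
       (fun p : R * R => F (pt e p.1) p.2)).

Definition st_int (F : gpoint G -> R -> R) : \bar R :=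
  \int[leb]_(t in `[0%R, +oo[) graph_int (F^~ t).

Definition st_integrable (F : gpoint G -> R -> R) : Prop :=
  {ae leb, forall t, (0 <= t)%R -> graph_integrable (F^~ t)} /\
  leb.-integrable `[0%R, +oo[ (fun t => graph_int (F^~ t)).

Definition X_norm (x0 : vertex G) (alpha : R) (f : gpoint G -> R) : \bar R :=
  graph_int_ge0 (fun x => (expR (- alpha * gdist x (Vtx x0)) * `|f x|)%:E).

Definition in_X (x0 : vertex G) (alpha : R) (f : gpoint G -> R) : Prop :=
  graph_measurable f /\ X_norm x0 alpha f < +oo.

(* [L^1_loc ([0, +oo[; X_alpha)], with [L^1 (]0, T[; L^1 (nu))] identified as
   usual with [L^1] of the product measure. *)
Definition in_L1loc_X (x0 : vertex G) (alpha : R) (u : gpoint G -> R -> R) : Prop :=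
  st_measurable u /\
  forall T : R, (0 < T)%R ->
    \int[leb]_(t in `[0%R, T]) X_norm x0 alpha (u^~ t) < +oo.

End integration.

Section very_weak_solutions.
Context (R : realType) (G : metricGraph R).
Context (mu : vertex G -> R) (omega : vertex G -> vertex G -> R).

Notation leb := (@lebesgue_measure R).

Definition vertex_laplacian (f : gpoint G -> R) (x : vertex G) : R :=
  (mu x)^-1 * \sum_(y \in [set y | adj x y]) omega x y * (f (Vtx y) - f (Vtx x)).

Definition edge_deriv2 (f : gpoint G -> R) (e : edge G) : R -> R :=
  iter 2 (deriv_on `]0, len e[) (f \o pt e).

(* Integrating [g * laplacian f] with [graph_int] adds the vertex and the edge
   contributions. *)
Definition laplacian (f : gpoint G -> R) (x : gpoint G) : R :=
  match x with
  | Vtx v => vertex_laplacian f v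
  | Inner e s => edge_deriv2 f e (val s)
  end.

(* The class [D(G)].  As [edge_deriv2 f e] is continuous on the open edge,
   it is in [L^oo] as soon as it is essentially bounded. *)
Definition class_D (f : gpoint G -> R) : Prop :=
  forall e : edge G,
    [/\ {within `[0, len e], continuous (f \o pt e)},
        Ck_on `]0, len e[ 2 (f \o pt e),
        Ck_on `[0, len e] 1 (f \o pt e) &
        exists M : R, {ae leb, forall s, s \in `]0, len e[ ->
                                 `|edge_deriv2 f e s| <= M} ].

(* A loop at [x] contributes through both of its ends. *)
Definition kirchhoff (f : gpoint G -> R) (x : vertex G) : R :=
  \sum_(e \in [set e : edge G | final e = x])
     deriv_on `[0, len e] (f \o pt e) (len e)
  - \sum_(e \in [set e : edge G | initial e = x])
     deriv_on `[0, len e] (f \o pt e) 0.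

Definition time_deriv (phi : gpoint G -> R -> R) (x : gpoint G) : R -> R :=
  deriv_on `[0, +oo[ (phi x).

Definition time_deriv2 (phi : gpoint G -> R -> R) (x : gpoint G) : R -> R :=
  iter 2 (deriv_on `[0, +oo[) (phi x).

Definition test_function (phi : gpoint G -> R -> R) : Prop :=
  [/\ forall x t, 0 <= t -> 0 <= phi x t,
      exists (T : R) (A : set (gpoint G)),
        [/\ 0 < T, compact A &
            closure [set p : gpoint G * R | 0 <= p.2 /\ phi p.1 p.2 != 0]
              `<=` A `*` `[0, T]],
      forall x, Ck_on `[0, +oo[ 2 (phi x) &
      st_measurable phi].

(* The inequality is required of those test functions for which the (iterated)
   integrals of its sign-changing terms exist; the remaining term, which is
   nonnegative, may a priori be infinite. *)
Definition very_weak_solution (sigma : R) (h : gpoint G -> R -> R)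
    (u0 u1 : gpoint G -> R) (u : gpoint G -> R -> R) : Prop :=
  [/\ forall x (T : R), 0 < T ->
        leb.-integrable `[0, T] (EFin \o u x) /\
        (\int[leb]_(t in `[0%R, T]) (`|u x t| `^ sigma * h x t)%:E < +oo)%E,
      forall t, 0 <= t ->
        class_D (u^~ t) /\ forall x : vertex G, kirchhoff (u^~ t) x = 0 &
      forall phi, test_function phi ->
        let phitt_u x t := time_deriv2 phi x t * u x t in
        let phi_lap x t := phi x t * laplacian (u^~ t) x in
        let h_u_phi x t := h x t * `|u x t| `^ sigma * phi x t in
        let u1_phi x := u1 x * phi x 0 in
        let u0_phit x := u0 x * time_deriv phi x 0 in
        st_integrable mu phitt_u -> st_integrable mu phi_lap ->
        graph_integrable mu u1_phi -> graph_integrable mu u0_phit ->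
        (- st_int mu phitt_u + st_int mu phi_lap + st_int mu h_u_phi
         + graph_int mu u1_phi - graph_int mu u0_phit <= 0)%E].

End very_weak_solutions.

(* Main.v *)
Require Import Defs.
From HB Require Import structures.
From mathcomp Require Import all_boot all_order all_algebra.
From mathcomp Require Import all_classical all_reals all_analysis.
From mathcomp Require Import measurable_realfun.
From mathcomp Require Import ring lra.

Set Implicit Arguments.
Unset Strict Implicit.
Unset Printing Implicit Defensive.

Import Order.TTheory GRing.Theory Num.Theory.
Import numFieldNormedType.Exports.

Local Open Scope classical_set_scope.
Local Open Scope ring_scope.

(** Write [d x] for the distance from [x] to [x0].  Given [rho], the solution is
    tested against [xi x * psi t].  Here [psi] (defined as [cutoff]) equals [1] up to
    time [T], the square root of [rho], and [0] after [2 * T].  The function [xi]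
    (defined as [interp] of [cutoff_val]) equals [1] for [d x < rho], decays like
    [expR (- alpha * d x)] with [alpha = delta / rho] further away, and vanishes at
    vertices with [N < d x]; on an edge, it interpolates the values at the vertices by
    a cubic polynomial with zero slope at both ends.

    Since [xi] is flat at the vertices, where the fluxes of [u] add up to [0],
    integrating by parts twice on each edge moves the Laplacian from [u] to [xi]
    without any boundary term ([graph_by_parts]).  Therefore ([weak_inequality]) the
    integral of [h * |u| ^ sigma * xi * psi] plus the integral of [u1 * xi] is at most
    the integral of [|u| * (|psi''| * xi + psi * |Delta xi|)].

    This last integrand vanishes on the cylinder [d x < rho], [t < T].  Outside of it,
    [psi''] is of order [1 / rho] since [T ^ 2 = rho] ([cutoff2_bound]), and
    [Delta xi] is of order [xi / rho] because the decay rate is [delta / rho] and the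
    lengths of the edges are bounded ([lap_xi_le]).  The exception is the region
    [N - j < d x], where the truncation only leaves a bound by [expR (- alpha * d x)];
    as [u] belongs to the weighted space, its contribution tends to [0] as [N] grows.
    By Young's inequality ([young_cutoff]) the right-hand side is at most [lam] times
    the integral of [h * |u| ^ sigma * xi * psi] outside of the cylinder, plus a
    constant times [lam] to the power [- 1 / (sigma - 1)]: the growth conditions on [h]
    say exactly that this constant is independent of [rho] ([scale_inequality]).

    With [lam = 1 / 2], the first term is absorbed, and letting [rho] tend to infinity
    shows that [h * |u| ^ sigma] is integrable in space-time.  Its integral outside of
    the cylinder then tends to [0], so that the integral of [h * |u| ^ sigma] plus that
    of [u1] is at most a constant times the above power of [lam], for every [lam].  As
    [lam] grows, and since [u1] has a nonnegative integral, the integral of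
    [h * |u| ^ sigma] is [0] ([st_int_ge0_eq0_of_tail_bound]).  Finally, [h] is
    positive, hence at almost every time [u] vanishes at the vertices and almost
    everywhere on the edges, and by continuity it vanishes everywhere. *)

(** * Sums over countable types *)

Section countable_sums.
Local Open Scope ereal_scope.
Context (R : realType).

(** Brings the theory of series, hence measurability of limits, to sums over
    countable types: [pickle_inv] reaches every index exactly once. *)
Lemma esum_countType (T : countType) (a : T -> \bar R) :
  (forall x, 0 <= a x) ->
  \esum_(x in [set: T]) a x =
  \sum_(n <oo) (if pickle_inv n is Some x then a x else 0).
Proof.
move=> a0; pose b n := if @pickle_inv T n is Some x then a x else 0.
have b0 n : 0 <= b n by rewrite /b; case: pickle_inv.
rewrite nneseries_esumT// -/b.
have -> : \esum_(i in [set: nat]) b i = \esum_(i in range (@pickle T)) b i.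
  rewrite [RHS]esum_mkcond; apply: eq_esum => n _.
  case: ifPn => // /negP; rewrite inE /b => nT.
  case E : pickle_inv => [x|//]; exfalso; apply: nT; exists x => //.
  by have := @pickle_invK T n; rewrite /ocancel/= E.
rewrite (reindex_esum setT (range (@pickle T)) (@pickle T)).
  by apply: eq_esum => x _; rewrite /b pickleK_inv.
apply/inj_bij; move=> x y _ _; exact: (pcan_inj pickleK).
Qed.

Lemma emeasurable_fun_esum d (X : measurableType d) (D : set X) (T : countType)
    (a : T -> X -> \bar R) :
  (forall x t, D t -> 0 <= a x t) -> (forall x, measurable_fun D (a x : X -> \bar R)) ->
  measurable D ->
  measurable_fun D (fun t => \esum_(x in [set: T]) a x t).
Proof.
move=> a0 ma mD.
pose b n t := if @pickle_inv T n is Some x then a x t else 0.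
apply: (@eq_measurable_fun _ _ _ _ D (fun t => \sum_(n <oo) b n t)).
  by move=> t; rewrite inE => Dt; rewrite esum_countType// => x; exact: a0.
apply: (emeasurable_fun_cvg (fun k t => \sum_(0 <= i < k) b i t)) => //.
  move=> k; apply: emeasurable_sum => n; rewrite /b.
  by case: pickle_inv => [x|]//; exact: measurable_cst.
move=> t Dt; apply: is_cvg_nneseries => n _ _; rewrite /b.
by case: pickle_inv => // x; exact: a0.
Qed.

(** Monotone convergence: a finite partial sum passes to the limit termwise, and
    both suprema, over the finite sets and over [n], can be exchanged. *)
Lemma cvg_esum (T : choiceType) (a : nat -> T -> \bar R) (l : T -> \bar R) :
  (forall n x, 0 <= a n x) -> (forall x, nondecreasing_seq (a ^~ x)) ->
  (forall x, a ^~ x @ \oo --> l x) ->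
  (fun n => \esum_(x in [set: T]) a n x) @ \oo --> \esum_(x in [set: T]) l x.
Proof.
move=> a0 nda al.
have nd : nondecreasing_seq (fun n => \esum_(x in [set: T]) a n x).
  by move=> m n mn; apply: le_esum => x _; exact: nda.
have al' n x : a n x <= l x.
  have -> : l x = ereal_sup (range (a ^~ x)).
    by apply: (cvg_unique _ (al x)); [exact: ereal_hausdorff|];
      exact: ereal_nondecreasing_cvgn.
  by apply: ereal_sup_ubound; exists n.
have -> : \esum_(x in [set: T]) l x =
    ereal_sup (range (fun n => \esum_(x in [set: T]) a n x)).
  apply/eqP; rewrite eq_le; apply/andP; split; last first.
    apply: ge_ereal_sup => _ [n _ <-]; apply: le_esum => x _; exact: al'.
  apply: ge_ereal_sup => _ [X [finX _] <-].
  rewrite fsbig_finite//=.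
  have cv : (fun n => \sum_(x <- finmap.enum_fset (fset_set X)) a n x) @ \oo -->
      \sum_(x <- finmap.enum_fset (fset_set X)) l x.
    by apply: cvg_nnesum => x _; [exact: nearW|exact: al].
  rewrite -(cvg_lim _ cv)//; apply: lime_le.
    by apply/cvg_ex; eexists; exact: cv.
  apply: nearW => n; apply: (@le_trans _ _ (\esum_(x in [set: T]) a n x)).
    by rewrite -fsbig_finite//; apply: esum_ge; exists X.
  by apply: ereal_sup_ubound; exists n.
exact: ereal_nondecreasing_cvgn.
Qed.

Lemma esumZl (T : choiceType) (a : T -> \bar R) (k : R) :
  (forall x, 0 <= a x) -> (0 <= k)%R ->
  \esum_(x in [set: T]) (k%:E * a x) = k%:E * \esum_(x in [set: T]) a x.
Proof.
move=> a0; rewrite le_eqVlt => /predU1P[<-|k0].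
  by rewrite mul0e esum1// => x _; rewrite mul0e.
have gen (c : R) (b : T -> \bar R) : (0 < c)%R -> (forall x, 0 <= b x) ->
    \esum_(x in [set: T]) (c%:E * b x) <= c%:E * \esum_(x in [set: T]) b x.
  move=> c0 b0; apply: ge_ereal_sup => _ [X [finX _] <-].
  rewrite fsbig_finite//= -ge0_sume_distrr//.
  rewrite lee_pmul2l// -fsbig_finite//; apply: esum_ge; exists X => //.
apply/eqP; rewrite eq_le gen//=.
rewrite -lee_pdivlMl//.
have := @gen k^-1%R (fun x => k%:E * a x).
rewrite invr_gt0 => /(_ k0) => H.
rewrite (le_trans _ (H _))//; last by move=> x; rewrite mule_ge0// lee_fin ltW.
apply: le_esum => x _.
by rewrite muleA -EFinM mulVf ?gt_eqF// mul1e.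
Qed.

End countable_sums.

(** * Integration on the graph *)

Section graph_integral.
Local Open Scope ereal_scope.
Context (R : realType) (G : metricGraph R) (mu : vertex G -> R).
Hypothesis mu0 : forall x, (0 < mu x)%R.

Notation leb := (@lebesgue_measure R).
Notation gi := (graph_int_ge0 mu).
Notation gp := (gpoint G).

Definition graph_emeasurable (F : gp -> \bar R) :=
  forall e, measurable_fun `]0%R, len e[ (fun s => F (pt e s) : \bar R).

Definition st_emeasurable (F : gp -> R -> \bar R) :=
  (forall v, measurable_fun `[(0%R : R), +oo[ (fun t : R => F (Vtx v) t : \bar R)) /\
  (forall e, measurable_fun (`]0%R, len e[ `*` `[(0%R : R), +oo[)
               (fun p : R * R => F (pt e p.1) p.2 : \bar R)).

Lemma st_measurable_EFin (f : gp -> R -> R) :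
  st_measurable f -> st_emeasurable (fun x t => (f x t)%:E).
Proof. by move=> [fv fe]; split=> [v|e]; apply/measurable_EFinP. Qed.

Lemma graph_int_ge0E (F : gp -> \bar R) : gi F =
  \esum_(v in [set: vertex G]) ((mu v)%:E * F (Vtx v)) +
  \esum_(e in [set: edge G]) \int[leb]_(s in `]0%R, len e[) F (pt e s).
Proof.
rewrite /graph_int_ge0 /vertex_int /edge_int; congr (_ + _).
by apply: eq_esum => e _; rewrite preimage_setT setIT.
Qed.

Lemma graph_int_ge0_ge0 (F : gp -> \bar R) : (forall x, 0 <= F x) -> 0 <= gi F.
Proof.
move=> F0; rewrite adde_ge0 ?esum_ge0// => [v _|e _]; last exact: integral_ge0.
by rewrite mule_ge0// lee_fin ltW.
Qed.

Lemma le_graph_int_ge0 (F1 F2 : gp -> \bar R) : graph_emeasurable F1 -> graph_emeasurable F2 ->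
  (forall x, 0 <= F1 x) -> (forall x, F1 x <= F2 x) -> gi F1 <= gi F2.
Proof.
move=> m1 m2 F10 F12; rewrite !graph_int_ge0E leeD// le_esum// => i _.
  by rewrite lee_pmul2l ?lte_fin.
by apply: ge0_le_integral => //; [exact: m1|exact: m2].
Qed.

Lemma graph_int_ge0D (F1 F2 : gp -> \bar R) : graph_emeasurable F1 -> graph_emeasurable F2 ->
  (forall x, 0 <= F1 x) -> (forall x, 0 <= F2 x) ->
  gi (fun x => F1 x + F2 x) = gi F1 + gi F2.
Proof.
move=> m1 m2 F10 F20; rewrite !graph_int_ge0E addeACA; congr (_ + _).
  rewrite -esumD; last 2 first.
  - by move=> v _; rewrite mule_ge0// lee_fin ltW.
  - by move=> v _; rewrite mule_ge0// lee_fin ltW.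
  by apply: eq_esum => v _; rewrite ge0_muleDr.
rewrite -esumD; last 2 first.
- by move=> e _; apply: integral_ge0.
- by move=> e _; apply: integral_ge0.
apply: eq_esum => e _; rewrite ge0_integralD//.
- exact: m1.
- exact: m2.
Qed.

Lemma graph_int_ge0Z (F : gp -> \bar R) (k : R) : graph_emeasurable F ->
  (forall x, 0 <= F x) -> (0 <= k)%R ->
  gi (fun x => k%:E * F x) = k%:E * gi F.
Proof.
move=> mF F0 k0; rewrite !graph_int_ge0E ge0_muleDr; last 2 first.
- by apply: esum_ge0 => v _; rewrite mule_ge0// lee_fin ltW.
- by apply: esum_ge0 => e _; apply: integral_ge0.
rewrite -!esumZl//; last 2 first.
- by move=> e; apply: integral_ge0.
- by move=> v; rewrite mule_ge0// lee_fin ltW.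
congr (_ + _); apply: eq_esum => i _; first by rewrite muleCA.
by rewrite ge0_integralZl//; exact: mF.
Qed.

Lemma cvg_graph_int_ge0 (F : nat -> gp -> \bar R) (L : gp -> \bar R) :
  (forall n, graph_emeasurable (F n)) -> (forall n x, 0 <= F n x) ->
  (forall x, nondecreasing_seq (F ^~ x)) -> (forall x, F ^~ x @ \oo --> L x) ->
  (fun n => gi (F n)) @ \oo --> gi L.
Proof.
move=> mF F0 ndF FL; rewrite graph_int_ge0E.
under eq_cvg do rewrite graph_int_ge0E.
have L0 x : 0 <= L x.
  rewrite -(cvg_lim _ (FL x))//; apply: lime_ge.
    by apply/cvg_ex; eexists; exact: FL.
  by apply: nearW => n; exact: F0.
apply: cvgeD.
- apply: ge0_adde_def; rewrite inE; apply: esum_ge0 => i _.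
    by rewrite mule_ge0// lee_fin ltW.
  exact: integral_ge0.
- apply: (@cvg_esum _ _ (fun n v => (mu v)%:E * F n (Vtx v))).
  + by move=> n v; rewrite mule_ge0// lee_fin ltW.
  + by move=> v m n mn; rewrite lee_pmul2l ?lte_fin//; exact: ndF.
  + by move=> v; apply: cvgeZl.
- apply: (@cvg_esum _ _ (fun n e => \int[leb]_(s in `]0%R, len e[) F n (pt e s))).
  + by move=> n e; apply: integral_ge0.
  + move=> e m n mn; apply: ge0_le_integral => //.
    * exact: mF.
    * exact: mF.
    * by move=> s _; exact: ndF.
  + move=> e.
    have -> : \int[leb]_(s in `]0%R, len e[) L (pt e s) =
        \int[leb]_(s in `]0%R, len e[) limn (fun n => F n (pt e s)).
      by apply: eq_integral => s _; rewrite (cvg_lim _ (FL _)).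
    apply: cvg_monotone_convergence => //.
    by move=> n; exact: mF.

Qed.

Lemma graph_int_ge0_0 : gi (fun=> 0) = 0.
Proof.
by rewrite graph_int_ge0E !esum1 ?adde0// => i _; rewrite ?mule0// integral0.
Qed.

Lemma st_emeasurable_section (F : gp -> R -> \bar R) t :
  st_emeasurable F -> (0 <= t)%R -> graph_emeasurable (F ^~ t).
Proof.
move=> [_ Fe] t0 e.
have : measurable_fun setT
    ((fun p : R * R => F (pt e p.1) p.2 : \bar R) \_ (`]0%R, len e[ `*` `[(0%R : R), +oo[)).
  by apply/(measurable_restrictT _ _).1 => //; apply: measurableX.
move=> /(measurable_fun_pair1 t) H.
apply: (eq_measurable_fun _ _ (measurable_funTS H)) => s.
by rewrite inE => sI; rewrite patchE mem_set//=; split => //=; rewrite in_itv/= t0.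
Qed.

Lemma measurable_vertex_int (F : gp -> R -> \bar R) :
  st_emeasurable F -> (forall x (t : R), (0 <= t)%R -> 0 <= F x t) ->
  measurable_fun `[(0%R : R), +oo[ (fun t : R => vertex_int mu setT (F ^~ t) : \bar R).
Proof.
move=> mF F0; apply: emeasurable_fun_esum => //.
  move=> v t; rewrite /= in_itv/= andbT => t0.
  by rewrite mule_ge0 ?F0// lee_fin ltW.
by move=> v; apply: measurable_funeM; exact: mF.1.
Qed.

(** On each edge this is the measurability part of Tonelli's theorem, for the
    extension by [0] of [F] outside of the edge. *)
Lemma measurable_edge_int (F : gp -> R -> \bar R) :
  st_emeasurable F -> (forall x (t : R), (0 <= t)%R -> 0 <= F x t) ->
  measurable_fun `[(0%R : R), +oo[ (fun t : R => edge_int setT (F ^~ t) : \bar R).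
Proof.
move=> mF F0.
have t0 (t : R) : `[(0%R : R), +oo[%classic t -> (0 <= t)%R.
  by rewrite /= in_itv/= andbT.
apply: emeasurable_fun_esum => //.
  by move=> e t /t0 ?; apply: integral_ge0 => s _; exact: F0.
move=> e.
pose g := (fun p : R * R => F (pt e p.1) p.2 : \bar R) \_
   (`]0%R, len e[ `*` `[(0%R : R), +oo[).
have mg : measurable_fun setT g.
  by apply/(measurable_restrictT _ _).1; [exact: measurableX|exact: mF.2].
have g0 p : 0 <= g p.
  rewrite /g patchE; case: ifPn => //; rewrite inE => -[_ /= ].
  by rewrite in_itv/= andbT => ?; exact: F0.
apply: (eq_measurable_fun (fubini_G leb g)); last first.
  exact/measurable_funTS/measurable_fun_fubini_tonelli_G.
move=> t; rewrite inE => tI; rewrite /fubini_G [RHS]integral_mkcond.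
apply: eq_integral => s _; rewrite /g !patchE preimage_setT setIT.
case: ifPn => [|/negP]; rewrite inE.
  by move=> -[/= sI _]; rewrite mem_set.
move=> sI; rewrite ifF//; apply/negP; rewrite inE => sI'; apply: sI; split => //.
Qed.

Lemma measurable_graph_int_ge0 (F : gp -> R -> \bar R) :
  st_emeasurable F -> (forall x (t : R), (0 <= t)%R -> 0 <= F x t) ->
  measurable_fun `[(0%R : R), +oo[ (fun t : R => gi (F ^~ t) : \bar R).
Proof.
move=> mF F0; apply: emeasurable_funD; first exact: measurable_vertex_int.
exact: measurable_edge_int.
Qed.

Definition st_int_ge0 (F : gp -> R -> \bar R) : \bar R :=
  \int[leb]_(t in `[(0%R : R), +oo[) gi (F ^~ t).

Let itv0 (t : R) : `[(0%R : R), +oo[%classic t -> (0 <= t)%R.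
Proof. by rewrite /= in_itv/= andbT. Qed.

Lemma st_int_ge0_ge0 (F : gp -> R -> \bar R) :
  (forall x (t : R), (0 <= t)%R -> 0 <= F x t) -> 0 <= st_int_ge0 F.
Proof.
by move=> F0; apply: integral_ge0 => t /itv0 ?; apply: graph_int_ge0_ge0 => x; exact: F0.
Qed.

Lemma le_st_int_ge0 (F1 F2 : gp -> R -> \bar R) : st_emeasurable F1 -> st_emeasurable F2 ->
  (forall x (t : R), (0 <= t)%R -> 0 <= F1 x t) ->
  (forall x (t : R), (0 <= t)%R -> F1 x t <= F2 x t) -> st_int_ge0 F1 <= st_int_ge0 F2.
Proof.
move=> m1 m2 F10 F12; apply: ge0_le_integral => //.
- by move=> t /itv0 ?; apply: graph_int_ge0_ge0 => x; exact: F10.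
- exact: measurable_graph_int_ge0.
- apply: measurable_graph_int_ge0 => // x t t0.
  exact: le_trans (F10 x t t0) (F12 x t t0).
- move=> t /itv0 t0; apply: le_graph_int_ge0 => [||x|x].
  + exact: st_emeasurable_section.
  + exact: st_emeasurable_section.
  + exact: F10.
  + exact: F12.
Qed.

Lemma eq_st_int_ge0 (F1 F2 : gp -> R -> \bar R) :
  (forall x (t : R), (0 <= t)%R -> F1 x t = F2 x t) -> st_int_ge0 F1 = st_int_ge0 F2.
Proof.
move=> F12; apply: eq_integral => t; rewrite inE => /itv0 t0.
by congr gi; apply/funext => x; exact: F12.
Qed.

Lemma st_int_ge0D (F1 F2 : gp -> R -> \bar R) : st_emeasurable F1 -> st_emeasurable F2 ->
  (forall x (t : R), (0 <= t)%R -> 0 <= F1 x t) ->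
  (forall x (t : R), (0 <= t)%R -> 0 <= F2 x t) ->
  st_int_ge0 (fun x t => F1 x t + F2 x t) = st_int_ge0 F1 + st_int_ge0 F2.
Proof.
move=> m1 m2 F10 F20; rewrite -ge0_integralD//.
- apply: eq_integral => t; rewrite inE => /itv0 t0.
  rewrite graph_int_ge0D// => [||x|x].
  + exact: st_emeasurable_section.
  + exact: st_emeasurable_section.
  + exact: F10.
  + exact: F20.
- by move=> t /itv0 ?; apply: graph_int_ge0_ge0 => x; exact: F10.
- exact: measurable_graph_int_ge0.
- by move=> t /itv0 ?; apply: graph_int_ge0_ge0 => x; exact: F20.
- exact: measurable_graph_int_ge0.
Qed.

Lemma st_int_ge0Z (F : gp -> R -> \bar R) (k : R) : st_emeasurable F ->
  (forall x (t : R), (0 <= t)%R -> 0 <= F x t) -> (0 <= k)%R ->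
  st_int_ge0 (fun x t => k%:E * F x t) = k%:E * st_int_ge0 F.
Proof.
move=> mF F0 k0; rewrite -ge0_integralZl//.
- apply: eq_integral => t; rewrite inE => /itv0 t0.
  by rewrite graph_int_ge0Z// => [|x]; [exact: st_emeasurable_section|exact: F0].
- exact: measurable_graph_int_ge0.
- by move=> t /itv0 ?; apply: graph_int_ge0_ge0 => x; exact: F0.
Qed.

Lemma cvg_st_int_ge0 (F : nat -> gp -> R -> \bar R) (L : gp -> R -> \bar R) :
  (forall n, st_emeasurable (F n)) -> (forall n x (t : R), (0 <= t)%R -> 0 <= F n x t) ->
  (forall x (t : R), (0 <= t)%R -> nondecreasing_seq (fun n => F n x t)) ->
  (forall x (t : R), (0 <= t)%R -> (fun n => F n x t) @ \oo --> L x t) ->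
  (fun n => st_int_ge0 (F n)) @ \oo --> st_int_ge0 L.
Proof.
move=> mF F0 ndF FL.
have -> : st_int_ge0 L = \int[leb]_(t in `[(0%R : R), +oo[) limn (fun n => gi ((F n) ^~ t)).
  apply: eq_integral => t; rewrite inE => /itv0 t0; apply/esym/cvg_lim => //.
  apply: (@cvg_graph_int_ge0 (fun n x => F n x t)) => [n|n x|x|x].
  - exact: st_emeasurable_section.
  - exact: F0.
  - exact: ndF.
  - exact: FL.
apply: cvg_monotone_convergence => //.
- by move=> n; apply: measurable_graph_int_ge0 => // x t; exact: F0.
- by move=> n t /itv0 ?; apply: graph_int_ge0_ge0 => x; exact: F0.
- move=> t /itv0 t0 m n mn; apply: le_graph_int_ge0 => [||x|x].
  + exact: st_emeasurable_section.
  + exact: st_emeasurable_section.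
  + exact: F0.
  + exact: ndF.
Qed.

End graph_integral.

(** * Signed integrals and the limiting argument *)

Section signed_integrals.
Local Open Scope ereal_scope.
Context (R : realType) (G : metricGraph R) (mu : vertex G -> R).
Hypothesis mu0 : forall x, (0 < mu x)%R.

Notation leb := (@lebesgue_measure R).
Notation gi := (graph_int_ge0 mu).
Notation gp := (gpoint G).

Let itv0 (t : R) : `[(0%R:R), +oo[%classic t -> (0 <= t)%R.
Proof. by rewrite /= in_itv/= andbT. Qed.

Lemma le_esum_term (T : choiceType) (a : T -> \bar R) x :
  a x <= \esum_(y in [set: T]) a y.
Proof.
apply: esum_ge; exists [set x]; first by split; [exact: finite_set1|].
by rewrite fsbig_set1.
Qed.

Lemma funepos_EFin (T : Type) (f : T -> R) :
  (EFin \o f)^\+ = fun x => (Num.max (f x) 0%R)%:E.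
Proof. by apply/funext => x; rewrite funeposE EFin_max. Qed.

Lemma funeneg_EFin (T : Type) (f : T -> R) :
  (EFin \o f)^\- = fun x => (Num.max (- f x)%R 0%R)%:E.
Proof. by apply/funext => x; rewrite funenegE EFin_max. Qed.

Lemma st_measurable_pos (f : gp -> R -> R) :
  st_measurable f -> st_measurable (fun x t => Num.max (f x t) 0%R).
Proof.
by move=> [fv fe]; split => [v|e]; exact: measurable_maxr.
Qed.

Lemma st_measurableN (f : gp -> R -> R) :
  st_measurable f -> st_measurable (fun x t => - f x t)%R.
Proof. by move=> [fv fe]; split => [v|e]; exact: measurableT_comp. Qed.

Lemma graph_emeasurable_pos (f : gp -> R) : graph_measurable f -> graph_emeasurable (EFin \o f)^\+.
Proof.
move=> mf e; rewrite funepos_EFin.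
have /measurable_EFinP : measurable_fun `]0%R, len e[ (fun s => Num.max (f (pt e s)) 0%R).
  by apply: measurable_maxr => //; exact: mf.
by [].
Qed.

Lemma graph_emeasurable_neg (f : gp -> R) : graph_measurable f -> graph_emeasurable (EFin \o f)^\-.
Proof.
move=> mf e; rewrite funeneg_EFin.
have /measurable_EFinP : measurable_fun `]0%R, len e[ (fun s => Num.max (- f (pt e s))%R 0%R).
  by apply: measurable_maxr => //; apply: measurableT_comp => //; exact: mf.
by [].
Qed.

Lemma graph_int_ge0_abs (f : gp -> R) : graph_measurable f ->
  gi (EFin \o f)^\+ + gi (EFin \o f)^\- = gi (fun x => `|f x|%:E).
Proof.
move=> mf; rewrite -graph_int_ge0D//; [|exact: graph_emeasurable_pos|exact: graph_emeasurable_neg].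
by congr gi; rewrite -[LHS]/(_ \+ _) -fune_abse.
Qed.

Lemma abse_graph_int (f : gp -> R) : graph_measurable f ->
  `|graph_int mu f| <= gi (fun x => `|f x|%:E).
Proof.
move=> mf; rewrite -graph_int_ge0_abs// (le_trans (lee_abs_sub _ _))//.
by rewrite !gee0_abs// graph_int_ge0_ge0.
Qed.

Lemma st_measurable_section (f : gp -> R -> R) t :
  st_measurable f -> (0 <= t)%R -> graph_measurable (f ^~ t).
Proof.
move=> /st_measurable_EFin mf t0 e; apply/measurable_EFinP.
exact: (st_emeasurable_section mf t0).
Qed.

Lemma st_measurable_abs (f : gp -> R -> R) :
  st_measurable f -> st_measurable (fun x t => `|f x t|)%R.
Proof. by move=> [fv fe]; split => [v|e]; exact: measurableT_comp. Qed.

(** A time integral that is finite is the integral of a function finite almost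
    everywhere; hence the integrability in space at almost every time. *)
Lemma st_integrable_abs (f : gp -> R -> R) : st_measurable f ->
  st_int_ge0 mu (fun x t => `|f x t|%:E) < +oo ->
  st_integrable mu f /\
  `|st_int mu f| <= st_int_ge0 mu (fun x t => `|f x t|%:E).
Proof.
move=> mf foo.
have maf := st_measurable_EFin (st_measurable_abs mf).
have mga := measurable_graph_int_ge0 mu0 maf (fun x t _ => ltac:(by rewrite lee_fin)).
have mgi : measurable_fun `[(0%R : R), +oo[ (fun t : R => graph_int mu (f ^~ t) : \bar R).
  have -> : (fun t => graph_int mu (f ^~ t)) = (fun t =>
      gi (fun x => (Num.max (f x t) 0%R)%:E) -
      gi (fun x => (Num.max (- f x t)%R 0%R)%:E)).
    by apply/funext => t; rewrite /graph_int funepos_EFin funeneg_EFin.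
  have mp := st_measurable_EFin (st_measurable_pos mf).
  have mn := st_measurable_EFin (st_measurable_pos (st_measurableN mf)).
  apply: emeasurable_funB.
    by apply: (measurable_graph_int_ge0 mu0 mp) => x t _; rewrite lee_fin le_max lexx orbT.
  by apply: (measurable_graph_int_ge0 mu0 mn) => x t _; rewrite lee_fin le_max lexx orbT.
have lea (t : R) : (0 <= t)%R -> `|graph_int mu (f ^~ t)| <= gi (fun x => `|f x t|%:E).
  by move=> t0; apply: abse_graph_int; exact: st_measurable_section.
have gi0 t : 0 <= gi (fun x => `|f x t|%:E) by apply: graph_int_ge0_ge0.
have iga : leb.-integrable `[(0%R : R), +oo[ (fun t => gi (fun x => `|f x t|%:E)).
  apply/integrableP; split => //.
  by under eq_integral do rewrite gee0_abs//.
split; [split|].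
- apply: filterS (integrable_ae _ iga) => // t H t0.
  split; first exact: st_measurable_section.
  by rewrite -ge0_fin_numE//; apply: H; rewrite /= in_itv/= t0.
- apply: le_integrable iga => // t /itv0 t0.
  by rewrite [leRHS]gee0_abs// lea.
- apply: (le_trans (le_abse_integral leb _ mgi)) => //.
  apply: ge0_le_integral => //; first exact: measurableT_comp.
  by move=> t /itv0 t0; exact: lea.
Qed.

(** If the truncated integrals over an exhausting sequence of space-time sets are
    controlled by a small multiple of themselves, they are bounded; the tails then tend to [0], and the same
    inequality, read with the tail on the right and an arbitrarily large factor,
    forces the whole integral to vanish. *)
Lemma st_int_ge0_eq0_of_tail_bound (F : gp -> R -> \bar R) (S : nat -> gp -> R -> bool)
    (p : nat -> \bar R) (P : \bar R) (m : R) (kappa : R -> R) (k0 : nat) :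
  st_emeasurable F -> (forall x (t : R), (0 <= t)%R -> 0 <= F x t) ->
  (forall n, st_emeasurable (fun x t => F x t * (S n x t)%:R%:E)) ->
  (forall n, st_emeasurable (fun x t => F x t * (~~ S n x t)%:R%:E)) ->
  (forall n x t, S n x t -> S n.+1 x t) ->
  (forall x (t : R), (0 <= t)%R -> exists n, S n x t) ->
  (forall k, 0 <= p k) -> p @ \oo --> P -> m%:E <= P ->
  (forall eps : R, (0 < eps)%R -> exists2 lam, (0 < lam)%R & (kappa lam <= eps)%R) ->
  (forall (lam : R) k, (0 < lam)%R -> (k0 <= k)%N -> exists X : \bar R,
    [/\ st_int_ge0 mu (fun x t => F x t * (S k x t)%:R%:E) <= X, X < +oo,
        X + p k <= lam%:E * X + (kappa lam + m)%:E &
        X + p k <= lam%:E * st_int_ge0 mu (fun x t => F x t * (~~ S k x t)%:R%:E)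
                   + (kappa lam + m)%:E ]) ->
  st_int_ge0 mu F = 0.
Proof.
move=> mF F0 mFS mFSc S1 Sex p0 pP mP kap0 H.
have Smono x t a b : (a <= b)%N -> S a x t -> S b x t.
  by move=> /subnK <-; elim: (b - a)%N => [//|n IH] /IH; exact: S1.
pose a k := st_int_ge0 mu (fun x t => F x t * (S k x t)%:R%:E).
pose b k := st_int_ge0 mu (fun x t => F x t * (~~ S k x t)%:R%:E).
have FS0 k x (t : R) :  (0 <= t)%R -> 0 <= F x t * (S k x t)%:R%:E.
  by move=> t0; rewrite mule_ge0 ?F0// lee_fin.
have FSc0 k x (t : R) :  (0 <= t)%R -> 0 <= F x t * (~~ S k x t)%:R%:E.
  by move=> t0; rewrite mule_ge0 ?F0// lee_fin.
have a0 k : 0 <= a k by apply: (st_int_ge0_ge0 mu0); exact: FS0.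
have aA : a @ \oo --> st_int_ge0 mu F.
  apply: (cvg_st_int_ge0 mu0 mFS FS0).
    move=> x t t0 i j ij; apply: lee_wpmul2l; first exact: F0.
    rewrite lee_fin; have := @Smono x t _ _ ij.
    by case: (S i x t) => // /(_ isT) ->.
  move=> x t t0; apply: cvg_near_cst.
  have [N SN] := Sex x t t0; exists N => // n /= Nn.
  by rewrite (Smono _ _ _ _ Nn SN) mule1.
have ab k : a k + b k = st_int_ge0 mu F.
  rewrite -(st_int_ge0D mu0 (mFS k) (mFSc k) (FS0 k) (FSc0 k)).
  apply: eq_st_int_ge0 => x t t0; by case: (S k x t); rewrite /= mule1 mule0 ?adde0 ?add0e.
have b0 k : 0 <= b k by apply: (st_int_ge0_ge0 mu0); exact: FSc0.
have A0 : 0 <= st_int_ge0 mu F by exact: (st_int_ge0_ge0 mu0).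
have {}H (lam : R) k : (0 < lam)%R -> (k0 <= k)%N -> exists X : \bar R,
    [/\ a k <= X, X < +oo, X + p k <= lam%:E * X + (kappa lam + m)%:E &
        X + p k <= lam%:E * b k + (kappa lam + m)%:E ] by exact: H.
move: (st_int_ge0 mu F) a b a0 b0 A0 aA ab H => A a b a0 b0 A0 aA ab H.
clear -p0 pP mP kap0 a0 b0 A0 aA ab H.
(* With the factor [1 / 2], half of [X] is absorbed by the other half. *)
have Aoo : A < +oo.
  apply: (@le_lt_trans _ _ (2 * (kappa 2^-1 + m))%:E); last exact: ltry.
  rewrite -(cvg_lim _ aA)//; apply: lime_le.
    by apply/cvg_ex; eexists; exact: aA.
  exists k0 => // k /= kk.
  have [X [aX Xoo + _]] := H 2^-1%R k ltac:(by rewrite invr_gt0) kk.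
  have X0 : 0 <= X := le_trans (a0 k) aX.
  have Xfin : X \is a fin_num by rewrite ge0_fin_numE.
  move=> /(le_trans (leeDl X (p0 k))) XX; apply: le_trans aX _; move: XX.
  rewrite -(fineK Xfin) -EFinM -EFinD !lee_fin; lra.
have Afin : A \is a fin_num by rewrite ge0_fin_numE.
have afin k : a k \is a fin_num.
  by rewrite ge0_fin_numE// (le_lt_trans _ Aoo)// -(ab k) leeDl.
have bE k : b k = A - a k by rewrite -(ab k) addeAC subee// add0e.
(* The tail [b k] tends to [A - A = 0], so that the factor [lam] no longer matters. *)
have lim2 (lam : R) : (0 < lam)%R -> A + P <= (kappa lam + m)%:E.
  move=> lam0.
  have c1 : (fun k => a k + p k) @ \oo --> A + P.
    by apply: cvgeD => //; rewrite ?fin_num_adde_defr.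
  have c2 : (fun k => lam%:E * b k + (kappa lam + m)%:E) @ \oo -->
      lam%:E * (A - A) + (kappa lam + m)%:E.
    apply: cvgeD => //; [by rewrite fin_num_adde_defl| |exact: cvg_cst].
    apply: cvgeZl => //; under eq_cvg do rewrite bE.
    by apply: cvgeB => //; [rewrite fin_num_adde_defr|exact: cvg_cst].
  rewrite subee// mule0 add0e in c2.
  rewrite -(cvg_lim _ c1)// -(cvg_lim _ c2)//; apply: lee_lim.
  - by apply/cvg_ex; eexists; exact: c1.
  - by apply/cvg_ex; eexists; exact: c2.
  - exists k0 => // k /= kk; have [X [aX _ _]] := H lam k lam0 kk.
    by apply: le_trans; exact: leeD2r.
apply/eqP; rewrite eq_le A0 andbT; apply/lee_addgt0Pr => e e0.
have [lam lam0 kl] := kap0 e e0.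
have := lim2 lam lam0; rewrite add0e.
have Pfin : P \is a fin_num.
  rewrite fin_numE; apply/andP; split.
    by rewrite gt_eqF// (lt_le_trans _ mP)// ltNyr.
  apply/eqP => Poo; have := lim2 lam lam0.
  by rewrite Poo addey// ?leye_eq// gt_eqF// (lt_le_trans _ A0).
move: mP; rewrite -(fineK Pfin) -(fineK Afin) -EFinD !lee_fin; lra.
Qed.

End signed_integrals.

(** * Metric and topology of the graph *)

Section distance.
Context (R : realType) (G : metricGraph R).
Notation gp := (gpoint G).
Hypothesis connected_G : graph_connected G.

Lemma pt_le0 (e : edge G) (s : R) : s <= 0 -> pt e s = Vtx (initial e).
Proof.
move=> s0; rewrite /pt insubF ?s0//.
by apply/negbTE/negP => /andP[/lt_le_trans/(_ s0)]; rewrite ltxx.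
Qed.

Lemma pt_ge_len (e : edge G) (s : R) : len e <= s -> pt e s = Vtx (final e).
Proof.
move=> ls; rewrite /pt insubF; last first.
  by apply/negbTE/negP => /andP[_ /lt_le_trans/(_ ls)]; rewrite ltxx.
by rewrite leNgt (lt_le_trans (len_gt0 e) ls).
Qed.

Lemma pt_inner (e : edge G) (s : R) (s_in : 0 < s < len e) :
  pt e s = Inner e (exist _ s s_in).
Proof.
rewrite /pt; case: insubP => [s' _ ss'|]; last by rewrite s_in.
by congr Inner; apply: val_inj.
Qed.

Lemma Inner_pt (e : edge G) (s : {s : R | 0 < s < len e}) :
  Inner e s = pt e (val s).
Proof. by case: s => s s_in; rewrite (pt_inner s_in). Qed.

Lemma walk_cat (x y z : gp) (L M : R) :
  walk x y L -> walk y z M -> walk x z (L + M).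
Proof.
move=> w; elim: w M => {x y L} [x|e s t y L s_in t_in _ IH] M wM.
  by rewrite add0r.
by rewrite -addrA; apply: walk_cons => //; exact: IH.
Qed.

Lemma walk_seg (e : edge G) (s t : R) : 0 <= s <= len e -> 0 <= t <= len e ->
  walk (pt e s) (pt e t) `|s - t|.
Proof.
by move=> s_in t_in; rewrite -[X in walk _ _ X]addr0; apply: walk_cons => //; exact: walk_nil.
Qed.

Lemma walk_sym (x y : gp) (L : R) : walk x y L -> walk y x L.
Proof.
elim=> {x y L} [x|e s t y L s_in t_in _ IH]; first exact: walk_nil.
by rewrite addrC distrC; apply: walk_cat IH _; exact: walk_seg.
Qed.

Lemma walk_ge0 (x y : gp) (L : R) : walk x y L -> 0 <= L.
Proof. by elim=> // {}x s t {}y {}L _ _ _ L0; rewrite addr_ge0. Qed.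

Lemma gdist_has_inf (x y : gp) : has_inf [set L : R | walk x y L].
Proof.
split; first by have [L wL] := connected_G x y; exists L.
by exists 0 => L /= /walk_ge0.
Qed.

Lemma gdist_le (x y : gp) (L : R) : walk x y L -> gdist x y <= L.
Proof. by move=> wL; apply: ge_inf => //; have [] := gdist_has_inf x y. Qed.

Lemma gdist_ge0 (x y : gp) : 0 <= gdist x y.
Proof.
apply: lb_le_inf; first by have [] := gdist_has_inf x y.
by move=> L /= /walk_ge0.
Qed.

Lemma gdist_sym (x y : gp) : gdist x y = gdist y x.
Proof.
by congr inf; apply/seteqP; split => L /= /walk_sym.
Qed.

Lemma gdist_triangle (x y z : gp) : gdist x z <= gdist x y + gdist y z.
Proof.
apply/ler_addgt0Pr => eps eps0.
have [L /= wL Lx] := inf_adherent (divr_gt0 eps0 (ltr0Sn R 1)) (gdist_has_inf x y).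
have [M /= wM My] := inf_adherent (divr_gt0 eps0 (ltr0Sn R 1)) (gdist_has_inf y z).
apply: (le_trans (gdist_le (walk_cat wL wM))).
rewrite /gdist; move: Lx My; set a := inf _; set b := inf _; lra.
Qed.

(** [pt e] is constant on both sides of [0, len e], hence [1]-Lipschitz on [R]. *)
Lemma gdist_pt (e : edge G) (s t : R) : gdist (pt e s) (pt e t) <= `|s - t|.
Proof.
pose c (s : R) := Num.max 0 (Num.min s (len e)).
have l0 := len_gt0 e.
have c_in (r : R) : 0 <= c r <= len e.
  by rewrite /c le_max lexx/= ge_max ge_min lexx orbT ltW.
have ptc (r : R) : pt e r = pt e (c r).
  rewrite /c; have [r0|r0] := leP r 0.
    rewrite !pt_le0// ge_max lexx/= ge_min r0//.
  have [rl|rl] := leP (len e) r.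
    by rewrite !pt_ge_len// le_max lexx orbT.
  by rewrite max_r// ltW.
rewrite (ptc s) (ptc t); apply: le_trans (gdist_le (walk_seg _ _)) _ => //.
have := ler_norm (s - t); have := ler_norm (t - s); rewrite (distrC t s).
move: `|s - t| => D Dt Ds; rewrite /c ler_norml.
case: (leP s (len e)) => ?; case: (leP t (len e)) => ?; rewrite ?(max_r (ltW l0));
  case: (leP 0 s) => ?; case: (leP 0 t) => ?; apply/andP; split; lra.
Qed.

Context (x0 : vertex G).
Notation d := (fun x => gdist x (Vtx x0)).

Lemma dist_gdist (x y : gp) : `|d x - d y| <= gdist x y.
Proof.
rewrite ler_norml; have := gdist_triangle x y (Vtx x0).
have := gdist_triangle y x (Vtx x0); rewrite (gdist_sym y x).
by move=> ? ?; apply/andP; split; lra.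
Qed.

Lemma gdist_pt_continuous (e : edge G) : continuous (fun s : R => d (pt e s)).
Proof.
move=> s; apply/cvgrPdist_le => eps eps0.
have /cvgrPdist_le/(_ _ eps0) : (id : R -> R) @ s --> s by exact: cvg_id.
apply: filterS => t; apply: le_trans.
exact: le_trans (dist_gdist _ _) (gdist_pt _ _ _).
Qed.

Lemma gopenE (U : set gp) : open U <-> gopen U. Proof. by []. Qed.

Lemma pt_continuous (e : edge G) : continuous (pt e).
Proof.
move=> s U; rewrite nbhsE => -[B [oB Bs] BU].
have [r r0 rB] := (gopenE B).1 oB _ Bs.
apply: (filterS (P := ball s r)) => [t st|]; last exact: nbhsx_ballx.
apply/BU/rB; rewrite /gball/=; apply: le_lt_trans (gdist_pt _ _ _) _.
by move: st; rewrite /ball/= distrC.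
Qed.

Lemma closed_gball (rho : R) : closed [set x : gp | d x <= rho].
Proof.
rewrite -openC; apply/gopenE => x /= /negP; rewrite -ltNge => rx.
exists (d x - rho); first by rewrite subr_gt0.
move=> y; rewrite /gball/= => yx; apply/negP; rewrite -ltNge.
have := gdist_triangle x y (Vtx x0); rewrite (gdist_sym x y); move: yx; lra.
Qed.

(** The closed ball is a closed subset of the union of finitely many vertices and
    closed edges, which are the continuous images of segments.  The larger radius
    is there because finiteness is known for open balls. *)
Lemma compact_gball (rho : R) : finite_part (gball (Vtx x0) (rho + 1)) ->
  compact [set x : gp | d x <= rho].
Proof.
move=> [finV finE].
pose V := [set x : vertex G | gball (Vtx x0) (rho + 1) (Vtx x)].
pose E := [set e : edge G | exists s, gball (Vtx x0) (rho + 1) (Inner e s)].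
pose K := (Vtx @` V : set gp) `|`
  \big[setU/set0]_(e <- finmap.enum_fset (fset_set E)) (pt e @` `[0, len e]).
apply: (subclosed_compact (B := K)).
- exact: closed_gball.
- apply: compactU; first by apply: finite_compact; exact: finite_image.
  apply: bigsetU_compact => e _; apply: continuous_compact.
    by apply: continuous_subspaceT => s; exact: pt_continuous.
  exact: segment_compact.
- have lt1 : rho < rho + 1 by rewrite ltrDl.
  move=> [v|e s] /= dx.
    by left; exists v => //; rewrite /V/= /gball/= (le_lt_trans dx).
  right; rewrite -(bigcup_seq (finmap.enum_fset (fset_set E)) (fun e => pt e @` `[0, len e])).
  exists e.
    rewrite /= in_fset_set// inE /E/=; exists s.
    by rewrite /gball/= (le_lt_trans dx).
  exists (val s); last by rewrite -Inner_pt.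
  by rewrite /= in_itv/=; have /andP[/ltW-> /ltW->] := valP s.
Qed.

End distance.

(** * One-sided derivatives and the time cutoff *)

Section derivatives.
Context (R : realType).
Implicit Types (f g : R -> R) (x l : R).

(** The quotients on the right are those of [derivable_on] and [deriv_on], taken
    at a moving point, whereas [is_derive] uses increments. *)
Lemma is_derive_quotP f x l : is_derive x (1 : R) f l <->
  (fun y => (f y - f x) / (y - x)) @ x^' --> l.
Proof.
have sub0 : (fun y => y - x) @ x^' --> (0 : R)^'.
  move=> A A0; change (\forall y \near x, y != x -> A (y - x)).
  change (\forall h \near (0 : R), h != 0 -> A h) in A0.
  have : (fun y => y - x) @ x --> x - x.
    by apply: cvgB; [exact: cvg_id|exact: cvg_cst].
  rewrite subrr => /(_ _ A0) H0.
  have H : \forall y \near x, y - x != 0 -> A (y - x) by exact: H0.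
  apply: filterS H => y /= Ay yx.
  by apply: Ay; rewrite subr_eq0.
have addx : (fun h => h + x) @ (0 : R)^' --> x^'.
  move=> A Ax; change (\forall h \near (0 : R), h != 0 -> A (h + x)).
  change (\forall y \near x, y != x -> A y) in Ax.
  have : (fun h => h + x) @ (0 : R) --> 0 + x.
    by apply: cvgD; [exact: cvg_id|exact: cvg_cst].
  rewrite add0r => /(_ _ Ax) H0.
  have H : \forall h \near (0 : R), h + x != x -> A (h + x) by exact: H0.
  apply: filterS H => y /= Ay y0.
  by apply: Ay; rewrite -subr_eq0 addrK.
split=> [[df dfl]|fl].
  have := cvg_comp _ _ sub0 df; rewrite -/('D_1 f x) dfl.
  apply: cvg_trans; apply: near_eq_cvg; near=> y.
  by rewrite /= scaler1 subrK mulrC.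
have H : (fun h => h^-1 *: ((f \o shift x) (h *: (1 : R)) - f x)) @ (0 : R)^' --> l.
  have := cvg_comp _ _ addx fl.
  apply: cvg_trans; apply: near_eq_cvg; near=> h.
  by rewrite /= addrK scaler1 mulrC.
by split; [apply/cvg_ex; exists l|exact: cvg_lim H].
Unshelve. all: by end_near. Qed.

Lemma within_dnbhs_cvg (I : set R) f g x l : I x -> {in I, f =1 g} ->
  is_derive x (1 : R) g l ->
  (fun y => (f y - f x) / (y - x)) @ within I x^' --> l.
Proof.
move=> Ix fg /is_derive_quotP gl.
apply: (@cvg_trans _ ((fun y => (g y - g x) / (y - x)) @ within I x^')).
  apply: near_eq_cvg; have : within I x^' I by exact: withinT.
  by apply: filterS => y Iy; rewrite !fg// inE.
by apply: cvg_trans gl; apply: cvg_app; exact: cvg_within.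
Qed.

Lemma interior_within_dnbhs (I : set R) x : nbhs x I -> within I x^' = x^'.
Proof.
move=> Ix; rewrite eqEsubset; split; last first.
  move=> A H; change (\forall y \near x, y != x -> A y) in H.
  change (\forall y \near x, y != x -> I y -> A y).
  by apply: filterS H => y H yx _; exact: H.
move=> A H; change (\forall y \near x, y != x -> I y -> A y) in H.
change (\forall y \near x, y != x -> A y).
by apply: filterS2 Ix H => y Iy H yx; exact: H.
Qed.

Lemma derivable_on_is_derive (I : set R) f x : nbhs x I -> derivable_on I f x ->
  is_derive x (1 : R) f (deriv_on I f x).
Proof.
move=> Ix D; apply/is_derive_quotP; move: D; rewrite /derivable_on /deriv_on.
by have -> := interior_within_dnbhs Ix.
Qed.

(** A limit along the punctured neighbourhoods remains a limit along their traces
    on [I], so that a one-sided derivative is computed from any derivable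
    extension. *)
Lemma deriv_on_is_derive (I : set R) f g x l : ProperFilter (within I x^') ->
  I x -> {in I, f =1 g} -> is_derive x (1 : R) g l ->
  derivable_on I f x /\ deriv_on I f x = l.
Proof.
move=> PI Ix fg gl; have H := within_dnbhs_cvg Ix fg gl.
split; first by apply/cvg_ex; exists l.
exact: (cvg_lim (@Rhausdorff R) H).
Qed.

Lemma itv0y_proper x : 0 <= x -> ProperFilter (within `[(0 : R), +oo[ x^').
Proof.
move=> x0; split; last exact: within_filter.
move=> H.
have {}H : \forall y \near x, y != x -> `[(0 : R), +oo[%classic y -> False by exact: H.
have [e /= e0 He] := (nbhs_ballP _ _).1 H.
have e2 : 0 < e / 2 by rewrite divr_gt0.
apply: (He (x + e / 2)).
- rewrite /ball/= opprD addrA subrr sub0r normrN gtr0_norm//.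
  by rewrite ltr_pdivrMr// ltr_pMr// ltr1n.
- by rewrite -subr_eq0 addrC addKr gt_eqF.
- by rewrite /= in_itv/= andbT addr_ge0// ltW.
Qed.

(** The truncated power [ppow k.+1] is of class [C^k]. *)
Definition ppow (k : nat) x : R := Num.max 0 x ^+ k.

Lemma is_derive_ppow (k : nat) x :
  is_derive x (1 : R) (ppow k.+2) (k.+2%:R * ppow k.+1 x).
Proof.
have [x0|x0|->] := ltgtP x 0.
- rewrite /ppow max_l ?ltW// expr0n/= mulr0.
  apply: (@near_eq_is_derive _ _ _ (cst (0 : R))).
  have := lt_nbhsl x0; apply: filterS => y y0.
  by rewrite /ppow max_l ?ltW// expr0n.
- rewrite /ppow max_r ?ltW//.
  apply: (@near_eq_is_derive _ _ _ ((@id R) ^+ k.+2)).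
    have := lt_nbhsr x0; apply: filterS => y y0.
    by rewrite /ppow max_r ?ltW// exprfctE.
  by apply: is_derive_eq; rewrite /= scaler1.
- rewrite /ppow maxxx expr0n/= mulr0; apply/is_derive_quotP.
  apply/cvgrPdist_le => e e0.
  have e1 : 0 < Num.min 1 e by rewrite lt_min ltr01.
  have : \forall y \near (0 : R), `|y| < Num.min 1 e.
    apply: (filterS _ (nbhsx_ballx (0 : R) _ e1)) => y.
    by rewrite /ball/= sub0r normrN.
  move=> H; change (\forall y \near (0 : R), y != 0 ->
    `|0 - (Num.max 0 y ^+ k.+2 - Num.max 0 0 ^+ k.+2) / (y - 0)| <= e).
  apply: filterS H => y; rewrite lt_min => /andP[y1 ye] y0.
  rewrite sub0r normrN maxxx expr0n/= !subr0.
  have [ly|ly] := leP y 0; first by rewrite expr0n/= mul0r normr0 ltW.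
  rewrite exprSr mulfK// normrX exprS ltW//; apply: le_lt_trans ye.
  by rewrite ler_piMr// exprn_ile1// ltW.
Qed.

Lemma ppow_continuous (k : nat) : continuous (ppow k.+1).
Proof.
have c1 : continuous (fun x : R => Num.max 0 x).
  by move=> x; apply: continuous_max; [exact: cvg_cst|exact: cvg_id].
elim: k => [|k IH] x; first by rewrite /ppow; under eq_fun do rewrite expr1; exact: c1.
rewrite /ppow; under eq_fun do rewrite exprS.
by apply: cvgM; [exact: c1|exact: IH].
Qed.

Lemma ppow_ge0 (k : nat) x : 0 <= ppow k x.
Proof. by rewrite exprn_ge0// le_max lexx. Qed.

Lemma ppow0 (k : nat) x : x <= 0 -> ppow k.+1 x = 0.
Proof. by move=> x0; rewrite /ppow max_l// expr0n. Qed.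

Lemma ppow_le1 (k : nat) x : x <= 1 -> ppow k x <= 1.
Proof. by move=> x1; rewrite exprn_ile1// ?le_max ?lexx// ge_max ler01. Qed.

Lemma is_derive_comp1 f g x (df dg : R) : is_derive x (1 : R) g dg ->
  is_derive (g x) (1 : R) f df -> is_derive x (1 : R) (f \o g) (df * dg).
Proof.
move=> [gx gE] [fx fE].
have dfg : differentiable (f \o g) x.
  apply: differentiable_comp; [exact/derivable1_diffP|exact/derivable1_diffP].
split; first exact/derivable1_diffP.
by rewrite -derive1E (derive1_comp gx fx) -fE -gE 2!derive1E.
Qed.

End derivatives.

Section time_cutoff.
Context (R : realType) (n : nat) (T : R).
Hypothesis T0 : 0 < T.
Notation ppow := (@ppow R).

(** The time cutoff is [(1 - (t / T - 1)_+ ^ 3)_+ ^ (n + 3)]: the cube makes it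
    [C^2] at time [T], where it starts to decrease, and the outer power makes its
    second derivative bounded by a large power of [cutoff_base]. *)
Definition cutoff_base (t : R) : R := 1 - ppow 3 (t / T - 1).
Definition cutoff (t : R) : R := ppow n.+3 (cutoff_base t).
Definition cutoff1 (t : R) : R :=
  n.+3%:R * ppow n.+2 (cutoff_base t) * (- (3%:R * ppow 2 (t / T - 1) / T)).
Definition cutoff2 (t : R) : R :=
  n.+3%:R * (n.+2%:R * ppow n.+1 (cutoff_base t) * (3%:R * ppow 2 (t / T - 1) / T) ^+ 2
             - ppow n.+2 (cutoff_base t) * (6%:R * ppow 1 (t / T - 1) / T ^+ 2)).

Let is_derive_arg (t : R) : is_derive t (1 : R) (fun t : R => t / T - 1) T^-1.
Proof.
have H := is_deriveB (is_deriveZ T^-1 (is_derive_id t 1)) (is_derive_cst (1 : R) t 1).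
rewrite subr0 scaler1 in H.
suff -> : (fun t : R => t / T - 1) = ((T^-1 \*: (@id R)) - cst 1) by [].
by apply/funext => s; rewrite mulrC.
Qed.

Let is_derive_pparg k (t : R) :
  is_derive t (1 : R) (fun t : R => ppow k.+2 (t / T - 1))
    (k.+2%:R * ppow k.+1 (t / T - 1) / T).
Proof.
exact: (is_derive_comp1 (is_derive_arg t) (is_derive_ppow k (t / T - 1))).
Qed.

Let is_derive_cutoff_base (t : R) :
  is_derive t (1 : R) cutoff_base (- (3%:R * ppow 2 (t / T - 1) / T)).
Proof.
have H := is_deriveB (is_derive_cst (1:R) t 1) (is_derive_pparg 1 t).
by rewrite sub0r in H.
Qed.

Lemma is_derive_cutoff (t : R) : is_derive t (1 : R) cutoff (cutoff1 t).
Proof.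
exact: (is_derive_comp1 (is_derive_cutoff_base t) (is_derive_ppow _ _)).
Qed.

Lemma is_derive_cutoff1 (t : R) : is_derive t (1 : R) cutoff1 (cutoff2 t).
Proof.
have H1 := is_derive_comp1 (is_derive_cutoff_base t) (is_derive_ppow n (cutoff_base t)).
have H2 := is_derive_pparg 0 t.
have := is_deriveZ (- (n.+3%:R * 3%:R / T)) (is_deriveM H1 H2).
set f := (X in is_derive _ _ X _); set df := (X in is_derive _ _ _ X) => H.
have -> : cutoff1 = f.
  apply/funext => s.
  have -> : f s = - (n.+3%:R * 3%:R / T) *
    (ppow n.+2 (cutoff_base s) * ppow 2 (s / T - 1)) by [].
  by rewrite /cutoff1; field; exact: lt0r_neq0.
suff <- : df = cutoff2 t by [].
have -> : df = - (n.+3%:R * 3%:R / T) *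
  (ppow n.+2 (cutoff_base t) * (2%:R * ppow 1 (t / T - 1) / T) + ppow 2 (t / T - 1) *
   (n.+2%:R * ppow n.+1 (cutoff_base t) * - (3 * ppow 2 (t / T - 1) / T))) by [].
by rewrite /cutoff2; field; exact: lt0r_neq0.
Qed.

Lemma cutoff2_continuous : continuous cutoff2.
Proof.
have dc (f : R -> R) (df : R -> R) : (forall t, is_derive t (1 : R) f (df t)) ->
    continuous f.
  move=> fd t; apply: differentiable_continuous; apply/derivable1_diffP.
  by have [] := fd t.
have ca : continuous (fun t : R => t / T - 1) by apply: dc; exact: is_derive_arg.
have cz : continuous cutoff_base by apply: dc; exact: is_derive_cutoff_base.
have cp k : continuous (fun t => ppow k.+1 (cutoff_base t)).
  by move=> t; exact: (continuous_comp (cz t) (@ppow_continuous R k _)).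
have cq k : continuous (fun t : R => ppow k.+1 (t / T - 1)).
  by move=> t; exact: (continuous_comp (ca t) (@ppow_continuous R k _)).
move=> t; apply: cvgM; first exact: cvg_cst.
apply: cvgB.
- apply: cvgM; first by apply: cvgM; [exact: cvg_cst|exact: cp].
  have H : (fun s : R => 3%:R * ppow 2 (s / T - 1) / T) @ t -->
      3%:R * ppow 2 (t / T - 1) / T.
    by apply: cvgM; [apply: cvgM; [exact: cvg_cst|exact: cq]|exact: cvg_cst].
  by under eq_fun do rewrite expr2; rewrite expr2; apply: cvgM.
- apply: cvgM; first exact: cp.
  by apply: cvgM; [apply: cvgM; [exact: cvg_cst|exact: cq]|exact: cvg_cst].
Qed.

Lemma cutoff_base_le1 (t : R) : cutoff_base t <= 1.
Proof. by rewrite /cutoff_base gerBl ppow_ge0. Qed.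

Lemma cutoff_base_early (t : R) : t <= T -> t / T - 1 <= 0.
Proof. by move=> tT; rewrite subr_le0 ler_pdivrMr// mul1r. Qed.

Lemma cutoff_early (t : R) : t <= T -> cutoff t = 1.
Proof.
move=> /cutoff_base_early tT; rewrite /cutoff /cutoff_base (ppow0 _ tT) subr0.
by rewrite /ppow max_r ?ler01// expr1n.
Qed.

Lemma cutoff1_early (t : R) : t <= T -> cutoff1 t = 0.
Proof. by move=> /cutoff_base_early tT; rewrite /cutoff1 (ppow0 _ tT) mulr0 mul0r oppr0 mulr0. Qed.

Lemma cutoff2_early (t : R) : t <= T -> cutoff2 t = 0.
Proof.
move=> /cutoff_base_early tT; rewrite /cutoff2 !(ppow0 _ tT) mulr0 mul0r expr0n/=.
by rewrite !mulr0 mul0r mulr0 subrr mulr0.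
Qed.

Lemma cutoff_base_late (t : R) : 2 * T <= t -> cutoff_base t <= 0.
Proof.
move=> tT; rewrite /cutoff_base subr_le0 /ppow.
have H : 1 <= t / T - 1 by rewrite lerBrDr ler_pdivlMr.
by rewrite exprn_ege1// le_max H orbT.
Qed.

Lemma cutoff_late (t : R) : 2 * T <= t -> cutoff t = 0.
Proof. by move=> /cutoff_base_late; exact: ppow0. Qed.

Lemma cutoff2_late (t : R) : 2 * T <= t -> cutoff2 t = 0.
Proof.
by move=> /cutoff_base_late H; rewrite /cutoff2 !(ppow0 _ H) mulr0 !mul0r subrr mulr0.
Qed.

Lemma cutoff_ge0 (t : R) : 0 <= cutoff t. Proof. exact: ppow_ge0. Qed.

Lemma cutoff_le1 (t : R) : cutoff t <= 1.
Proof. exact/ppow_le1/cutoff_base_le1. Qed.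

(** The second derivative loses two powers of the truncated factor, and gains
    [T ^- 2]. *)
Lemma cutoff2_bound (t : R) :
  `|cutoff2 t| <= n.+3%:R * (9%:R * n.+2%:R + 6%:R) * ppow n.+1 (cutoff_base t) / T ^+ 2.
Proof.
have [t2|t2] := leP (2 * T) t.
  by rewrite cutoff2_late// (ppow0 _ (cutoff_base_late t2)) normr0 mulr0 mul0r.
have a1 : t / T - 1 <= 1 by rewrite lerBlDr ler_pdivrMr// ltW.
set a := t / T - 1 in a1 *.
have p2 : 0 <= ppow 2 a <= 1 by rewrite ppow_ge0 ppow_le1.
have p1 : 0 <= ppow 1 a <= 1 by rewrite ppow_ge0 ppow_le1.
have zz : ppow n.+2 (cutoff_base t) = Num.max 0 (cutoff_base t) * ppow n.+1 (cutoff_base t).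
  by rewrite /ppow exprS.
have z1 : 0 <= Num.max 0 (cutoff_base t) <= 1 by rewrite le_max lexx ge_max ler01 cutoff_base_le1.
have q0 := ppow_ge0 n.+1 (cutoff_base t).
rewrite /cutoff2 zz -/a.
move: (ppow 2 a) (ppow 1 a) (Num.max _ _) (ppow n.+1 _) p2 p1 z1 q0 => A B Z Q
  /andP[A0 A1] /andP[B0 B1] /andP[Z0 Z1] Q0.
have -> : n.+3%:R * (n.+2%:R * Q * (3 * A / T) ^+ 2 - Z * Q * (6 * B / T ^+ 2)) =
  n.+3%:R * (9%:R * n.+2%:R * (A * A) - 6%:R * (Z * B)) * Q / T ^+ 2.
  by field; exact: lt0r_neq0.
have iT : 0 < (T ^+ 2)^-1 by rewrite invr_gt0 exprn_gt0.
rewrite normrM (gtr0_norm iT) (ler_pM2r iT) normrM (ger0_norm Q0).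
rewrite ler_wpM2r// normrM ger0_norm// ler_pM2l ?ltr0n//.
have AA : 0 <= A * A <= 1 by rewrite mulr_ge0// mulr_ile1.
have ZB : 0 <= Z * B <= 1 by rewrite mulr_ge0// mulr_ile1.
have n0 : 0 <= n.+2%:R :> R by [].
rewrite ler_norml; move: (A * A) (Z * B) AA ZB => a2 b2 /andP[? ?] /andP[? ?].
by apply/andP; split; nra.
Qed.

End time_cutoff.

Lemma Ck_on2_is_derive (R : realType) (f f1 f2 g : R -> R) :
  (forall t, is_derive t (1 : R) f (f1 t)) ->
  (forall t, is_derive t (1 : R) f1 (f2 t)) -> continuous f2 ->
  {in `[(0 : R), +oo[%classic, g =1 f} ->
  [/\ Ck_on `[(0 : R), +oo[ 2 g,
      forall t, 0 <= t -> deriv_on `[(0 : R), +oo[ g t = f1 t &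
      forall t, 0 <= t -> iter 2 (deriv_on `[(0 : R), +oo[) g t = f2 t].
Proof.
move=> d1 d2 c2 gf.
have I0 (t : R) : `[(0 : R), +oo[%classic t -> 0 <= t by rewrite /= in_itv/= andbT.
have I0' (t : R) : 0 <= t -> `[(0 : R), +oo[%classic t by rewrite /= in_itv/= andbT.
have D1 t : 0 <= t -> derivable_on `[(0 : R), +oo[ g t /\
    deriv_on `[(0 : R), +oo[ g t = f1 t.
  by move=> t0; apply: deriv_on_is_derive (d1 t) => //; [exact: itv0y_proper|exact: I0'].
have D2 t : 0 <= t -> derivable_on `[(0 : R), +oo[ (deriv_on `[(0 : R), +oo[ g) t /\
    deriv_on `[(0 : R), +oo[ (deriv_on `[(0 : R), +oo[ g) t = f2 t.
  move=> t0; apply: deriv_on_is_derive (d2 t).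
  - exact: itv0y_proper.
  - exact: I0'.
  - by move=> s; rewrite inE => /I0 /D1 [].
split.
- split; first by move=> t /I0 /D1 [].
  split; first by move=> t /I0 /D2 [].
  have : {within `[(0 : R), +oo[, continuous f2} by exact: continuous_subspaceT.
  by apply: subspace_eq_continuous => t; rewrite inE => /I0 /D2 [].
- by move=> t /D1 [].
- by move=> t /D2 [].
Qed.

(** * Integration by parts on an edge *)

Section interval_calculus.
Context (R : realType).
Notation leb := (@lebesgue_measure R).

Lemma ae_bounded_integrable (l : R) (g : R -> R) (M : R) : 0 < l ->
  {within `]0, l[, continuous g} ->
  {ae leb, forall s, s \in `]0, l[ -> `|g s| <= M} ->
  leb.-integrable `]0, l[ (EFin \o g).
Proof.
move=> l0 cg aeg.
have mg : measurable_fun `]0, l[ g by exact: subspace_continuous_measurable_fun.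
apply/integrableP; split; first exact/measurable_EFinP.
apply: le_lt_trans.
  apply: (integral_le_bound `|M|%:E) => //; first exact/measurable_EFinP.
  apply: (@filterS _ _ (ae_filter_ringOfSetsType leb) _ _ _ aeg) => s H sI.
  by rewrite lee_fin; exact: le_trans (H sI) (ler_norm M).
have E : lebesgue_measure (`]0, l[%classic : set R) = l%:E.
  by rewrite lebesgue_measure_itv/= lte_fin l0 -EFinD subr0.
by rewrite lte_mul_pinfty//; apply: (le_lt_trans (y := l%:E)); [rewrite -E|exact: ltry].
Qed.

(** The derivative is only assumed integrable and continuous inside the
    interval; since the indefinite integral is continuous up to the endpoints,
    the mean value theorem applies to its difference with [F]. *)
Lemma integral_itvoo_FTC (l : R) (F g : R -> R) : 0 < l ->
  {within `[0, l], continuous F} ->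
  (forall x, 0 < x < l -> is_derive x (1 : R) F (g x)) ->
  {within `]0, l[, continuous g} ->
  leb.-integrable `]0, l[ (EFin \o g) ->
  (\int[leb]_(s in `]0%R, l[) (g s)%:E = (F l - F 0)%:E)%E.
Proof.
move=> l0 cF dF cg ig.
pose g0 := g \_ `]0, l[.
have ig0 : leb.-integrable setT (EFin \o g0).
  by rewrite /g0 -restrict_EFin -integrable_mkcond.
have ig0l : leb.-integrable `[0, l] (EFin \o g0) by exact: integrableS ig0.
pose G x := parameterized_integral leb 0 x g0.
have cG : {within `[0, l], continuous G}.
  by apply: parameterized_integral_continuous => //; exact: ltW.
have cgx x : 0 < x < l -> {for x, continuous g0}.
  move=> xl; have xI : `]0, l[%classic x by rewrite /= in_itv.
  have nI : \forall y \near x, `]0, l[%classic y by exact: open_nbhs_nbhs.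
  have cgx : {for x, continuous g}.
    move: cg; rewrite continuous_open_subspace; last exact: interval_open.
    by move/(_ x); rewrite inE => /(_ xI).
  rewrite /prop_for /continuous_at.
  have -> : g0 x = g x by rewrite /g0 patchE mem_set.
  apply: cvg_trans cgx; apply: near_eq_cvg; apply: filterS nI => y yI.
  by rewrite /g0 patchE mem_set.
have dG x : 0 < x < l -> is_derive x (1 : R) G (g x).
  move=> /[dup] xl /andP[x0 xl'].
  have [D1 D2] := continuous_FTC1_closed xl' ig0l x0 (cgx x xl).
  split => //; rewrite -derive1E D2 /g0 patchE mem_set//.
have [c c_in] := @MVT R (G - F) (fun=> 0) 0 l l0
  (fun x xI => ltac:(rewrite in_itv/= in xI; rewrite -(subrr (g x));
     apply: is_deriveB; [exact: dG|exact: dF]))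
  (fun x => cvgB (cG x) (cF x)).
rewrite mul0r => /eqP; rewrite subr_eq0 => /eqP.
have GFE x : (G - F) x = G x - F x by [].
rewrite !GFE => GF.
have G0 : G 0 = 0 by rewrite /G /parameterized_integral set_itv1 Rintegral_set1.
have {}GF : G l = F l - F 0 by move: GF; rewrite G0; lra.
rewrite -GF /G /parameterized_integral /Rintegral fineK; last first.
  by apply: integrable_fin_num.
rewrite [LHS]integral_mkcond [RHS]integral_mkcond.
apply: eq_integral => s _.
rewrite !patchE /g0 !patchE; case: ifPn => sI.
  by rewrite ifT//; move: sI; rewrite !inE; exact: subset_itv_oo_cc.
by case: ifP.
Qed.

(** Cubic interpolation between [a] and [b], flat at both ends. *)
Definition hermite (l a b s : R) : R :=
  a + (b - a) * (3%:R * (s / l) ^+ 2 - 2%:R * (s / l) ^+ 3).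
Definition hermite1 (l a b s : R) : R := (b - a) * (6%:R * (s / l) - 6%:R * (s / l) ^+ 2) / l.
Definition hermite2 (l a b s : R) : R := (b - a) * (6%:R - 12%:R * (s / l)) / l ^+ 2.

Let is_derive_Xn (k : nat) (c s : R) :
  is_derive s (1 : R) (fun t => c * t ^+ k) (c * (k%:R * s ^+ k.-1)).
Proof.
have := is_deriveZ c (is_deriveX k (is_derive_id s 1)).
by rewrite scaler1 exprfctE.
Qed.

Lemma is_derive_hermite (l a b s : R) : l != 0 ->
  is_derive s (1 : R) (hermite l a b) (hermite1 l a b s).
Proof.
move=> l0.
have := is_deriveD (is_derive_cst a s 1) (is_deriveD
  (is_derive_Xn 2 (3%:R * (b - a) / l ^+ 2) s)
  (is_derive_Xn 3 (- (2%:R * (b - a) / l ^+ 3)) s)).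
set f := (X in is_derive _ _ X _); set df := (X in is_derive _ _ _ X).
have -> : f = hermite l a b.
  apply/funext => t; have -> : f t = a + (3%:R * (b - a) / l ^+ 2 * t ^+ 2 +
    - (2%:R * (b - a) / l ^+ 3) * t ^+ 3) by [].
  by rewrite /hermite; field.
by have -> : df = hermite1 l a b s by rewrite /df /hermite1 /=; field.
Qed.

Lemma is_derive_hermite1 (l a b s : R) : l != 0 ->
  is_derive s (1 : R) (hermite1 l a b) (hermite2 l a b s).
Proof.
move=> l0.
have := is_deriveD (is_derive_Xn 1 (6%:R * (b - a) / l ^+ 2) s)
  (is_derive_Xn 2 (- (6%:R * (b - a) / l ^+ 3)) s).
set f := (X in is_derive _ _ X _); set df := (X in is_derive _ _ _ X).
have -> : f = hermite1 l a b.
  apply/funext => t; have -> : f t = (6%:R * (b - a) / l ^+ 2 * t ^+ 1 +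
    - (6%:R * (b - a) / l ^+ 3) * t ^+ 2) by [].
  by rewrite /hermite1; field.
by have -> : df = hermite2 l a b s by rewrite /df /hermite2 /=; field.
Qed.

Lemma is_derive_hermite2 (l a b s : R) : l != 0 ->
  is_derive s (1 : R) (hermite2 l a b) (- (12%:R * (b - a) / l ^+ 3)).
Proof.
move=> l0.
have := is_deriveD (is_derive_cst (6%:R * (b - a) / l ^+ 2) s 1)
  (is_derive_Xn 1 (- (12%:R * (b - a) / l ^+ 3)) s).
set f := (X in is_derive _ _ X _); set df := (X in is_derive _ _ _ X).
have -> : f = hermite2 l a b.
  apply/funext => t; have -> : f t = (6%:R * (b - a) / l ^+ 2 +
    - (12%:R * (b - a) / l ^+ 3) * t ^+ 1) by [].
  by rewrite /hermite2; field.
by have -> : df = - (12%:R * (b - a) / l ^+ 3) by rewrite /df /= expr0 mulr1 mulr1 add0r.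
Qed.

Let is_derive_continuous (f df : R -> R) :
  (forall t, is_derive t (1 : R) f (df t)) -> continuous f.
Proof.
move=> fd t; apply: differentiable_continuous; apply/derivable1_diffP.
by have [] := fd t.
Qed.

Lemma hermite_continuous (l a b : R) : l != 0 -> continuous (hermite l a b).
Proof. by move=> l0; apply: is_derive_continuous => t; exact: is_derive_hermite. Qed.

Lemma hermite1_continuous (l a b : R) : l != 0 -> continuous (hermite1 l a b).
Proof. by move=> l0; apply: is_derive_continuous => t; exact: is_derive_hermite1. Qed.

Lemma hermite2_continuous (l a b : R) : l != 0 -> continuous (hermite2 l a b).
Proof. by move=> l0; apply: is_derive_continuous => t; exact: is_derive_hermite2. Qed.

(** The weights of [a] and [b] are nonnegative and add up to [1]. *)
Lemma hermite_bounds (l a b s : R) : 0 < l -> 0 <= s <= l ->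
  Num.min a b <= hermite l a b s <= Num.max a b.
Proof.
move=> l0 /andP[s0 sl]; rewrite /hermite.
have : 0 <= s / l <= 1 by rewrite divr_ge0 ?(ltW l0)//= ler_pdivrMr// mul1r.
move: (s / l) => x /andP[x0 x1].
have h0 : 0 <= 3%:R * x ^+ 2 - 2%:R * x ^+ 3.
  have -> : 3%:R * x ^+ 2 - 2%:R * x ^+ 3 = x ^+ 2 * (3%:R - 2%:R * x) by ring.
  by rewrite mulr_ge0 ?sqr_ge0//; lra.
have h1 : 0 <= 1 - (3%:R * x ^+ 2 - 2%:R * x ^+ 3).
  have -> : 1 - (3%:R * x ^+ 2 - 2%:R * x ^+ 3) = (1 - x) ^+ 2 * (1 + 2%:R * x) by ring.
  by rewrite mulr_ge0 ?sqr_ge0//; lra.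
move: (3%:R * x ^+ 2 - 2%:R * x ^+ 3) h0 h1 => y h0 h1.
by rewrite ge_min le_max; case: (leP a b) => ab; apply/andP; split;
  apply/orP; (try by left; nra); right; nra.
Qed.

Lemma hermite2_bound (l a b s : R) : 0 < l -> 0 <= s <= l ->
  `|hermite2 l a b s| <= 6%:R * `|b - a| / l ^+ 2.
Proof.
move=> l0 /andP[s0 sl]; rewrite /hermite2.
have : 0 <= s / l <= 1 by rewrite divr_ge0 ?(ltW l0)//= ler_pdivrMr// mul1r.
move: (s / l) => x /andP[x0 x1].
have l2 : 0 < (l ^+ 2)^-1 by rewrite invr_gt0 exprn_gt0.
rewrite normrM (gtr0_norm l2) (ler_pM2r l2) normrM mulrC ler_wpM2r//.
by rewrite ler_norml; apply/andP; split; lra.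
Qed.

End interval_calculus.

Section edge_by_parts.
Context (R : realType).
Notation leb := (@lebesgue_measure R).

Let nbhs_oo (l x : R) : 0 < x < l -> nbhs x `]0, l[%classic.
Proof. by move=> xl; apply: open_nbhs_nbhs; split; [exact: interval_open|rewrite /= in_itv]. Qed.

Let nbhs_cc (l x : R) : 0 < x < l -> nbhs x `[0, l]%classic.
Proof. by move=> /nbhs_oo; apply: filterS; exact: subset_itv_oo_cc. Qed.

(** The fundamental theorem of calculus is applied to
    [hermite * f' - hermite1 * f]; as [hermite1] vanishes at both ends, the values
    of [f] there do not contribute. *)
Lemma edge_by_parts (l a b M : R) (f : R -> R) : 0 < l ->
  {within `[0, l], continuous f} ->
  Ck_on `]0, l[ 2 f -> Ck_on `[0, l] 1 f ->
  {ae leb, forall s, s \in `]0, l[ -> `|iter 2 (deriv_on `]0, l[) f s| <= M} ->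
  [/\ leb.-integrable `]0, l[
        (fun s => (hermite l a b s * iter 2 (deriv_on `]0, l[) f s)%:E),
      leb.-integrable `]0, l[ (fun s => (hermite2 l a b s * f s)%:E) &
      (\int[leb]_(s in `]0%R, l[) (hermite l a b s * iter 2 (deriv_on `]0, l[) f s)%:E
       = \int[leb]_(s in `]0%R, l[) (hermite2 l a b s * f s)%:E
         + (b * deriv_on `[0, l] f l - a * deriv_on `[0, l] f 0)%:E)%E ].
Proof.
move=> l0 cf [D1 [D2 cw]] [D3 cv] aew.
have ln0 : l != 0 := lt0r_neq0 l0.
set w := iter 2 (deriv_on `]0, l[) f in aew *.
set D := deriv_on `]0, l[ f in D2 cw w aew *.
set v := deriv_on `[0, l] f in cv *.
have inE' x : 0 < x < l -> `]0, l[%classic x by rewrite /= in_itv.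
have inE2 x : 0 < x < l -> `[0, l]%classic x.
  by move=> /inE'; exact: subset_itv_oo_cc.
have fD x : 0 < x < l -> is_derive x (1 : R) f (D x).
  by move=> xl; apply: derivable_on_is_derive; [exact: nbhs_oo|exact/D1/inE'].
have fv x : 0 < x < l -> is_derive x (1 : R) f (v x).
  by move=> xl; apply: derivable_on_is_derive; [exact: nbhs_cc|exact/D3/inE2].
have Dv x : 0 < x < l -> D x = v x.
  by move=> xl; have [_ <-] := fD x xl; have [_ <-] := fv x xl.
have vw x : 0 < x < l -> is_derive x (1 : R) v (w x).
  move=> xl; apply: (@near_eq_is_derive _ _ _ D).
    by apply: filterS (nbhs_oo xl) => y; rewrite /= in_itv/= => /Dv.
  by apply: derivable_on_is_derive; [exact: nbhs_oo|exact/D2/inE'].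
have ch I : {within I, continuous (hermite l a b)}.
  by apply: continuous_subspaceT; exact: hermite_continuous.
have ch1 I : {within I, continuous (hermite1 l a b)}.
  by apply: continuous_subspaceT; exact: hermite1_continuous.
have ch2 I : {within I, continuous (hermite2 l a b)}.
  by apply: continuous_subspaceT; exact: hermite2_continuous.
have cfo : {within `]0, l[, continuous f}.
  by apply: continuous_subspaceW cf; exact: subset_itv_oo_cc.
have iw : leb.-integrable `]0, l[ (fun s => (hermite l a b s * w s)%:E).
  apply: (@ae_bounded_integrable _ _ _ (Num.max `|a| `|b| * `|M|)) => //.
    by move=> x; apply: cvgM; [exact: ch|exact: cw].
  apply: (@filterS _ _ (ae_filter_ringOfSetsType leb) _ _ _ aew) => s H sI.
  rewrite normrM ler_pM//; last exact: le_trans (H sI) (ler_norm M).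
  have /andP[h1 h2] : Num.min a b <= hermite l a b s <= Num.max a b.
    apply: hermite_bounds => //; move: sI; rewrite in_itv/= => /andP[? ?].
    by rewrite !ltW.
  have : `|a| <= Num.max `|a| `|b| by rewrite le_max lexx.
  have : `|b| <= Num.max `|a| `|b| by rewrite le_max lexx orbT.
  move: h1 h2 (Num.max `|a| `|b|) => h1 h2 m.
  rewrite !ler_norml => /andP[? ?] /andP[? ?]; move: h1 h2.
  by case: (leP a b) => _ ? ?; apply/andP; split; lra.
have i2 : leb.-integrable `]0, l[ (fun s => (hermite2 l a b s * f s)%:E).
  apply: (@integrableS _ _ _ leb `[0, l]%classic) => //; last first.
  apply: continuous_compact_integrable; first exact: segment_compact.
  by move=> x; apply: cvgM; [exact: ch2|exact: cf].
split=> //.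
pose F := hermite l a b * v - hermite1 l a b * f.
pose g s := hermite l a b s * w s - hermite2 l a b s * f s.
have cF : {within `[0, l], continuous F}.
  by move=> x; apply: cvgB; apply: cvgM; [exact: ch|exact: cv|exact: ch1|exact: cf].
have dF x : 0 < x < l -> is_derive x (1 : R) F (g x).
  move=> xl.
  have := is_deriveB (is_deriveM (is_derive_hermite a b x ln0) (vw x xl))
     (is_deriveM (is_derive_hermite1 a b x ln0) (fv x xl)).
  set df := (X in is_derive _ _ _ X) => H.
  suff <- : df = g x by [].
  have -> : df = hermite l a b x * w x + v x * hermite1 l a b x -
     (hermite1 l a b x * v x + f x * hermite2 l a b x) by [].
  by rewrite /g; ring.
have cg : {within `]0, l[, continuous g}.
  by move=> x; apply: cvgB; apply: cvgM; [exact: ch|exact: cw|exact: ch2|exact: cfo].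
have ig : leb.-integrable `]0, l[ (EFin \o g).
  by have := integrableB _ iw i2; exact.
have Fl : F l = b * v l.
  rewrite -[LHS]/(hermite l a b l * v l - hermite1 l a b l * f l).
  by rewrite /hermite /hermite1 divff//; field.
have F0 : F 0 = a * v 0.
  rewrite -[LHS]/(hermite l a b 0 * v 0 - hermite1 l a b 0 * f 0).
  by rewrite /hermite /hermite1 mul0r; field.
rewrite -Fl -F0 -(integral_itvoo_FTC l0 cF dF cg ig).
under [X in (_ = _ + X)%E]eq_integral do rewrite EFinB.
rewrite integralB// addeC subeK//.
exact: integrable_fin_num.
Qed.

End edge_by_parts.

(** * Green's formula on the graph *)

Lemma fsbig_seq_support (R : nmodType) (T : choiceType) (A : set T) (s : seq T)
    (F : T -> R) : uniq s ->
  (forall y, A y -> F y != 0 -> y \in s) ->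
  (forall y, y \in s -> ~ A y -> F y = 0) ->
  \sum_(y \in A) F y = \sum_(y <- s) F y.
Proof.
move=> us As sA; rewrite [RHS]fsbig_seq// [LHS]fsbig_supp [RHS]fsbig_supp; apply: eq_fsbigl.
apply/seteqP; split => y [H Fy]; split => //.
- by apply: As => //; exact/eqP.
- by apply: contrapT => nA; apply: Fy; exact: sA.
Qed.

Section green.
Context (R : realType) (G : metricGraph R).
Context (mu : vertex G -> R) (omega : vertex G -> vertex G -> R).
Hypothesis mu0 : forall x, 0 < mu x.
Hypothesis omega_sym : forall x y, omega x y = omega y x.
Hypothesis omega_ge0 : forall x y, 0 <= omega x y.
Hypothesis omega_adj : forall x y, 0 < omega x y <-> adj x y.
Notation leb := (@lebesgue_measure R).
Notation gp := (gpoint G).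

(** Extension of a function of the vertices to the whole graph.  As the
    interpolation is flat at the vertices, no boundary term involves the
    derivatives of the extension. *)
Definition interp (a : vertex G -> R) (x : gp) : R :=
  match x with
  | Vtx v => a v
  | Inner e s => hermite (len e) (a (initial e)) (a (final e)) (val s)
  end.

Definition interp_laplacian (a : vertex G -> R) (x : gp) : R :=
  match x with
  | Vtx v => vertex_laplacian mu omega (interp a) v
  | Inner e s => hermite2 (len e) (a (initial e)) (a (final e)) (val s)
  end.

Lemma interp_pt (a : vertex G -> R) e (s : R) : 0 < s < len e ->
  interp a (pt e s) = hermite (len e) (a (initial e)) (a (final e)) s.
Proof. by move=> s_in; rewrite (pt_inner s_in). Qed.

Lemma interp_laplacian_pt (a : vertex G -> R) e (s : R) : 0 < s < len e ->
  interp_laplacian a (pt e s) = hermite2 (len e) (a (initial e)) (a (final e)) s.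
Proof. by move=> s_in; rewrite (pt_inner s_in). Qed.

Lemma laplacian_pt (f : gp -> R) e (s : R) : 0 < s < len e ->
  laplacian mu omega f (pt e s) = edge_deriv2 f e s.
Proof. by move=> s_in; rewrite (pt_inner s_in). Qed.

Lemma mu_vertex_laplacian (f : gp -> R) v :
  mu v * vertex_laplacian mu omega f v =
  \sum_(y \in [set y | adj v y]) omega v y * (f (Vtx y) - f (Vtx v)).
Proof. by rewrite mulrA mulfV ?mul1r// gt_eqF. Qed.

Lemma omega_nadj x y : ~ adj x y -> omega x y = 0.
Proof.
move=> nxy; apply/eqP; rewrite eq_le omega_ge0 andbT leNgt.
by apply/negP => /omega_adj.
Qed.

Lemma esum_seq (T : choiceType) (s : seq T) (a : T -> \bar R) : uniq s ->
  (forall x, (0 <= a x)%E) -> (forall x, x \notin s -> a x = 0%E) ->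
  (\esum_(x in [set: T]) a x = \sum_(x <- s) a x)%E.
Proof.
move=> us a0 as0.
transitivity (\esum_(x in [set` s]) a x)%E.
  rewrite [RHS]esum_mkcond; apply: eq_esum => x _.
  by case: ifPn => //; rewrite mem_setE; exact: as0.
by rewrite esum_fset// -?fsbig_seq//; exact: finite_seq.
Qed.

Section finite_support.
Context (vs : seq (vertex G)) (es : seq (edge G)).
Hypothesis (uvs : uniq vs) (ues : uniq es).

Lemma graph_int_ge0_finite (F : gp -> \bar R) : (forall x, (0 <= F x)%E) ->
  (forall v, v \notin vs -> F (Vtx v) = 0%E) ->
  (forall e s, e \notin es -> 0 < s < len e -> F (pt e s) = 0%E) ->
  graph_int_ge0 mu F = (\sum_(v <- vs) (mu v)%:E * F (Vtx v) +
    \sum_(e <- es) \int[leb]_(s in `]0%R, len e[) F (pt e s))%E.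
Proof.
move=> F0 Fv Fe; rewrite graph_int_ge0E; congr (_ + _)%E; apply: esum_seq => //.
- by move=> v; rewrite mule_ge0// lee_fin ltW.
- by move=> v nv; rewrite Fv// mule0.
- by move=> e; apply: integral_ge0.
- move=> e ne; apply: integral0_eq => s; rewrite /= in_itv/= => s_in.
  exact: Fe.
Qed.

(** The integrals of the positive and negative parts reduce to finite sums of
    finite terms, which can be subtracted termwise. *)
Lemma graph_int_finite (f : gp -> R) :
  (forall v, v \notin vs -> f (Vtx v) = 0) ->
  (forall e s, e \notin es -> 0 < s < len e -> f (pt e s) = 0) ->
  (forall e, leb.-integrable `]0, len e[ (fun s => (f (pt e s))%:E)) ->
  graph_integrable mu f /\
  (graph_int mu f = (\sum_(v <- vs) mu v * f (Vtx v))%:E +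
    \sum_(e <- es) \int[leb]_(s in `]0%R, len e[) (f (pt e s))%:E)%E.
Proof.
move=> fv fe fi.
have mf : graph_measurable f.
  by move=> e; have /measurable_int/measurable_EFinP := fi e.
have fin (F : gp -> \bar R) : (forall x, (0 <= F x <= `|f x|%:E)%E) -> graph_emeasurable F ->
    graph_int_ge0 mu F = (\sum_(v <- vs) (mu v)%:E * F (Vtx v) +
    \sum_(e <- es) \int[leb]_(s in `]0%R, len e[) F (pt e s))%E /\
    (graph_int_ge0 mu F < +oo)%E.
  move=> Ff mF.
  have F0 x : (0 <= F x)%E by have /andP[] := Ff x.
  have Ffin x : F x \is a fin_num.
    by have /andP[_ H] := Ff x; rewrite ge0_fin_numE// (le_lt_trans H)// ltry.
  have E : graph_int_ge0 mu F = (\sum_(v <- vs) (mu v)%:E * F (Vtx v) +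
    \sum_(e <- es) \int[leb]_(s in `]0%R, len e[) F (pt e s))%E.
    apply: graph_int_ge0_finite => //.
    - move=> v /fv f0; have := Ff (Vtx v); rewrite f0 normr0.
      by move=> H; apply/eqP; rewrite eq_le andbC.
    - move=> e s /fe/[apply] f0; have := Ff (pt e s); rewrite f0 normr0.
      by move=> H; apply/eqP; rewrite eq_le andbC.
  split => //; rewrite E lte_add_pinfty//.
    by apply: lte_sum_pinfty => v _; rewrite -(fineK (Ffin (Vtx v))) -EFinM ltry.
  apply: lte_sum_pinfty => e _.
  have /integrableP[_] := fi e; apply: le_lt_trans.
  apply: ge0_le_integral => //.
  - exact: mF.
  - by apply: measurableT_comp => //; have /measurable_int := fi e.
  - by move=> s _; have /andP[] := Ff (pt e s).
have maf : graph_emeasurable (fun x => `|f x|%:E).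
  by move=> e; apply/measurable_EFinP/measurableT_comp => //; exact: mf.
have [_ aoo] := fin (fun x => `|f x|%:E) (fun x => ltac:(by rewrite lexx andbT lee_fin)) maf.
split; first by split.
have pE x : (0 <= (EFin \o f)^\+ x <= `|f x|%:E)%E.
  by rewrite funepos_EFin lee_fin le_max lexx orbT/= lee_fin ge_max ler_norm normr_ge0.
have nE x : (0 <= (EFin \o f)^\- x <= `|f x|%:E)%E.
  by rewrite funeneg_EFin lee_fin le_max lexx orbT/= lee_fin ge_max -normrN ler_norm normr_ge0.
have [Ep _] := fin _ pE (graph_emeasurable_pos mf).
have [En _] := fin _ nE (graph_emeasurable_neg mf).
rewrite /graph_int Ep En.
pose ip e := (fine (\int[leb]_(s in `]0%R, len e[) (EFin \o f)^\+ (pt e s))%E).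
pose im e := (fine (\int[leb]_(s in `]0%R, len e[) (EFin \o f)^\- (pt e s))%E).
have pcomp e : ((fun s => (f (pt e s))%:E)^\+ = (EFin \o f)^\+ \o pt e)%E.
  by rewrite -funepos_comp.
have ncomp e : ((fun s => (f (pt e s))%:E)^\- = (EFin \o f)^\- \o pt e)%E.
  by rewrite -funeneg_comp.
have ipE e : (\int[leb]_(s in `]0%R, len e[) (EFin \o f)^\+ (pt e s) = (ip e)%:E)%E.
  rewrite fineK//; have H := integrable_pos_fin_num _ (fi e).
  have {}H := H (measurable_itv _); by rewrite pcomp in H.
have imE e : (\int[leb]_(s in `]0%R, len e[) (EFin \o f)^\- (pt e s) = (im e)%:E)%E.
  rewrite fineK//; have H := integrable_neg_fin_num _ (fi e).
  have {}H := H (measurable_itv _); by rewrite ncomp in H.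
have iE e : (\int[leb]_(s in `]0%R, len e[) (f (pt e s))%:E = (ip e - im e)%:E)%E.
  rewrite integralE pcomp ncomp.
  by rewrite EFinB -ipE -imE.
rewrite (eq_bigr (fun v => (mu v * Num.max (f (Vtx v)) 0)%:E)); last first.
  by move=> v _; rewrite funepos_EFin -EFinM.
rewrite [in X in (_ - X)%E](eq_bigr (fun v => (mu v * Num.max (- f (Vtx v)) 0)%:E)); last first.
  by move=> v _; rewrite funeneg_EFin -EFinM.
rewrite (eq_bigr (fun e => (ip e)%:E) (fun e _ => ipE e)).
rewrite (eq_bigr (fun e => (im e)%:E) (fun e _ => imE e)).
rewrite (eq_bigr (fun e => (ip e - im e)%:E) (fun e _ => iE e)).
rewrite !sumEFin -!EFinD; congr EFin.
rewrite sumrB opprD addrACA; congr (_ + _).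
rewrite -sumrB; apply: eq_bigr => v _; rewrite -mulrBr; congr (_ * _).
by have [f0|f0] := leP (f (Vtx v)) 0; rewrite maxElt; case: ltP; lra.
Qed.

End finite_support.

Section by_parts.
(** The list [vs] also contains the neighbours of the support of [a], where the
    vertex Laplacian of [a] may be nonzero. *)
Context (a : vertex G -> R) (vs : seq (vertex G)) (es : seq (edge G)).
Hypothesis (uvs : uniq vs) (ues : uniq es).
Hypothesis avs : forall v, a v != 0 -> v \in vs.
Hypothesis advs : forall v w, a v != 0 -> adj v w -> w \in vs.
Hypothesis aes : forall e, (a (initial e) != 0) || (a (final e) != 0) -> e \in es.

Let a0 v : v \notin vs -> a v = 0.
Proof. by move=> nv; apply/eqP; apply: contraNT nv; exact: avs. Qed.

Let e0 e : e \notin es -> a (initial e) = 0 /\ a (final e) = 0.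
Proof.
move=> ne; have : ~~ ((a (initial e) != 0) || (a (final e) != 0)).
  by apply: contra ne; exact: aes.
by rewrite negb_or !negbK => /andP[/eqP-> /eqP->].
Qed.

Lemma interp_laplacian_out v : v \notin vs -> interp_laplacian a (Vtx v) = 0.
Proof.
move=> nv; rewrite /= /vertex_laplacian fsbig1 ?mulr0// => y vy /=.
rewrite (a0 nv) subr0; have [->|ay] := eqVneq (a y) 0; first by rewrite mulr0.
case/negP: nv; apply: (advs ay); case: vy => e H; exists e; tauto.
Qed.

(** Both sides are double sums over [vs]; exchanging the two summations in the
    terms [omega v y * a v * u y] turns one into the other, as [omega] is
    symmetric. *)
Lemma vertex_by_parts (u : gp -> R) :
  \sum_(v <- vs) mu v * (a v * vertex_laplacian mu omega u v) =
  \sum_(v <- vs) mu v * (u (Vtx v) * interp_laplacian a (Vtx v)).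
Proof.
transitivity (\sum_(v <- vs) \sum_(y <- vs)
    omega v y * a v * (u (Vtx y) - u (Vtx v))).
  apply: eq_bigr => v _; rewrite mulrCA mu_vertex_laplacian.
  have [av|av] := eqVneq (a v) 0.
    by rewrite av mul0r big1// => y _; rewrite mulr0 mul0r.
  rewrite (fsbig_seq_support uvs); last 2 first.
  - by move=> y vy _; exact: advs vy.
  - by move=> y _ /omega_nadj->; rewrite mul0r.
  by rewrite mulr_sumr; apply: eq_bigr => y _; ring.
transitivity (\sum_(v <- vs) \sum_(y <- vs)
    omega v y * u (Vtx v) * (a y - a v)); last first.
  apply: eq_big_seq => v vvs; rewrite mulrCA mu_vertex_laplacian /=.
  rewrite (fsbig_seq_support uvs); last 2 first.
  - move=> y vy; apply: contra_neqT => nyv.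
    have [av|av] := eqVneq (a v) 0; first by rewrite av a0// subr0 mulr0.
    by case/negP: nyv; exact: advs vy.
  - by move=> y _ /omega_nadj->; rewrite mul0r.
  by rewrite mulr_sumr; apply: eq_bigr => y _; ring.
have split_sum (f : vertex G -> vertex G -> R) (g : vertex G -> vertex G -> R) :
    \sum_(v <- vs) \sum_(y <- vs) (f v y - g v y) =
    \sum_(v <- vs) \sum_(y <- vs) f v y - \sum_(v <- vs) \sum_(y <- vs) g v y.
  by rewrite -sumrB; apply: eq_bigr => v _; rewrite sumrB.
under eq_bigr do under eq_bigr do rewrite mulrBr.
under [in RHS]eq_bigr do under eq_bigr do rewrite mulrBr.
rewrite !split_sum; congr (_ - _); last first.
  by apply: eq_bigr => v _; apply: eq_bigr => y _; ring.
rewrite exchange_big; apply: eq_bigr => v _; apply: eq_bigr => y _.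
by rewrite omega_sym; ring.
Qed.

(** Grouped by vertices, the boundary terms add up to the Kirchhoff fluxes. *)
Lemma kirchhoff_sum (p q : edge G -> R) :
  (forall x, \sum_(e \in [set e : edge G | final e = x]) p e
     - \sum_(e \in [set e : edge G | initial e = x]) q e = 0) ->
  \sum_(e <- es) (a (final e) * p e - a (initial e) * q e) = 0.
Proof.
move=> K; rewrite sumrB.
have reg (g : edge G -> vertex G) (r : edge G -> R) :
    (forall e, a (g e) != 0 -> e \in es) ->
    \sum_(e <- es) a (g e) * r e =
    \sum_(v <- vs) a v * \sum_(e \in [set e : edge G | g e = v]) r e.
  move=> ges.
  transitivity (\sum_(e <- es) \sum_(v <- vs | v == g e) a v * r e).
    apply: eq_bigr => e _; have [gv|gv] := boolP (g e \in vs).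
      rewrite -big_filter filter_pred1_uniq// big_seq1//.
    rewrite (a0 gv) mul0r big1_seq// => v /andP[/eqP-> vv].
    by rewrite vv in gv.
  rewrite (exchange_big_dep xpredT)//=; apply: eq_bigr => v _.
  have [->|av] := eqVneq (a v) 0; first by rewrite mul0r big1// => e _; rewrite mul0r.
  rewrite -mulr_sumr; congr (_ * _); rewrite -[LHS]big_filter.
  rewrite [RHS](@fsbig_seq_support _ _ _ [seq e <- es | v == g e])//.
  - by rewrite filter_uniq.
  - by move=> e /= gv _; rewrite mem_filter gv eqxx/= ges// gv.
  - by move=> e; rewrite mem_filter => /andP[/eqP-> _] /=.
rewrite !reg; last 2 first.
- by move=> e ae; rewrite aes// ae.
- by move=> e ae; rewrite aes// ae orbT.
by rewrite -sumrB big1// => v _; rewrite -mulrBr K mulr0.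
Qed.

(** Integration by parts twice: no boundary term survives, since the extension
    is flat at the vertices and the flux of [u] vanishes there. *)
Lemma graph_by_parts (u : gp -> R) : class_D u ->
  (forall x, kirchhoff u x = 0) ->
  [/\ graph_integrable mu (fun x => interp a x * laplacian mu omega u x),
      graph_integrable mu (fun x => u x * interp_laplacian a x) &
      graph_int mu (fun x => interp a x * laplacian mu omega u x) =
      graph_int mu (fun x => u x * interp_laplacian a x)].
Proof.
move=> Du Ku.
pose p e := deriv_on `[0, len e] (u \o pt e) (len e).
pose q e := deriv_on `[0, len e] (u \o pt e) 0.
have ebp e := ltac:(have [cu C2 C1 [M HM]] := Du e;
  exact: (edge_by_parts (a (initial e)) (a (final e)) (len_gt0 e) cu C2 C1 HM)).
have I1 e : leb.-integrable `]0, len e[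
    (fun s => (interp a (pt e s) * laplacian mu omega u (pt e s))%:E).
  have [H _ _] := ebp e; apply: eq_integrable H => // s.
  by rewrite inE /= in_itv/= => s_in; rewrite interp_pt// laplacian_pt.
have I2 e : leb.-integrable `]0, len e[
    (fun s => (u (pt e s) * interp_laplacian a (pt e s))%:E).
  have [_ H _] := ebp e; apply: eq_integrable H => // s.
  by rewrite inE /= in_itv/= => s_in; rewrite interp_laplacian_pt// mulrC.
have I3 e : (\int[leb]_(s in `]0%R, len e[)
      (interp a (pt e s) * laplacian mu omega u (pt e s))%:E =
    \int[leb]_(s in `]0%R, len e[) (u (pt e s) * interp_laplacian a (pt e s))%:E +
    (a (final e) * p e - a (initial e) * q e)%:E)%E.
  have [_ _ H] := ebp e.
  transitivity (\int[leb]_(s in `]0%R, len e[)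
    (hermite (len e) (a (initial e)) (a (final e)) s *
      iter 2 (deriv_on `]0, len e[) (u \o pt e) s)%:E)%E.
    apply: eq_integral => s; rewrite inE /= in_itv/= => s_in.
    by rewrite interp_pt// laplacian_pt.
  rewrite H; congr (_ + _)%E.
  apply: eq_integral => s; rewrite inE /= in_itv/= => s_in.
  by rewrite interp_laplacian_pt// mulrC.
have [G1 E1] := @graph_int_finite vs es uvs ues
  (fun x => interp a x * laplacian mu omega u x)
  (fun v nv => ltac:(by rewrite /= a0// mul0r))
  (fun e s ne s_in => ltac:(by have [H1 H2] := e0 ne;
     rewrite interp_pt// H1 H2 /hermite subrr mul0r addr0 mul0r)) I1.
have G2v v : v \notin vs -> u (Vtx v) * interp_laplacian a (Vtx v) = 0.
  by move=> nv; rewrite interp_laplacian_out// mulr0.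
have [G2 E2] := @graph_int_finite vs es uvs ues
  (fun x => u x * interp_laplacian a x)
  G2v
  (fun e s ne s_in => ltac:(by have [H1 H2] := e0 ne;
     rewrite interp_laplacian_pt// H1 H2 /hermite2 subrr !mul0r mulr0)) I2.
split => //; rewrite E1 E2 /=; congr (_ + _)%E.
  by congr EFin; exact: vertex_by_parts.
rewrite (eq_bigr _ (fun e _ => I3 e)).
have fin e : (\int[leb]_(s in `]0%R, len e[)
    (u (pt e s) * interp_laplacian a (pt e s))%:E)%E \is a fin_num.
  exact: integrable_fin_num (I2 e).
rewrite (eq_bigr (fun e => (fine (\int[leb]_(s in `]0%R, len e[)
    (u (pt e s) * interp_laplacian a (pt e s))%:E)%E +
     (a (final e) * p e - a (initial e) * q e))%:E)); last first.
  by move=> e _; rewrite [RHS]EFinD fineK.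
rewrite sumEFin big_split /= (kirchhoff_sum Ku) addr0 -sumEFin.
by apply: eq_bigr => e _; rewrite fineK.
Qed.

End by_parts.

End green.

(** * The spatial cutoff *)

Section spatial_cutoff.
Context (R : realType) (G : metricGraph R).
Context (mu : vertex G -> R) (omega : vertex G -> vertex G -> R).
Context (x0 : vertex G) (C0 j r : R).
Notation gp := (gpoint G).
Notation d x := (gdist x (Vtx x0)).
Hypothesis connected_G : graph_connected G.
Hypothesis lfin : locally_finite G.
Hypothesis mu0 : forall x, 0 < mu x.
Hypothesis omega_ge0 : forall x y, 0 <= omega x y.
Hypothesis omega_C0 : forall x, \sum_(y \in [set y | adj x y]) omega x y <= C0 * mu x.
Hypothesis C00 : 0 < C0.
Hypothesis r0 : 0 < r.
Hypothesis len_rj : forall e : edge G, r <= len e <= j.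

Lemma adj_finite (v : vertex G) : finite_set [set y | adj v y].
Proof.
apply: (@sub_finite_set _ _ ((@initial R G) @` [set e | initial e = v \/ final e = v] `|`
   (@final R G) @` [set e | initial e = v \/ final e = v])).
  by move=> y [e [[iv fy]|[iy fv]]]; [right|left]; exists e => //=; tauto.
by rewrite finite_setU; split; apply: finite_image; exact: lfin.
Qed.

Lemma normr_vertex_laplacian (f : gp -> R) (v : vertex G) (M : R) : 0 <= M ->
  (forall y, adj v y -> `|f (Vtx y) - f (Vtx v)| <= M) ->
  `|vertex_laplacian mu omega f v| <= C0 * M.
Proof.
move=> M0 fM; rewrite /vertex_laplacian normrM gtr0_norm ?invr_gt0//.
rewrite mulrC ler_pdivrMr// mulrAC.
have fin := adj_finite v.
apply: (@le_trans _ _ ((\sum_(y \in [set y | adj v y]) omega v y) * M)); last first.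
  by rewrite ler_wpM2r.
rewrite !fsbig_finite//=.
rewrite (le_trans (ler_norm_sum _ _ _))// mulr_suml !big_seq ler_sum// => y.
rewrite in_fset_set// inE => /= vy; rewrite normrM ger0_norm//.
by rewrite ler_wpM2l// fM.
Qed.

Lemma gdist_initial e (s : R) : 0 < s < len e ->
  `|d (pt e s) - d (Vtx (initial e))| <= j.
Proof.
move=> /andP[s0 sl]; rewrite -(@pt_le0 _ _ e 0)//.
rewrite (le_trans (dist_gdist connected_G x0 _ _))//.
rewrite (le_trans (gdist_pt connected_G _ _ _))// subr0 gtr0_norm//.
by have /andP[_] := len_rj e; apply: le_trans; exact: ltW.
Qed.

Lemma gdist_final e (s : R) : 0 < s < len e ->
  `|d (pt e s) - d (Vtx (final e))| <= j.
Proof.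
move=> /andP[s0 sl]; rewrite -(@pt_ge_len _ _ e (len e))//.
rewrite (le_trans (dist_gdist connected_G x0 _ _))//.
rewrite (le_trans (gdist_pt connected_G _ _ _))// ltr0_norm ?subr_lt0// opprB.
have /andP[_] := len_rj e; apply: le_trans; lra.
Qed.

Lemma gdist_edge e : `|d (Vtx (initial e)) - d (Vtx (final e))| <= j.
Proof.
rewrite -(@pt_ge_len _ _ e (len e))// -(@pt_le0 _ _ e 0)//.
rewrite (le_trans (dist_gdist connected_G x0 _ _))//.
rewrite (le_trans (gdist_pt connected_G _ _ _))// sub0r normrN gtr0_norm ?len_gt0//.
by have /andP[_] := len_rj e.
Qed.

Lemma gdist_adj v y : adj v y -> `|d (Vtx y) - d (Vtx v)| <= j.
Proof.
by case=> e [[<- <-]|[<- <-]]; rewrite 1?distrC; first exact: gdist_edge;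
  rewrite distrC; exact: gdist_edge.
Qed.

(** The cutoff is constant on the ball of radius [rho], decays at the rate
    [alpha = delta / rho] outside of it, and is truncated at distance [N]. *)
Context (delta rho alpha N : R).
Hypothesis delta0 : 0 < delta.
Hypothesis rho0 : 0 < rho.
Hypothesis rhoj : 2 * j <= rho.
Hypothesis j0 : 0 <= j.
Hypothesis Nrho : rho + j <= N.
Hypothesis alpha_rho : alpha * rho = delta.

Let alpha0 : 0 < alpha.
Proof. by move: delta0; rewrite -alpha_rho pmulr_lgt0. Qed.

Let alpha_j : alpha * j <= delta.
Proof.
rewrite -alpha_rho (ler_pM2l alpha0); apply: le_trans rhoj.
by rewrite mulr_natl mulr2n lerDl.
Qed.

(** The shift by [j] gives the value [1] to both ends of any edge that meets the
    ball of radius [rho]. *)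
Definition profile (t : R) : R := Num.min 1 (expR (- alpha * (t - rho - j))).

Lemma profile_gt0 t : 0 < profile t.
Proof. by rewrite lt_min ltr01 expR_gt0. Qed.

Lemma profile1 t : t <= rho + j -> profile t = 1.
Proof.
move=> tr; rewrite /profile min_l// -expR0 ler_expR mulNr oppr_ge0.
by rewrite pmulr_rle0//; lra.
Qed.

Lemma profile_le t : profile t <= expR (delta + alpha * j) * expR (- alpha * t).
Proof.
rewrite -expRD ge_min; apply/orP; right; rewrite ler_expR -alpha_rho.
by have -> : - alpha * (t - rho - j) = alpha * rho + alpha * j + - alpha * t by ring.
Qed.

Lemma profile_comparable t t' : `|t - t'| <= j ->
  profile t' <= expR (alpha * j) * profile t.
Proof.
move=> tt'; have e1 : 1 <= expR (alpha * j).
  by rewrite -expR0 ler_expR mulr_ge0// ltW.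
have tj' : t - t' <= j by apply: le_trans tt'; exact: ler_norm.
rewrite {2}/profile minElt; case: ifP => _.
  by rewrite mulr1 (le_trans _ e1)// ge_min lexx.
rewrite -expRD ge_min; apply/orP; right; rewrite ler_expR.
by have := ler_wpM2l (ltW alpha0) tj'; lra.
Qed.

(** The values of [profile] at distance at most [j] differ by a factor between
    [expR (- (alpha * j))] and [expR (alpha * j)]. *)
Lemma profile_lipschitz t t' : `|t - t'| <= j ->
  `|profile t' - profile t| <= alpha * j * expR (alpha * j) * profile t.
Proof.
move=> tt'; have h1 := profile_comparable tt'.
have h2 : profile t <= expR (alpha * j) * profile t'.
  by apply: profile_comparable; rewrite distrC.
have p0 := profile_gt0 t; have p0' := profile_gt0 t'.
set k := alpha * j in h1 h2 *.
have k0 : 0 <= k by rewrite mulr_ge0// ltW.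
have e0 := expR_gt0 k.
have e2 : expR k - 1 <= k * expR k.
  have := expR_ge1Dx (- k); rewrite expRN => H.
  have : (1 - k) * expR k <= (expR k)^-1 * expR k by rewrite ler_wpM2r// ltW.
  by rewrite mulVf ?gt_eqF//; lra.
have e1 : 1 <= expR k by rewrite -expR0 ler_expR.
have e3 : (expR k - 1) * profile t <= k * expR k * profile t.
  by rewrite ler_wpM2r// ltW.
rewrite ler_norml; apply/andP; split; last by lra.
have e4 : profile t <= profile t + (expR k - 1) * (profile t - profile t') ->
  - (k * expR k * profile t) <= profile t' - profile t by nra.
have : profile t - profile t' <= (expR k - 1) * profile t.
  have [tt|tt] := leP (profile t) (profile t').
    by apply: (@le_trans _ _ 0); [lra|apply: mulr_ge0; lra].
  have := ler_wpM2l (_ : 0 <= expR k - 1) (ltW tt); nra.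
lra.
Qed.

Definition cutoff_val (v : vertex G) : R :=
  if d (Vtx v) <= N then profile (d (Vtx v)) else 0.

Notation xi := (interp cutoff_val).
Notation lap_xi := (interp_laplacian mu omega cutoff_val).

Lemma cutoff_val_ge0 v : 0 <= cutoff_val v.
Proof. by rewrite /cutoff_val; case: ifP => // _; exact/ltW/profile_gt0. Qed.

Lemma cutoff_val_le v :
  cutoff_val v <= expR (delta + alpha * j) * expR (- alpha * d (Vtx v)).
Proof.
rewrite /cutoff_val; case: ifP => _; first exact: profile_le.
by rewrite mulr_ge0// expR_ge0.
Qed.

Lemma cutoff_val_neq0 v : cutoff_val v != 0 -> d (Vtx v) <= N.
Proof. by rewrite /cutoff_val; case: ifP => //; rewrite eqxx. Qed.

Lemma cutoff_val1 v : d (Vtx v) <= rho + j -> cutoff_val v = 1.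
Proof. by move=> dv; rewrite /cutoff_val (le_trans dv Nrho) profile1. Qed.

Let expR_shift (t t' : R) : `|t - t'| <= j ->
  expR (- alpha * t') <= expR (alpha * j) * expR (- alpha * t).
Proof.
move=> tt'; rewrite -expRD ler_expR.
have tj' : t - t' <= j by apply: le_trans tt'; exact: ler_norm.
by have := ler_wpM2l (ltW alpha0) tj'; lra.
Qed.

Let ends_le e (s : R) (v : vertex G) : 0 < s < len e ->
  `|d (pt e s) - d (Vtx v)| <= j ->
  cutoff_val v <= expR (3 * delta) * expR (- alpha * d (pt e s)).
Proof.
move=> s_in dv; apply: le_trans (cutoff_val_le v) _.
apply: (@le_trans _ _ (expR (delta + alpha * j) *
    (expR (alpha * j) * expR (- alpha * d (pt e s))))).
  by rewrite ler_pM2l ?expR_gt0// expR_shift.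
by rewrite mulrA ler_pM2r ?expR_gt0// -expRD ler_expR; have := delta0; have := alpha_j; lra.
Qed.

Lemma interp_cutoff_val_ge0 x : 0 <= xi x.
Proof.
case: x => [v|e s] /=; first exact: cutoff_val_ge0.
have /andP[s0 sl] := valP s.
have := @hermite_bounds _ (len e) (cutoff_val (initial e)) (cutoff_val (final e))
  (val s) (len_gt0 e).
rewrite (ltW s0) (ltW sl) => /(_ isT)/andP[+ _]; apply: le_trans.
by rewrite le_min !cutoff_val_ge0.
Qed.

Lemma xi_le x : xi x <= expR (3 * delta) * expR (- alpha * d x).
Proof.
case: x => [v|e s].
  apply: le_trans (cutoff_val_le v) _.
  by rewrite ler_pM2r ?expR_gt0// ler_expR; have := delta0; have := alpha_j; lra.
have s_in := valP s; rewrite (Inner_pt s) interp_pt//.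
have /andP[s0 sl] := s_in.
have := @hermite_bounds _ (len e) (cutoff_val (initial e)) (cutoff_val (final e))
  (val s) (len_gt0 e).
rewrite (ltW s0) (ltW sl) => /(_ isT)/andP[_ +]; move=> /le_trans; apply.
rewrite ge_max; apply/andP; split; apply: ends_le => //.
  exact: gdist_initial.
exact: gdist_final.
Qed.

Lemma xi_le1 x : xi x <= 1.
Proof.
have val_le1 v : cutoff_val v <= 1.
  by rewrite /cutoff_val; case: ifP => // _; rewrite ge_min lexx.
case: x => [v|e s] /=; first exact: val_le1.
have /andP[s0 sl] := valP s.
have := @hermite_bounds _ (len e) (cutoff_val (initial e)) (cutoff_val (final e))
  (val s) (len_gt0 e).
rewrite (ltW s0) (ltW sl) => /(_ isT)/andP[_ +]; move=> /le_trans; apply.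
by rewrite ge_max !val_le1.
Qed.

Lemma xi_ball x : d x < rho -> xi x = 1.
Proof.
case: x => [v|e s] dx; first by apply: cutoff_val1; rewrite (le_trans (ltW dx))// lerDl.
have s_in := valP s; move: dx; rewrite (Inner_pt s) interp_pt// => dx.
have := gdist_initial s_in; have := gdist_final s_in; rewrite !ler_norml.
move=> /andP[f1 f2] /andP[i1 i2].
rewrite !cutoff_val1; [by rewrite /hermite subrr mul0r addr0|lra|lra].
Qed.

Lemma lap_xi_ball x : d x < rho -> lap_xi x = 0.
Proof.
case: x => [v|e s] dx.
  rewrite /= /vertex_laplacian fsbig1 ?mulr0// => y /= /gdist_adj.
  rewrite ler_norml => /andP[y1 y2].
  by rewrite !cutoff_val1 ?subrr ?mulr0//; move: dx y1 y2; have := j0; lra.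
have s_in := valP s; move: dx; rewrite (Inner_pt s) interp_laplacian_pt// => dx.
have := gdist_initial s_in; have := gdist_final s_in; rewrite !ler_norml.
move=> /andP[f1 f2] /andP[i1 i2].
rewrite !cutoff_val1; [by rewrite /hermite2 subrr !mul0r|lra|lra].
Qed.

Lemma xi_support x : xi x != 0 -> d x <= N + j.
Proof.
case: x => [v /= /cutoff_val_neq0|e s]; first by have := j0; lra.
have s_in := valP s; rewrite (Inner_pt s) interp_pt// => xi0.
have := gdist_initial s_in; have := gdist_final s_in; rewrite !ler_norml.
move=> /andP[f1 f2] /andP[i1 i2].
have [ai|/cutoff_val_neq0] := eqVneq (cutoff_val (initial e)) 0; last by lra.
have [af|/cutoff_val_neq0] := eqVneq (cutoff_val (final e)) 0; last by lra.
by move: xi0; rewrite ai af /hermite subrr mul0r addr0 eqxx.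
Qed.

Let hermite2_le (e : edge G) (s B : R) : 0 < s < len e ->
  `|cutoff_val (final e) - cutoff_val (initial e)| <= B ->
  `|hermite2 (len e) (cutoff_val (initial e)) (cutoff_val (final e)) s|
     <= 6%:R / r ^+ 2 * B.
Proof.
move=> /andP[s0 sl] dB.
have := @hermite2_bound _ (len e) (cutoff_val (initial e)) (cutoff_val (final e)) s
  (len_gt0 e).
rewrite (ltW s0) (ltW sl) => /(_ isT) /le_trans; apply.
have /andP[rl _] := len_rj e.
have B0 : 0 <= B by apply: le_trans dB.
have l0 := len_gt0 e.
rewrite mulrAC; apply: ler_pM => //; first by rewrite divr_ge0// exprn_ge0// ltW.
rewrite ler_pM2l// lef_pV2 ?posrE ?exprn_gt0//.
by rewrite ler_pXn2r// nnegrE ltW.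
Qed.

(** Away from the truncation, the relative variation of the cutoff between two
    neighbouring vertices is of order [alpha * j], that is, [1 / rho]. *)
Lemma lap_xi_le x : d x <= N - j ->
  `|lap_xi x| <= (C0 + 6%:R / r ^+ 2) * (delta * j * expR delta) / rho * xi x.
Proof.
have r2 : 0 <= 6%:R / r ^+ 2 by rewrite mulr_ge0// invr_ge0 exprn_ge0// ltW.
have kk t : 0 <= t -> alpha * j * expR (alpha * j) * t <= delta * j * expR delta / rho * t.
  move=> t0; rewrite ler_wpM2r//.
  have -> : delta * j * expR delta / rho = alpha * j * expR delta.
    by rewrite -alpha_rho; field; exact: lt0r_neq0.
  by rewrite ler_wpM2l ?ler_expR// mulr_ge0// ltW.
set k := delta * j * expR delta / rho in kk.
have k0 : 0 <= k.
  by rewrite divr_ge0 ?(ltW rho0)// !mulr_ge0 ?expR_ge0 ?(ltW delta0).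
rewrite -[(_ * (_ * expR delta)) / rho]mulrA -/k => dx.
have fin c t t' : 0 <= c -> c <= C0 + 6%:R / r ^+ 2 -> 0 <= t' -> t <= c * (k * t') ->
    t <= (C0 + 6%:R / r ^+ 2) * k * t'.
  move=> c0 cc t0 /le_trans; apply; rewrite -mulrA ler_wpM2r// mulr_ge0//.
case: x dx => [v|e s] dx.
  apply: (fin C0); [exact: ltW|lra|exact: interp_cutoff_val_ge0|].
  have cv : cutoff_val v = profile (d (Vtx v)).
    by rewrite /cutoff_val ifT//; move: dx; have := j0; lra.
  apply: normr_vertex_laplacian.
    by rewrite mulr_ge0// interp_cutoff_val_ge0.
  move=> y /gdist_adj vy /=.
  have cy : cutoff_val y = profile (d (Vtx y)).
    rewrite /cutoff_val ifT//; move: dx vy; rewrite ler_norml => ? /andP[? ?]; lra.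
  rewrite cv cy; apply: le_trans (profile_lipschitz _) (kk _ _).
    by rewrite distrC.
  exact/ltW/profile_gt0.
have s_in := valP s; have /andP[s0 sl] := s_in.
have := gdist_final s_in; rewrite ler_distl => /andP[f1 f2].
have := gdist_initial s_in; rewrite ler_distl => /andP[i1 i2].
move: dx; rewrite (Inner_pt s) interp_pt// interp_laplacian_pt// => dx.
have ci : cutoff_val (initial e) = profile (d (Vtx (initial e))).
  by rewrite /cutoff_val ifT//; lra.
have cf : cutoff_val (final e) = profile (d (Vtx (final e))).
  by rewrite /cutoff_val ifT//; lra.
have := @hermite_bounds _ (len e) (cutoff_val (initial e)) (cutoff_val (final e))
  (val s) (len_gt0 e).
rewrite (ltW s0) (ltW sl) => /(_ isT)/andP[hmin _].
have h0 : 0 <= Num.min (cutoff_val (initial e)) (cutoff_val (final e)).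
  by rewrite le_min !cutoff_val_ge0.
apply: (fin (6%:R / r ^+ 2)) => //; first by have := C00; have := r2; lra.
  exact: le_trans hmin.
apply: hermite2_le => //.
apply: (@le_trans _ _ (k * Num.min (cutoff_val (initial e)) (cutoff_val (final e)))); last first.
  by rewrite ler_wpM2l.
have de := gdist_edge e.
rewrite ci cf minElt; case: ifP => _.
  apply: le_trans (profile_lipschitz _) (kk _ _); first by [].
  exact/ltW/profile_gt0.
rewrite distrC; apply: le_trans (profile_lipschitz _) (kk _ _); first by rewrite distrC.
exact/ltW/profile_gt0.
Qed.

(** Across the truncation the values of the cutoff are not comparable; each of them
    is bounded by the exponential weight, without any gain in [rho]. *)
Lemma lap_xi_le_exp x :
  `|lap_xi x| <= (C0 + 6%:R / r ^+ 2) * (2%:R * expR (3 * delta)) * expR (- alpha * d x).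
Proof.
have r2 : 0 <= 6%:R / r ^+ 2 by rewrite mulr_ge0// invr_ge0 exprn_ge0// ltW.
set E := expR (3 * delta).
have fin c t t' : 0 <= c -> c <= C0 + 6%:R / r ^+ 2 -> 0 <= t' ->
    t <= c * (2%:R * E * t') -> t <= (C0 + 6%:R / r ^+ 2) * (2%:R * E) * t'.
  move=> c0 cc t0 /le_trans; apply; rewrite -[leRHS]mulrA; apply: ler_wpM2r => //.
  by rewrite mulr_ge0// mulr_ge0// expR_ge0.
have tri (y z m : R) : 0 <= y -> 0 <= z -> y <= m -> z <= m -> `|y - z| <= 2%:R * m.
  by move=> ? ? ? ?; rewrite ler_norml; apply/andP; split; lra.
case: x => [v|e s].
  apply: (fin C0); [exact: ltW|lra|exact: expR_ge0|].
  apply: normr_vertex_laplacian; first by rewrite !mulr_ge0// expR_ge0.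
  move=> y /gdist_adj vy /=; rewrite -mulrA.
  apply: tri; [exact: cutoff_val_ge0|exact: cutoff_val_ge0| |exact: (xi_le (Vtx v))].
  apply: le_trans (cutoff_val_le y) _.
  apply: (@le_trans _ _ (expR (delta + alpha * j) *
      (expR (alpha * j) * expR (- alpha * d (Vtx v))))).
    by rewrite ler_pM2l ?expR_gt0// expR_shift// distrC.
  by rewrite mulrA ler_pM2r ?expR_gt0// -expRD ler_expR; have := delta0; have := alpha_j; lra.
have s_in := valP s.
rewrite (Inner_pt s) interp_laplacian_pt//.
apply: (fin (6%:R / r ^+ 2)) => //; [by have := C00; have := r2; lra|].
apply: hermite2_le => //; rewrite -mulrA.
apply: tri; [exact: cutoff_val_ge0|exact: cutoff_val_ge0| |].
  by apply: ends_le => //; exact: gdist_final.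
by apply: ends_le => //; exact: gdist_initial.
Qed.

End spatial_cutoff.

(** * Measurability and integrability in space-time *)

Section space_time.
Context (R : realType) (G : metricGraph R) (mu : vertex G -> R).
Hypothesis mu0 : forall x, 0 < mu x.
Notation leb := (@lebesgue_measure R).
Notation gp := (gpoint G).
Notation gi := (graph_int_ge0 mu).

Lemma st_measurableM (f g : gp -> R -> R) : st_measurable f -> st_measurable g ->
  st_measurable (fun x t => f x t * g x t).
Proof. by move=> [fv fe] [gv ge]; split => [v|e]; exact: measurable_funM. Qed.

Lemma st_measurableD (f g : gp -> R -> R) : st_measurable f -> st_measurable g ->
  st_measurable (fun x t => f x t + g x t).
Proof. by move=> [fv fe] [gv ge]; split => [v|e]; exact: measurable_funD. Qed.

Lemma st_measurable_comp (k : R -> R) (f : gp -> R -> R) :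
  measurable_fun setT k -> st_measurable f -> st_measurable (fun x t => k (f x t)).
Proof. by move=> mk [fv fe]; split => [v|e]; exact: measurableT_comp. Qed.

Lemma st_measurable_time (k : R -> R) : measurable_fun setT k ->
  st_measurable (fun (_ : gp) t => k t).
Proof.
move=> mk; split => [v|e]; first exact: measurable_funTS.
by apply: measurable_funTS; exact: (measurableT_comp mk).
Qed.

Lemma st_measurable_space (f : gp -> R) : graph_measurable f ->
  st_measurable (fun x (_ : R) => f x).
Proof.
move=> mf; split => [v|e]; first exact: measurable_cst.
apply: (@measurable_comp _ _ _ _ _ _ `]0, len e[ (f \o pt e) _ (@fst R R)) => //.
  by move=> _ [p [p1 _] <-].
exact: measurable_funTS.
Qed.

Lemma eq_st_int (f g : gp -> R -> R) :
  (forall x (t : R), 0 <= t -> f x t = g x t) -> st_integrable mu f ->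
  st_integrable mu g /\ st_int mu f = st_int mu g.
Proof.
move=> fg [fi1 fi2].
have fgt (t : R) : 0 <= t -> f ^~ t = g ^~ t.
  by move=> t0; apply/funext => x; exact: fg.
have I0 (t : R) : t \in `[(0 : R), +oo[%classic -> 0 <= t.
  by rewrite inE /= in_itv/= andbT.
split; last by apply: eq_integral => t /I0 /fgt ->.
split.
  apply: (@filterS _ _ (ae_filter_ringOfSetsType leb) _ _ _ fi1) => t H t0.
  by rewrite -fgt//; exact: H.
by apply: eq_integrable fi2 => // t /I0 /fgt ->.
Qed.

Lemma st_int_congr (f g : gp -> R -> R) :
  (forall t : R, 0 <= t -> graph_integrable mu (g ^~ t)) ->
  (forall t : R, 0 <= t -> graph_int mu (g ^~ t) = graph_int mu (f ^~ t)) ->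
  st_integrable mu f -> st_integrable mu g /\ st_int mu g = st_int mu f.
Proof.
move=> gi0 gf [_ fi].
have I0 (t : R) : t \in `[(0 : R), +oo[%classic -> 0 <= t.
  by rewrite inE /= in_itv/= andbT.
split; last by apply: eq_integral => t /I0 /gf ->.
split; first exact: aeW.
by apply: eq_integrable fi => // t /I0 /gf ->.
Qed.

Lemma st_int_ge0E (f : gp -> R -> R) : (forall x (t : R), 0 <= t -> 0 <= f x t) ->
  st_int mu f = st_int_ge0 mu (fun x t => (f x t)%:E).
Proof.
move=> f0; apply: eq_integral => t; rewrite inE /= in_itv/= andbT => t0.
rewrite /graph_int funepos_EFin funeneg_EFin.
have -> : (fun x => (Num.max (- f x t) 0)%:E) = (fun=> 0%E).
  by apply/funext => x; rewrite max_r// oppr_le0 f0.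
rewrite graph_int_ge0_0 sube0; congr gi; apply/funext => x.
by rewrite max_l// f0.
Qed.

Lemma graph_integrable_parts (f : gp -> R) : graph_integrable mu f ->
  gi (EFin \o f)^\+%E \is a fin_num /\ gi (EFin \o f)^\-%E \is a fin_num.
Proof.
move=> [mf foo]; have maf := graph_emeasurable_pos mf.
have p0 : (0 <= gi (EFin \o f)^\+)%E by exact: graph_int_ge0_ge0.
have n0 : (0 <= gi (EFin \o f)^\-)%E by exact: graph_int_ge0_ge0.
rewrite -(graph_int_ge0_abs mu0 mf) in foo.
by rewrite !ge0_fin_numE//; split; apply: le_lt_trans foo; [exact: leeDl|exact: leeDr].
Qed.

Lemma graph_int_fin_num (f : gp -> R) : graph_integrable mu f ->
  graph_int mu f \is a fin_num.
Proof. by move=> /graph_integrable_parts [? ?]; rewrite fin_numB; apply/andP. Qed.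

Lemma graph_integrableZ (f : gp -> R) (c : R) : 0 <= c -> graph_integrable mu f ->
  graph_integrable mu (fun x => c * f x).
Proof.
move=> c0 [mf foo]; have mcf : graph_measurable (fun x => c * f x).
  by move=> e; apply: measurable_funM => //; exact: mf.
split => //.
have -> : (fun x => `|c * f x|%:E) = (fun x => c%:E * `|f x|%:E)%E.
  by apply/funext => x; rewrite normrM (ger0_norm c0).
rewrite graph_int_ge0Z// ?lte_mul_pinfty//.
by move=> e; apply/measurable_EFinP/measurableT_comp => //; exact: mf.
Qed.

Lemma graph_intZ (f : gp -> R) (c : R) : 0 <= c -> graph_integrable mu f ->
  graph_int mu (fun x => c * f x) = (c%:E * graph_int mu f)%E.
Proof.
move=> c0 fi; have [mf _] := fi; have [pf nf] := graph_integrable_parts fi.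
have mp := graph_emeasurable_pos mf; have mn := graph_emeasurable_neg mf.
rewrite /graph_int muleBr//; last by rewrite fin_num_adde_defr.
have -> : EFin \o (fun x => c * f x) = (fun x => c%:E * (EFin \o f) x)%E.
  by apply/funext => x; rewrite /= EFinM.
by rewrite -!graph_int_ge0Z// ge0_funeposM// ge0_funenegM.
Qed.

Lemma X_norm_st_int_ge0_fin (x0 : vertex G) (alpha S : R) (u : gp -> R -> R) :
  0 < S -> in_L1loc_X mu x0 alpha u ->
  (st_int_ge0 mu (fun x t => (expR (- alpha * gdist x (Vtx x0)) * `|u x t| * (t <= S)%R%:R)%:E)
     < +oo)%E.
Proof.
move=> S0 [_ /(_ S S0)]; apply: le_lt_trans; rewrite /st_int_ge0.
rewrite integral_mkcond [leRHS]integral_mkcond le_eqVlt; apply/orP; left; apply/eqP.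
apply: eq_integral => t _; rewrite !patchE; case: ifPn.
  rewrite inE /= in_itv/= andbT => t0; case: ifPn.
    rewrite inE /= in_itv/= => /andP[_ tS]; rewrite /X_norm; congr gi.
    by apply/funext => x; rewrite tS mulr1.
  move=> /negP; rewrite inE /= in_itv/= t0/= => /negP/negbTE tS.
  rewrite -[RHS](graph_int_ge0_0 mu); congr gi.
  by apply/funext => x; rewrite tS mulr0.
move=> /negP; rewrite inE /= in_itv/= andbT => t0.
case: ifPn => //; rewrite inE /= in_itv/= => /andP[t0' _].
by case: t0.
Qed.

End space_time.

(** * The weak inequality for a product test function *)

Section weak_inequality.
Context (R : realType) (G : metricGraph R).
Context (mu : vertex G -> R) (omega : vertex G -> vertex G -> R).
Hypothesis mu0 : forall x, 0 < mu x.
Hypothesis omega_sym : forall x y, omega x y = omega y x.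
Hypothesis omega_ge0 : forall x y, 0 <= omega x y.
Hypothesis omega_adj : forall x y, 0 < omega x y <-> adj x y.
Hypothesis connected_G : graph_connected G.
Notation gp := (gpoint G).

Lemma graph_measurable_interp (a : vertex G -> R) : graph_measurable (interp a).
Proof.
move=> e.
have H : measurable_fun `]0, len e[ (hermite (len e) (a (initial e)) (a (final e))).
  apply: measurable_funTS; apply: continuous_measurable_fun.
  by apply: hermite_continuous; rewrite gt_eqF// len_gt0.
apply: eq_measurable_fun H => s; rewrite inE /= in_itv/= => s_in.
by rewrite interp_pt.
Qed.

Lemma graph_measurable_interp_laplacian (a : vertex G -> R) :
  graph_measurable (interp_laplacian mu omega a).
Proof.
move=> e.
have H : measurable_fun `]0, len e[ (hermite2 (len e) (a (initial e)) (a (final e))).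
  apply: measurable_funTS; apply: continuous_measurable_fun.
  by apply: hermite2_continuous; rewrite gt_eqF// len_gt0.
apply: eq_measurable_fun H => s; rewrite inE /= in_itv/= => s_in.
by rewrite interp_laplacian_pt.
Qed.

Context (x0 : vertex G).
Notation d x := (gdist x (Vtx x0)).

Lemma graph_measurable_gdist : graph_measurable (fun x => d x).
Proof.
move=> e; apply: measurable_funTS; apply: continuous_measurable_fun.
exact: gdist_pt_continuous.
Qed.

Lemma graph_integrable_in_X (alpha K : R) (f xi : gp -> R) :
  in_X mu x0 alpha f -> graph_measurable xi ->
  (forall x, `|xi x| <= K * expR (- alpha * d x)) ->
  graph_integrable mu (fun x => f x * xi x).
Proof.
move=> [mf Xoo] mxi xiK.
have mfxi : graph_measurable (fun x => f x * xi x).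
  by move=> e; apply: measurable_funM; [exact: mf|exact: mxi].
have K0 : 0 <= K.
  by have := le_trans (normr_ge0 _) (xiK (Vtx x0)); rewrite pmulr_lge0// expR_gt0.
have mX : graph_emeasurable (fun x => (expR (- alpha * d x) * `|f x|)%:E).
  move=> e; apply/measurable_EFinP/measurable_funM.
    apply: measurableT_comp => //; apply: measurable_funM => //.
    exact: graph_measurable_gdist.
  by apply: measurableT_comp => //; exact: mf.
split; first exact: mfxi.
apply: (@le_lt_trans _ _ (K%:E * X_norm mu x0 alpha f)%E); last first.
  by rewrite lte_mul_pinfty.
have X0 x : (0 <= (expR (- alpha * d x) * `|f x|)%:E)%E.
  by rewrite lee_fin mulr_ge0// expR_ge0.
rewrite /X_norm -(graph_int_ge0Z mu0 mX X0 K0).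
apply: (le_graph_int_ge0 mu0).
- by move=> e; apply/measurable_EFinP/measurableT_comp => //; exact: mfxi.
- by move=> e; apply: measurable_funeM; exact: mX.
- by move=> x; rewrite lee_fin.
- move=> x; rewrite -EFinM lee_fin normrM.
  by rewrite mulrC mulrA ler_wpM2r.
Qed.

(* The integral [S] may be infinite beforehand, which forbids subtracting in
   extended reals without care. *)
Let ereal_rearrange (a1 a2 g A1 A2 S : \bar R) : g \is a fin_num ->
  (`|a1| <= A1 -> A1 < +oo -> `|a2| <= A2 -> A2 < +oo ->
  - a1 + a2 + S + g <= 0 -> S + g <= A1 + A2)%E.
Proof.
have absfin (y A : \bar R) : (`|y| <= A -> A < +oo ->
    exists r s : R, [/\ y = r%:E, A = s%:E & (`|r| <= s)%R])%E.
  move=> yA Aoo.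
  have A0 : (0 <= A)%E := le_trans (abse_ge0 y) yA.
  have Af : A \is a fin_num by rewrite ge0_fin_numE.
  have yf : y \is a fin_num by rewrite fin_num_abs (le_lt_trans yA).
  exists (fine y), (fine A); rewrite !fineK//; split => //.
  by move: yA; rewrite -(fineK Af) -[in X in X -> _](fineK yf) lee_fin.
move=> /fineK <- le1 f1f le2 f2f.
have [r1 [s1 [-> -> b1]]] := absfin _ _ le1 f1f.
have [r2 [s2 [-> -> b2]]] := absfin _ _ le2 f2f.
move: b1 b2; rewrite !ler_norml => /andP[? ?] /andP[? ?].
case: S => [s| |]; last 2 first.
- by rewrite -EFinN -EFinD addey// addye// leye_eq.
- by move=> _; rewrite addNye leNye.
by rewrite -EFinN -!EFinD !lee_fin; lra.
Qed.

Context (a : vertex G -> R) (M T : R) (n : nat).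
Hypothesis T0 : 0 < T.
Hypothesis xi_ge0 : forall x, 0 <= interp a x.
Hypothesis xi_supp : forall x, interp a x != 0 -> d x <= M.
Hypothesis finite_ball : finite_part (gball (Vtx x0) (M + 1)).

Notation xi := (interp a).
Notation lap_xi := (interp_laplacian mu omega a).
Notation psi := (cutoff n T).
Notation psi2 := (cutoff2 n T).

Let phi (x : gp) (t : R) := xi x * psi t.

Let phi_C2 x : [/\ Ck_on `[(0 : R), +oo[ 2 (phi x),
  forall t, 0 <= t -> time_deriv phi x t = xi x * cutoff1 n T t &
  forall t, 0 <= t -> time_deriv2 phi x t = xi x * psi2 t].
Proof.
have Dc c (f f1 : R -> R) : (forall t, is_derive t (1 : R) f (f1 t)) ->
    forall t, is_derive t (1 : R) (fun s => c * f s) (c * f1 t).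
  by move=> fd t; have := is_deriveZ c (fd t).
apply: (@Ck_on2_is_derive R (phi x) (fun t => xi x * cutoff1 n T t)
  (fun t => xi x * psi2 t)).
- by apply: Dc => t; exact: is_derive_cutoff.
- by apply: Dc => t; exact: is_derive_cutoff1.
- by move=> t; apply: cvgM; [exact: cvg_cst|exact: cutoff2_continuous].
- by [].
Qed.

Let cont_psi : continuous psi.
Proof.
move=> t; apply: differentiable_continuous; apply/derivable1_diffP.
by have [] := is_derive_cutoff n T t.
Qed.

Lemma st_measurable_cutoff : st_measurable phi.
Proof.
apply: (@st_measurableM _ _ (fun x _ => xi x) (fun _ t => psi t)).
  by apply: st_measurable_space; exact: graph_measurable_interp.
by apply: st_measurable_time; exact: continuous_measurable_fun.
Qed.

Lemma test_function_cutoff : test_function phi.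
Proof.
split.
- by move=> x t _; rewrite mulr_ge0// cutoff_ge0.
- exists (2 * T), [set x | d x <= M]; split; first by rewrite mulr_gt0.
    exact: compact_gball.
  have cl : closed ([set x | d x <= M] `*` `[0, 2 * T]).
    have -> : [set x | d x <= M] `*` `[0, 2 * T] =
        (@fst gp R) @^-1` [set x | d x <= M] `&` (@snd gp R) @^-1` `[0, 2 * T].
      by [].
    apply: closedI; apply: preimage_closed => //.
    + by move=> p _; exact: cvg_fst.
    + exact: closed_gball.
    + by move=> p _; exact: cvg_snd.
    + exact: itv_closed.
  rewrite [X in _ `<=` X](closure_id _).1//; apply: closure_subset.
  move=> [x t] /= [t0 p0].
  have x_supp : xi x != 0 by apply: contra_neq p0; rewrite /phi => ->; rewrite mul0r.
  split => /=; first exact: xi_supp.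
  rewrite in_itv/= t0/= leNgt; apply: contra_neqN p0 => tT.
  by rewrite /phi cutoff_late ?mulr0// ltW.
- by move=> x; have [] := phi_C2 x.
- exact: st_measurable_cutoff.
Qed.

Context (vs : seq (vertex G)) (es : seq (edge G)).
Hypothesis (uvs : uniq vs) (ues : uniq es).
Hypothesis avs : forall v, a v != 0 -> v \in vs.
Hypothesis advs : forall v w, a v != 0 -> adj v w -> w \in vs.
Hypothesis aes : forall e, (a (initial e) != 0) || (a (final e) != 0) -> e \in es.

Context (sigma alpha K : R) (h : gp -> R -> R) (u0 u1 : gp -> R) (u : gp -> R -> R).
Hypothesis xi_le : forall x, xi x <= K * expR (- alpha * d x).
Hypothesis lap_xi_le : forall x, `|lap_xi x| <= K * expR (- alpha * d x).
Hypothesis h0 : forall x (t : R), 0 <= t -> 0 < h x t.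
Hypothesis u_sol : very_weak_solution mu omega sigma h u0 u1 u.
Hypothesis u_X : in_L1loc_X mu x0 alpha u.
Hypothesis u1_X : in_X mu x0 alpha u1.

(** What remains of the terms with no definite sign, once all derivatives have been
    moved to the test function and absolute values are taken. *)
Definition weak_remainder (x : gp) (t : R) : R :=
  `|u x t| * (`|psi2 t| * xi x + psi t * `|lap_xi x|).

Let exp_bound (c : R) : 0 <= c -> forall f : gp -> R -> R, st_measurable f ->
  (forall x t, 0 <= t -> `|f x t| <=
     c * (expR (- alpha * d x) * `|u x t| * (t <= 2 * T)%R%:R)) ->
  (st_int_ge0 mu (fun x t => `|f x t|%:E) < +oo)%E.
Proof.
move=> c0 f mf fb.
have S0 : 0 < 2 * T by rewrite mulr_gt0.
have mE : st_measurable (fun x t =>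
    expR (- alpha * gdist x (Vtx x0)) * `|u x t| * (t <= 2 * T)%R%:R).
  apply: st_measurableM; first apply: st_measurableM.
  - apply: (@st_measurable_space _ _ (fun x => expR (- alpha * d x))) => e.
    apply: measurableT_comp => //; apply: measurable_funM => //.
    exact: graph_measurable_gdist.
  - by apply: st_measurable_abs; have [] := u_X.
  - apply: st_measurable_time; apply: nonincreasing_measurable => // s t st.
    rewrite ler_nat; have [tT|] := leP t (2 * T); last by [].
    by rewrite (le_trans st tT).
pose E x t := expR (- alpha * gdist x (Vtx x0)) * `|u x t| * (t <= 2 * T)%R%:R.
have E0 x t : 0 <= t -> (0 <= (E x t)%:E)%E.
  by move=> _; rewrite lee_fin !mulr_ge0// expR_ge0.
have mE' : st_emeasurable (fun x t => (E x t)%:E) := st_measurable_EFin mE.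
have sE := st_int_ge0Z mu0 mE' E0 c0.
have mcE : st_emeasurable (fun x t => (c%:E * (E x t)%:E)%E).
  apply: (st_measurable_EFin (f := fun x t => c * E x t)).
  apply: (@st_measurableM _ _ (fun _ _ => c)); last exact: mE.
  by apply: st_measurable_time; exact: measurable_cst.
have le1 x t : 0 <= t -> (`|f x t|%:E <= c%:E * (E x t)%:E)%E.
  by move=> t0; rewrite -EFinM lee_fin; exact: fb.
have f00 x t : 0 <= t -> (0 <= `|f x t|%:E)%E by move=> _; rewrite lee_fin.
have H := le_st_int_ge0 mu0 (st_measurable_EFin (st_measurable_abs mf)) mcE f00 le1.
rewrite sE in H; apply: le_lt_trans H _.
have Eoo := X_norm_st_int_ge0_fin S0 u_X.
by rewrite lte_mul_pinfty.
Qed.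

Let m_xi : st_measurable (fun x (_ : R) => xi x).
Proof. by apply: st_measurable_space; exact: graph_measurable_interp. Qed.

Let m_lap : st_measurable (fun x (_ : R) => lap_xi x).
Proof. by apply: st_measurable_space; exact: graph_measurable_interp_laplacian. Qed.

Let m_psi : st_measurable (fun (_ : gp) t => psi t).
Proof. by apply: st_measurable_time; exact: continuous_measurable_fun. Qed.

Let m_psi2 : st_measurable (fun (_ : gp) t => psi2 t).
Proof.
by apply: st_measurable_time; apply: continuous_measurable_fun; exact: cutoff2_continuous.
Qed.

Let m_u : st_measurable u. Proof. by have [] := u_X. Qed.

Let K0 : 0 <= K.
Proof.
have := le_trans (normr_ge0 _) (lap_xi_le (Vtx x0)).
by rewrite pmulr_lge0// expR_gt0.
Qed.

Let late (t : R) : (t <= 2 * T) = false -> 2 * T <= t.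
Proof. by move=> /negbT; rewrite -ltNge; exact: ltW. Qed.

Let psi2_bounded : exists2 B : R, 0 <= B & forall t, `|psi2 t| <= B.
Proof.
exists (n.+3%:R * (9%:R * n.+2%:R + 6%:R) / T ^+ 2).
  by rewrite divr_ge0 ?exprn_ge0// ltW.
move=> t; apply: le_trans (cutoff2_bound n T0 t) _.
rewrite ler_pM2r ?invr_gt0 ?exprn_gt0//.
by rewrite -[leRHS]mulr1 ler_wpM2l// ppow_le1// cutoff_base_le1.
Qed.

Let f1 (x : gp) (t : R) := xi x * psi2 t * u x t.
Let f2 (x : gp) (t : R) := psi t * (u x t * lap_xi x).

Let mf1 : st_measurable f1.
Proof.
apply: (@st_measurableM _ _ (fun x t => xi x * psi2 t)); last exact: m_u.
exact: (@st_measurableM _ _ (fun x _ => xi x)).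
Qed.

Let mf2 : st_measurable f2.
Proof.
apply: (@st_measurableM _ _ (fun _ t => psi t)); first exact: m_psi.
exact: (@st_measurableM _ _ u).
Qed.

Let f1_fin : (st_int_ge0 mu (fun x t => `|f1 x t|%:E) < +oo)%E.
Proof.
have [B B0 psiB] := psi2_bounded.
apply: (@exp_bound (K * B)); [exact: mulr_ge0|exact: mf1|] => x t t0.
rewrite /f1; case tT : (t <= 2 * T); last first.
  by rewrite cutoff2_late ?late// mulr0 mul0r normr0 mulr0 mulr0.
rewrite 2!normrM (ger0_norm (xi_ge0 x)).
have -> : K * B * (expR (- alpha * d x) * `|u x t| * true%:R) =
    K * expR (- alpha * d x) * B * `|u x t| by rewrite mulr1; ring.
by apply: ler_wpM2r => //; apply: ler_pM.
Qed.

Let f2_fin : (st_int_ge0 mu (fun x t => `|f2 x t|%:E) < +oo)%E.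
Proof.
apply: (@exp_bound K); [exact: K0|exact: mf2|] => x t t0.
rewrite /f2; case tT : (t <= 2 * T); last first.
  by rewrite cutoff_late ?late// mul0r normr0 mulr0 mulr0.
rewrite normrM (ger0_norm (cutoff_ge0 _ _ _)) normrM.
have -> : K * (expR (- alpha * d x) * `|u x t| * true%:R) =
    `|u x t| * (K * expR (- alpha * d x)) by rewrite mulr1; ring.
apply: (@le_trans _ _ (1 * (`|u x t| * `|lap_xi x|))).
  by rewrite ler_wpM2r ?mulr_ge0// cutoff_le1.
by rewrite mul1r ler_wpM2l.
Qed.

Let weak_remainderE x t : (weak_remainder x t)%:E = (`|f1 x t|%:E + `|f2 x t|%:E)%E.
Proof.
rewrite -EFinD; congr EFin.
have -> : `|f1 x t| = xi x * `|psi2 t| * `|u x t|.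
  by rewrite /f1 2!normrM (ger0_norm (xi_ge0 x)).
have -> : `|f2 x t| = psi t * (`|u x t| * `|lap_xi x|).
  by rewrite /f2 normrM (ger0_norm (cutoff_ge0 _ _ _)) normrM.
by rewrite /weak_remainder; ring.
Qed.

Let st_int_ge0_remainder : st_int_ge0 mu (fun x t => (weak_remainder x t)%:E) =
  (st_int_ge0 mu (fun x t => `|f1 x t|%:E) + st_int_ge0 mu (fun x t => `|f2 x t|%:E))%E.
Proof.
have p (f : gp -> R -> R) x (t : R) : 0 <= t -> (0 <= `|f x t|%:E)%E.
  by move=> _; rewrite lee_fin.
rewrite -(st_int_ge0D mu0 (st_measurable_EFin (st_measurable_abs mf1))
  (st_measurable_EFin (st_measurable_abs mf2)) (p f1) (p f2)).
by apply: eq_st_int_ge0 => x t t0; exact: weak_remainderE.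
Qed.

Lemma st_measurable_weak_remainder : st_measurable weak_remainder.
Proof.
have -> : weak_remainder = (fun x t => `|f1 x t| + `|f2 x t|).
  apply/funext => x; apply/funext => t.
  by have := weak_remainderE x t; rewrite -EFinD => -[].
by apply: st_measurableD; apply: st_measurable_abs; [exact: mf1|exact: mf2].
Qed.

Lemma weak_remainder_fin : (st_int_ge0 mu (fun x t => (weak_remainder x t)%:E) < +oo)%E.
Proof. by rewrite st_int_ge0_remainder; apply: lte_add_pinfty; [exact: f1_fin|exact: f2_fin]. Qed.

(** Green's formula moves the Laplacian to [xi] at each time, and the term with [u0]
    vanishes because [psi] is constant near [0].  The other terms with no definite
    sign converge absolutely, since the test function and its derivatives are dominated by the
    weight of the space [X_alpha]. *)
Lemma weak_inequality : st_measurable h ->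
  graph_integrable mu (fun x => u1 x * xi x) /\
  (st_int_ge0 mu (fun x t => (h x t * `|u x t| `^ sigma * (xi x * psi t))%:E) +
   graph_int mu (fun x => (u1 x * xi x)%R) <=
   st_int_ge0 mu (fun x t => (weak_remainder x t)%:E))%E.
Proof.
move=> mh; have [_ Du weak] := u_sol.
have lap_u (t : R) : 0 <= t ->
    graph_integrable mu (fun x => phi x t * laplacian mu omega (u^~ t) x) /\
    graph_int mu (fun x => phi x t * laplacian mu omega (u^~ t) x) =
    graph_int mu (f2^~ t).
  move=> t0; have [Dut Kut] := Du t t0.
  have [i1 i2 E1] := graph_by_parts mu0 omega_sym omega_ge0 omega_adj
    uvs ues avs advs aes Dut Kut.
  have p0 := cutoff_ge0 n T t.
  have -> : (fun x => phi x t * laplacian mu omega (u^~ t) x) =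
      (fun x => psi t * (xi x * laplacian mu omega (u^~ t) x)).
    by apply/funext => x; rewrite /phi; ring.
  split; first exact: graph_integrableZ.
  by rewrite graph_intZ// E1 /f2 -graph_intZ.
have [i1 le1] := st_integrable_abs mu0 mf1 f1_fin.
have [i2 le2] := st_integrable_abs mu0 mf2 f2_fin.
have [j1 E1] := @eq_st_int _ _ mu f1 (fun x t => time_deriv2 phi x t * u x t)
  (fun x t t0 => ltac:(by have [_ _ ->] := phi_C2 x)) i1.
have [j2 E2] := st_int_congr (fun t t0 => (lap_u t t0).1) (fun t t0 => (lap_u t t0).2) i2.
have psi00 : psi 0 = 1 := cutoff_early n T0 (ltW T0).
have u1phi : (fun x => u1 x * phi x 0) = (fun x => u1 x * xi x).
  by apply/funext => x; rewrite /phi psi00 mulr1.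
have u0phi : (fun x => u0 x * time_deriv phi x 0) = (fun=> 0).
  apply/funext => x; have [_ H _] := phi_C2 x; rewrite (H 0 (lexx 0)).
  by rewrite (cutoff1_early n T0 (ltW T0)) mulr0 mulr0.
have ju1 : graph_integrable mu (fun x => u1 x * xi x).
  apply: (graph_integrable_in_X u1_X (graph_measurable_interp a) (K := K)) => x.
  by rewrite (ger0_norm (xi_ge0 x)); exact: xi_le.
split; first exact: ju1.
have E0 : (fun x : gp => `|(fun=> 0 : R) x|%:E) = (fun=> 0%E).
  by apply/funext => x; rewrite /= normr0.
have ju0 : graph_integrable mu (fun=> 0).
  split; first by move=> e; exact: measurable_cst.
  by rewrite E0 graph_int_ge0_0.
have g0 : graph_int mu (fun=> 0) = 0%E.
  have := abse_graph_int mu0 ju0.1; rewrite E0 graph_int_ge0_0 => g_le0.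
  by apply/eqP; rewrite -abse_eq0 eq_le g_le0 abse_ge0.
have pos x (t : R) : 0 <= t -> 0 <= h x t * `|u x t| `^ sigma * phi x t.
  move=> t0; apply: mulr_ge0; last exact: mulr_ge0 (xi_ge0 x) (cutoff_ge0 _ _ _).
  exact: mulr_ge0 (ltW (h0 x t0)) (powR_ge0 _ _).
have := weak phi test_function_cutoff; cbv zeta.
rewrite u1phi u0phi g0 -E1 E2 (st_int_ge0E mu pos) sube0.
move=> /(_ j1 j2 ju1 ju0); rewrite st_int_ge0_remainder.
apply: ereal_rearrange; [exact: graph_int_fin_num|exact: le1|exact: f1_fin
  |exact: le2|exact: f2_fin].
Qed.

End weak_inequality.

(** * Young's inequality *)

(** If [k] is small compared with [lam * h * v ^ (s - 1) * z ^ 2], the first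
    term on the right dominates; otherwise [v] itself is bounded, at the price of
    a negative power of [z], which is absorbed because [n.+1] is large. *)
Lemma young_cutoff (R : realType) (n : nat) (s lam k z h v : R) :
  1 < s -> 0 < lam -> 0 <= k -> 0 <= z <= 1 -> 0 < h -> 0 <= v ->
  2 * (s - 1)^-1 <= n.+1%:R ->
  v * k * z ^+ n.+1 <= lam * (h * v `^ s) * z ^+ n.+3 +
    lam `^ (- (s - 1)^-1) * k `^ (s / (s - 1)) * h `^ (- (s - 1)^-1).
Proof.
move=> s1 lam0 k0 /andP[z0 z1] h0 v0 ns.
have s10 : 0 < s - 1 by rewrite subr_gt0.
set p := (s - 1)^-1 in ns *.
have p0 : 0 < p by rewrite invr_gt0.
have A0 : 0 <= lam * (h * v `^ s) * z ^+ n.+3.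
  apply: mulr_ge0; last exact: exprn_ge0.
  by apply: mulr_ge0; [exact: ltW|apply: mulr_ge0; [exact: ltW|exact: powR_ge0]].
have B0 : 0 <= lam `^ (- p) * k `^ (s / (s - 1)) * h `^ (- p).
  by rewrite !mulr_ge0 ?powR_ge0.
have triv : v * k * z ^+ n.+1 = 0 ->
    v * k * z ^+ n.+1 <= lam * (h * v `^ s) * z ^+ n.+3 +
      lam `^ (- p) * k `^ (s / (s - 1)) * h `^ (- p) by move=> ->; rewrite addr_ge0.
move: k0; rewrite le_eqVlt => /predU1P[k0|k0].
  by apply: triv; rewrite -k0 mulr0 mul0r.
move: v0; rewrite le_eqVlt => /predU1P[v0|v0].
  by apply: triv; rewrite -v0 !mul0r.
move: z0; rewrite le_eqVlt => /predU1P[z0|z0].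
  by apply: triv; rewrite -z0 expr0n mulr0.
have vs : v `^ s = v * v `^ (s - 1) by rewrite mulr_powRB1 ?(ltW v0)// (lt_trans _ s1).
have [kl|kl] := leP k (lam * h * v `^ (s - 1) * z ^+ 2).
  apply: (@le_trans _ _ (lam * (h * v `^ s) * z ^+ n.+3)); last by rewrite lerDl.
  have -> : lam * (h * v `^ s) * z ^+ n.+3 =
      v * (lam * h * v `^ (s - 1) * z ^+ 2) * z ^+ n.+1.
    by rewrite vs -[n.+3]/(2 + n.+1)%N exprD; ring.
  by rewrite ler_pM2r ?exprn_gt0// ler_pM2l.
apply: (@le_trans _ _ (lam `^ (- p) * k `^ (s / (s - 1)) * h `^ (- p))); last first.
  by rewrite lerDr.
have vE : v = (v `^ (s - 1)) `^ p.
  by rewrite -powRrM mulfV ?gt_eqF// powRr1// ltW.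
have L : lam `^ p * h `^ p * (z ^+ 2) `^ p * v <= k `^ p.
  have z20 : 0 <= z ^+ 2 by rewrite exprn_ge0 ?ltW.
  have lh0 : 0 <= lam * h by rewrite mulr_ge0 ?ltW.
  have lhz0 : 0 <= lam * h * z ^+ 2 by rewrite mulr_ge0.
  have L0 : (lam * h * z ^+ 2 * v `^ (s - 1)) `^ p <= k `^ p.
    apply: ge0_ler_powR; rewrite ?nnegrE ?(ltW p0) ?(ltW k0)//.
      by rewrite mulr_ge0 ?powR_ge0.
    by apply: le_trans (ltW kl); rewrite le_eqVlt; apply/orP; left; apply/eqP; ring.
  by move: L0; rewrite powRM ?powR_ge0// -vE powRM// powRM// ltW.
have Z : z ^+ n.+1 <= (z ^+ 2) `^ p.
  rewrite -(powR_mulrn n.+1 (ltW z0)) -(powR_mulrn 2 (ltW z0)) -powRrM.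
  by apply: ger_powR => //; rewrite z0 z1.
have lp : 0 < lam `^ p by rewrite powR_gt0.
have hp : 0 < h `^ p by rewrite powR_gt0.
have kp : k `^ (s / (s - 1)) = k * k `^ p.
  have -> : s / (s - 1) = 1 + p by rewrite /p; field; rewrite gt_eqF.
  rewrite powRD ?powRr1 ?(ltW k0)//.
  by rewrite [X in _ ==> ~~ X]gt_eqF// implybT.
rewrite !powRN kp.
have -> : (lam `^ p)^-1 * (k * k `^ p) * (h `^ p)^-1 =
    k * (k `^ p / (lam `^ p * h `^ p)) by field; rewrite !gt_eqF.
have -> : v * k * z ^+ n.+1 = k * (v * z ^+ n.+1) by ring.
rewrite ler_pM2l// ler_pdivlMr ?mulr_gt0//; apply: le_trans L.
have -> : lam `^ p * h `^ p * (z ^+ 2) `^ p * v =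
  v * (z ^+ 2) `^ p * (lam `^ p * h `^ p) by ring.
by rewrite ler_pM2r ?mulr_gt0// ler_pM2l.
Qed.

(** * Integrals over parts of space-time *)

Section restricted_integrals.
Context (R : realType) (G : metricGraph R) (mu : vertex G -> R).
Hypothesis mu0 : forall x, 0 < mu x.
Notation leb := (@lebesgue_measure R).
Notation gp := (gpoint G).
Local Open Scope ereal_scope.

Lemma vertex_int_mkcond (A : gp -> bool) (F : gp -> \bar R) :
  vertex_int mu [set x | A x] F = vertex_int mu setT (fun x => F x * (A x)%:R%:E).
Proof.
rewrite /vertex_int esum_mkcond; apply: eq_esum => v _.
case Av : (A (Vtx v)); first by rewrite mem_set// mule1.
by rewrite memNset ?mule0 ?mule0//= Av.
Qed.

Lemma edge_int_mkcond (A : gp -> bool) (F : gp -> \bar R) :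
  edge_int [set x | A x] F = edge_int setT (fun x => F x * (A x)%:R%:E).
Proof.
apply: eq_esum => e _; rewrite integral_mkcond [RHS]integral_mkcond.
apply: eq_integral => s _; rewrite !patchE in_setI preimage_setT setIT.
case: (s \in `]0%R, len e[%classic) => //=.
case As : (A (pt e s)); first by rewrite mem_set// mule1.
by rewrite memNset ?mule0//= As.
Qed.

(** Turns integrals over the vertices and over the edges of part of the graph, as in
    the growth conditions on [h], into a single space-time integral. *)
Lemma st_int_ge0_restrict (A : gp -> bool) (F : gp -> R -> \bar R) (a b : R) :
  (0 <= a)%R -> st_emeasurable (fun x t => F x t * (A x)%:R%:E) ->
  (forall x (t : R), (0 <= t)%R -> 0 <= F x t) ->
  st_int_ge0 mu (fun x t => F x t * (A x)%:R%:E * ((a <= t <= b)%R)%:R%:E) =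
  \int[leb]_(t in `[a, b]) vertex_int mu [set x | A x] (F ^~ t) +
  \int[leb]_(t in `[a, b]) edge_int [set x | A x] (F ^~ t).
Proof.
move=> a0 mFA F0.
pose H x t := F x t * (A x)%:R%:E.
have H0 x (t : R) : (0 <= t)%R -> 0 <= H x t.
  by move=> t0; rewrite mule_ge0 ?F0// lee_fin.
have sub : `[a, b]%classic `<=` `[(0%R : R), +oo[%classic.
  by move=> t; rewrite /= !in_itv/= andbT => /andP[? _]; exact: le_trans a0 _.
have t0 (t : R) : `[a, b]%classic t -> (0 <= t)%R.
  by move=> /sub; rewrite /= in_itv/= andbT.
have mV := measurable_funS (measurable_itv _) sub (measurable_vertex_int mu0 mFA H0).
have mE := measurable_funS (measurable_itv _) sub (measurable_edge_int mFA H0).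
transitivity (\int[leb]_(t in `[a, b])
    (vertex_int mu setT (H ^~ t) + edge_int setT (H ^~ t))).
  rewrite /st_int_ge0 integral_mkcond [RHS]integral_mkcond; apply: eq_integral => t _.
  rewrite !patchE; case: ifPn => [|/negP]; rewrite inE.
    rewrite /= in_itv/= andbT => tge; case: ifPn => [|/negP]; rewrite inE.
      rewrite /= in_itv/= => tab; congr graph_int_ge0; apply/funext => x.
      by rewrite tab mule1.
    rewrite /= in_itv/= => /negP/negbTE tab.
    rewrite -[RHS](graph_int_ge0_0 mu); congr graph_int_ge0; apply/funext => x.
    by rewrite tab mule0.
  by move=> tI; case: ifPn => //; rewrite inE => /sub.
have pV (t : R) : `[a, b]%classic t -> 0 <= vertex_int mu setT (H ^~ t).
  move=> /t0 tge; apply: esum_ge0 => v _; rewrite mule_ge0 ?H0//.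
  by rewrite lee_fin ltW.
have pE (t : R) : `[a, b]%classic t -> 0 <= edge_int setT (H ^~ t).
  move=> /t0 tge; apply: esum_ge0 => e _; apply: integral_ge0 => s _.
  exact: H0.
have E1 : \int[leb]_(t in `[a, b]) vertex_int mu [set x | A x] (F ^~ t) =
    \int[leb]_(t in `[a, b]) vertex_int mu setT (H ^~ t).
  by apply: eq_integral => t _; rewrite vertex_int_mkcond.
have E2 : \int[leb]_(t in `[a, b]) edge_int [set x | A x] (F ^~ t) =
    \int[leb]_(t in `[a, b]) edge_int setT (H ^~ t).
  by apply: eq_integral => t _; rewrite edge_int_mkcond.
rewrite E1 E2; apply: ge0_integralD.
- exact: measurable_itv.
- exact: pV.
- exact: mV.
- exact: pE.
- exact: mE.
Qed.

(** By monotone convergence of the integrals over the sets [D x <= n%:R]. *)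
Lemma st_int_ge0_tail (F : gp -> R -> \bar R) (D : gp -> R) :
  st_emeasurable F -> (forall n : nat, st_emeasurable (fun x t => F x t * (D x <= n%:R)%R%:R%:E)) ->
  (forall n : nat, st_emeasurable (fun x t => F x t * (n%:R < D x)%R%:R%:E)) ->
  (forall x (t : R), (0 <= t)%R -> 0 <= F x t) -> st_int_ge0 mu F < +oo ->
  forall (N0 eps : R), (0 < eps)%R -> exists2 N : nat, (N0 <= N%:R)%R &
    st_int_ge0 mu (fun x t => F x t * (N%:R < D x)%R%:R%:E) <= eps%:E.
Proof.
move=> mF mF1 mF2 F0 Foo N0 eps eps0.
have F10 n x (t : R) : (0 <= t)%R -> 0 <= F x t * (D x <= n%:R)%R%:R%:E.
  by move=> t0; rewrite mule_ge0 ?F0// lee_fin.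
have F20 n x (t : R) : (0 <= t)%R -> 0 <= F x t * (n%:R < D x)%R%:R%:E.
  by move=> t0; rewrite mule_ge0 ?F0// lee_fin.
pose a (n : nat) := st_int_ge0 mu (fun x t => F x t * (D x <= n%:R)%R%:R%:E).
have aF : a @ \oo --> st_int_ge0 mu F.
  apply: (cvg_st_int_ge0 mu0 mF1 F10).
    move=> x t t0 p q pq; apply: lee_wpmul2l; first exact: F0.
    rewrite lee_fin ler_nat; have [Dp|] := leP (D x) p%:R; last by [].
    by rewrite (le_trans Dp)// ler_nat.
  move=> x t t0; apply: cvg_near_cst.
  exists (Num.truncn `|D x|).+1 => // n /= Dn.
  have -> : (D x <= n%:R)%R; last by rewrite mule1.
  apply: (@le_trans _ _ `|D x|%R); first exact: ler_norm.
  by apply: (@le_trans _ _ (Num.truncn `|D x|).+1%:R); [exact/ltW/truncnS_gt|rewrite ler_nat].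
have F00 : 0 <= st_int_ge0 mu F by exact: (st_int_ge0_ge0 mu0).
have Ffin : st_int_ge0 mu F \is a fin_num by rewrite ge0_fin_numE.
have split_a n : a n + st_int_ge0 mu (fun x t => F x t * (n%:R < D x)%R%:R%:E) = st_int_ge0 mu F.
  rewrite -(st_int_ge0D mu0 (mF1 n) (mF2 n) (F10 n) (F20 n)); apply: eq_st_int_ge0 => x t t0.
  by rewrite ltNge; case: leP => _; rewrite /= mule1 mule0 ?adde0 ?add0e.
have near1 : \forall n \near \oo, st_int_ge0 mu F - eps%:E < a n.
  have Fe : st_int_ge0 mu F - eps%:E < st_int_ge0 mu F by rewrite lteBlDr// lteDl// lte_fin.
  exact: (aF [set y | st_int_ge0 mu F - eps%:E < y] (open_ereal_gt' Fe)).
have near2 : \forall n \near \oo, (N0 <= n%:R)%R by exact: nbhs_infty_ger.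
have [N [N1 N2]] := filter_ex (filterI near1 near2).
exists N => //; have := split_a N.
have t0 : 0 <= st_int_ge0 mu (fun x t => F x t * (N%:R < D x)%R%:R%:E).
  exact: (st_int_ge0_ge0 mu0 (F20 N)).
have a0 : 0 <= a N by exact: (st_int_ge0_ge0 mu0 (F10 N)).
move: t0; set w := st_int_ge0 mu (fun x t => F x t * (N%:R < D x)%R%:R%:E).
move: w N1 a0 => w; rewrite -(fineK Ffin); move: (a N) => aN.
case: aN => [y| |]; case: w => [z| |]//.
rewrite -!EFinD lte_fin !lee_fin => ? ? ? [] ?; lra.
Qed.

End restricted_integrals.

Lemma le_st_int_ge0_combination (R : realType) (G : metricGraph R) (mu : vertex G -> R)
    (mu0 : forall x, 0 < mu x) (f f1 f2 f3 : gpoint G -> R -> R) (c1 c2 c3 : R) :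
  st_measurable f -> st_measurable f1 -> st_measurable f2 -> st_measurable f3 ->
  0 <= c1 -> 0 <= c2 -> 0 <= c3 ->
  (forall x t, 0 <= t -> 0 <= f x t) -> (forall x t, 0 <= t -> 0 <= f1 x t) ->
  (forall x t, 0 <= t -> 0 <= f2 x t) -> (forall x t, 0 <= t -> 0 <= f3 x t) ->
  (forall x t, 0 <= t -> f x t <= c1 * f1 x t + c2 * f2 x t + c3 * f3 x t) ->
  (st_int_ge0 mu (fun x t => (f x t)%:E) <= c1%:E * st_int_ge0 mu (fun x t => (f1 x t)%:E) +
    c2%:E * st_int_ge0 mu (fun x t => (f2 x t)%:E) +
    c3%:E * st_int_ge0 mu (fun x t => (f3 x t)%:E))%E.
Proof.
move=> mf m1 m2 m3 c10 c20 c30 f0 f10 f20 f30 le_f.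
have p0 (g : gpoint G -> R -> R) : (forall x t, 0 <= t -> 0 <= g x t) ->
    forall x t, 0 <= t -> (0 <= (g x t)%:E)%E.
  by move=> g0 x t t0; rewrite lee_fin; exact: g0.
have mc (c : R) (g : gpoint G -> R -> R) : st_measurable g ->
    st_measurable (fun x t => c * g x t).
  move=> mg; apply: (@st_measurableM _ _ (fun _ _ => c) g); last exact: mg.
  by apply: st_measurable_time; exact: measurable_cst.
have c0 (c : R) (g : gpoint G -> R -> R) : 0 <= c ->
    (forall x t, 0 <= t -> 0 <= g x t) -> forall x t, 0 <= t -> 0 <= c * g x t.
  by move=> ? g0 x t t0; apply: mulr_ge0 => //; exact: g0.
rewrite -(st_int_ge0Z mu0 (st_measurable_EFin m1) (p0 _ f10) c10).
rewrite -(st_int_ge0Z mu0 (st_measurable_EFin m2) (p0 _ f20) c20).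
rewrite -(st_int_ge0Z mu0 (st_measurable_EFin m3) (p0 _ f30) c30).
have m12 := st_measurableD (mc c1 _ m1) (mc c2 _ m2).
have f120 x t : 0 <= t -> 0 <= c1 * f1 x t + c2 * f2 x t.
  by move=> t0; apply: addr_ge0; [exact: c0 f10 _ _ t0|exact: c0 f20 _ _ t0].
rewrite -(st_int_ge0D mu0 (st_measurable_EFin (mc c1 _ m1)) (st_measurable_EFin (mc c2 _ m2))
  (p0 _ (c0 _ _ c10 f10)) (p0 _ (c0 _ _ c20 f20))).
rewrite -(st_int_ge0D mu0 (st_measurable_EFin m12) (st_measurable_EFin (mc c3 _ m3))
  (p0 _ f120) (p0 _ (c0 _ _ c30 f30))).
apply: (le_st_int_ge0 mu0 (st_measurable_EFin mf)).
- exact: (st_measurable_EFin (st_measurableD m12 (mc c3 _ m3))).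
- exact: p0.
- by move=> x t t0; rewrite lee_fin; exact: le_f.
Qed.

(** * The integral inequality at a fixed scale *)

Section fixed_scale.
Context (R : realType) (G : metricGraph R).
Context (mu : vertex G -> R) (omega : vertex G -> vertex G -> R).
Context (x0 : vertex G) (C0 j r sigma delta C : R).
Context (h : gpoint G -> R -> R) (u0 u1 : gpoint G -> R) (u : gpoint G -> R -> R).
Notation leb := (@lebesgue_measure R).
Notation gp := (gpoint G).
Notation d x := (gdist x (Vtx x0)).
Notation gi := (graph_int_ge0 mu).
Hypothesis connected_G : graph_connected G.
Hypothesis lfin : locally_finite G.
Hypothesis finite_balls : forall r, 0 < r -> finite_part (gball (Vtx x0) r).
Hypothesis mu0 : forall x, 0 < mu x.
Hypothesis omega_ge0 : forall x y, 0 <= omega x y.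
Hypothesis omega_sym : forall x y, omega x y = omega y x.
Hypothesis omega_adj : forall x y, 0 < omega x y <-> adj x y.
Hypothesis C00 : 0 < C0.
Hypothesis omega_C0 : forall x, \sum_(y \in [set y | adj x y]) omega x y <= C0 * mu x.
Hypothesis r0 : 0 < r.
Hypothesis j0 : 0 <= j.
Hypothesis len_rj : forall e : edge G, r <= len e <= j.
Hypothesis sigma1 : 1 < sigma.
Hypothesis delta0 : 0 < delta.
Hypothesis h_meas : st_measurable h.
Hypothesis h0 : forall x (t : R), 0 <= t -> 0 < h x t.
Hypothesis C_gt0 : 0 < C.
Hypothesis u_sol : very_weak_solution mu omega sigma h u0 u1 u.

Context (rho : R).
Hypothesis rho0 : 0 < rho.
Hypothesis rhoj : 2 * j <= rho.
Let alpha := delta / rho.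
Let T := Num.sqrt rho.
Hypothesis u1_X : in_X mu x0 alpha u1.
Hypothesis u_X : in_L1loc_X mu x0 alpha u.

Let p := (sigma - 1)^-1.
Let q := sigma / (sigma - 1).
Let weight (x : gp) (t : R) := h x t `^ (- p) * expR (- alpha * d x).
Let bound := (C * rho `^ q)%:E.

Hypothesis weight_bounds :
  [/\ (\int[leb]_(t in `[T, (2 * T)%R])
         vertex_int mu (gball (Vtx x0) rho) (fun x => (weight x t)%:E) <= bound)%E,
      (\int[leb]_(t in `[T, (2 * T)%R])
         edge_int (gball (Vtx x0) rho) (fun x => (weight x t)%:E) <= bound)%E,
      (\int[leb]_(t in `[0%R, (2 * T)%R])
         vertex_int mu (~` gball (Vtx x0) rho) (fun x => (weight x t)%:E) <= bound)%E &
      (\int[leb]_(t in `[0%R, (2 * T)%R])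
         edge_int (~` gball (Vtx x0) rho) (fun x => (weight x t)%:E) <= bound)%E].

Let T0 : 0 < T. Proof. by rewrite sqrtr_gt0. Qed.
Let TT : T ^+ 2 = rho. Proof. by rewrite sqr_sqrtr// ltW. Qed.
Let alpha_rho : alpha * rho = delta.
Proof. by rewrite /alpha divfK// gt_eqF. Qed.

(** The space-time cylinder on which the test function is constant. *)
Definition cylinder (x : gp) (t : R) : bool := (d x < rho) && (t < T).

Let m_lt (c : R) : measurable_fun setT (fun t : R => (t < c)%R%:R : R).
Proof.
apply: nonincreasing_measurable => // s t st; rewrite ler_nat.
by have [tc|] := ltP t c; [rewrite (le_lt_trans st tc)|].
Qed.

Let m_le (c : R) : measurable_fun setT (fun t : R => (t <= c)%R%:R : R).
Proof.
apply: nonincreasing_measurable => // s t st; rewrite ler_nat.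
by have [tc|] := leP t c; [rewrite (le_trans st tc)|].
Qed.

Let m_ge (c : R) : measurable_fun setT (fun t : R => (c <= t)%R%:R : R).
Proof.
apply: nondecreasing_measurable => // s t st; rewrite ler_nat.
by have [tc|] := leP c s; [rewrite (le_trans tc st)|].
Qed.

Let m_gt (c : R) : measurable_fun setT (fun t : R => (c < t)%R%:R : R).
Proof.
apply: nondecreasing_measurable => // s t st; rewrite ler_nat.
by have [tc|] := ltP c s; [rewrite (lt_le_trans tc st)|].
Qed.

Let m_d : st_measurable (fun x (_ : R) => d x).
Proof. by apply: st_measurable_space; exact: graph_measurable_gdist. Qed.

Let m_dk (k : R -> R) : measurable_fun setT k -> st_measurable (fun x (_ : R) => k (d x)).
Proof. by move=> mk; exact: (st_measurable_comp mk m_d). Qed.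

Let m_u : st_measurable u. Proof. by have [] := u_X. Qed.

Let m_exp : st_measurable (fun x (_ : R) => expR (- alpha * d x)).
Proof.
apply: (m_dk (k := fun t => expR (- alpha * t))).
by apply: measurableT_comp => //; exact: measurable_funM.
Qed.

Lemma st_measurable_weight : st_measurable weight.
Proof.
apply: st_measurableM; last exact: m_exp.
exact: (st_measurable_comp (k := fun y => y `^ (- p)) (measurable_powR _) h_meas).
Qed.

Lemma weight_ge0 x t : 0 <= weight x t.
Proof. by rewrite mulr_ge0 ?powR_ge0 ?expR_ge0. Qed.

Lemma st_measurable_cylinder : st_measurable (fun x t => (cylinder x t)%:R : R).
Proof.
have -> : (fun x t => (cylinder x t)%:R : R) = (fun x t => (d x < rho)%R%:R * (t < T)%R%:R).
  by apply/funext => x; apply/funext => t; rewrite -natrM mulnb.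
apply: (@st_measurableM _ _ (fun x _ => (d x < rho)%R%:R) (fun _ t => (t < T)%R%:R)).
  exact: (m_dk (m_lt rho)).
exact: st_measurable_time.
Qed.

Lemma st_measurable_cylinderC : st_measurable (fun x t => (~~ cylinder x t)%:R : R).
Proof.
have -> : (fun x t => (~~ cylinder x t)%:R : R) = (fun x t => 1 + - (cylinder x t)%:R).
  by apply/funext => x; apply/funext => t; case: (cylinder x t); rewrite /= ?subrr ?subr0.
apply: (@st_measurableD _ _ (fun _ _ => 1) (fun x t => - (cylinder x t)%:R)).
  by apply: st_measurable_time; exact: measurable_cst.
exact: st_measurableN st_measurable_cylinder.
Qed.

(** Up to time [2 * T], the complement of the cylinder is covered by the two regions
    on which the weight is controlled: the ball after time [T], and the complement
    of the ball from the start. *)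
Lemma st_int_ge0_weight :
  (st_int_ge0 mu (fun x t => (weight x t * ((t <= 2 * T) && ~~ cylinder x t)%:R)%:E)
     <= (4 * C * rho `^ q)%:E)%E.
Proof.
have [b1 b2 b3 b4] := weight_bounds.
pose A1 (x : gp) := d x < rho.
pose A2 (x : gp) := rho <= d x.
have ball1 : gball (Vtx x0) rho = [set x | A1 x] by [].
have ball2 : ~` gball (Vtx x0) rho = [set x | A2 x].
  by apply/seteqP; split => x /=; rewrite /gball/= /A2 leNgt => /negP.
rewrite ball2 in b3 b4; rewrite ball1 in b1 b2.
have mW := st_measurable_EFin st_measurable_weight.
have mWA (A : gp -> bool) : st_measurable (fun x (_ : R) => (A x)%:R) ->
    st_emeasurable (fun x t => (weight x t)%:E * (A x)%:R%:E)%E.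
  move=> mA; apply: (st_measurable_EFin (f := fun x t => weight x t * (A x)%:R)).
  exact: (st_measurableM st_measurable_weight mA).
have mA1 : st_measurable (fun x (_ : R) => (A1 x)%:R) := m_dk (m_lt rho).
have mA2 : st_measurable (fun x (_ : R) => (A2 x)%:R) := m_dk (m_ge rho).
have W0 x (t : R) : 0 <= t -> (0 <= (weight x t)%:E)%E.
  by move=> _; rewrite lee_fin weight_ge0.
have s1 := st_int_ge0_restrict mu0 (2 * T) (ltW T0) (mWA A1 mA1) W0.
have s2 := st_int_ge0_restrict mu0 (2 * T) (lexx 0) (mWA A2 mA2) W0.
have mI (a b : R) : st_measurable (fun (_ : gp) t => (a <= t <= b)%R%:R).
  have -> : (fun (_ : gp) t => (a <= t <= b)%R%:R : R) =
      (fun _ t => (a <= t)%R%:R * (t <= b)%R%:R).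
    by apply/funext => x; apply/funext => t; rewrite -natrM mulnb.
  by apply: st_measurable_time; exact: measurable_funM.
have mWAI (A : gp -> bool) (a b : R) : st_measurable (fun x (_ : R) => (A x)%:R) ->
    st_emeasurable (fun x t => (weight x t)%:E * (A x)%:R%:E * (a <= t <= b)%R%:R%:E)%E.
  move=> mA.
  apply: (st_measurable_EFin (f := fun x t => weight x t * (A x)%:R * (a <= t <= b)%R%:R)).
  exact: (st_measurableM (st_measurableM st_measurable_weight mA) (mI a b)).
have WAI0 (A : gp -> bool) (a b : R) x (t : R) : 0 <= t ->
    (0 <= (weight x t)%:E * (A x)%:R%:E * (a <= t <= b)%R%:R%:E)%E.
  by move=> t0; rewrite -!EFinM lee_fin !mulr_ge0 ?powR_ge0 ?expR_ge0.
have sD := st_int_ge0D mu0 (mWAI A1 T (2 * T) mA1) (mWAI A2 0 (2 * T) mA2)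
  (WAI0 A1 T (2 * T)) (WAI0 A2 0 (2 * T)).
rewrite s1 s2 in sD.
have mD := st_measurable_EFin (st_measurableD
  (st_measurableM (st_measurableM st_measurable_weight mA1) (mI T (2 * T)))
  (st_measurableM (st_measurableM st_measurable_weight mA2) (mI 0 (2 * T)))).
have mL : st_measurable (fun x t => weight x t * ((t <= 2 * T) && ~~ cylinder x t)%:R).
  apply: (st_measurableM st_measurable_weight).
  have -> : (fun x t => ((t <= 2 * T) && ~~ cylinder x t)%:R : R) =
      (fun x t => (t <= 2 * T)%R%:R * (~~ cylinder x t)%:R).
    by apply/funext => x; apply/funext => t; rewrite -natrM mulnb.
  apply: (@st_measurableM _ _ (fun _ t => (t <= 2 * T)%R%:R)).
    exact: st_measurable_time.
  exact: st_measurable_cylinderC.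
apply: (@le_trans _ _ (bound + bound + (bound + bound))%E); last first.
  by rewrite /bound -!EFinD lee_fin; lra.
apply: le_trans (leeD (leeD b1 b2) (leeD b3 b4)); rewrite -sD.
apply: (le_st_int_ge0 mu0 (st_measurable_EFin mL)).
- exact: mD.
- by move=> x t t0; rewrite lee_fin; apply: mulr_ge0 => //; exact: weight_ge0.
- move=> x t t0; rewrite lee_fin; move: (weight x t) (weight_ge0 x t) => w w0.
  rewrite -!mulrA -mulrDr; apply: ler_wpM2l; first exact: w0.
  rewrite /cylinder /A1 /A2 t0 [rho <= _]leNgt [T <= t]leNgt.
  by case: (t <= 2 * T); case: (d x < rho); case: (t < T);
    rewrite /= ?mulr1 ?mul1r ?mulr0 ?addr0 ?add0r.
Qed.

Context (n : nat).
Hypothesis np : 2 * p <= n.+1%:R.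

(** The constants of [cutoff2_bound], [lap_xi_le] and [lap_xi_le_exp]. *)
Let Kpsi : R := n.+3%:R * (9%:R * n.+2%:R + 6%:R).
Let Klap : R := (C0 + 6%:R / r ^+ 2) * (delta * j * expR delta).
Let Kexp : R := (C0 + 6%:R / r ^+ 2) * (2%:R * expR (3 * delta)).
Let rate : R := (Kpsi + Klap) / rho.

(** The last term [1] leaves room for the truncation error. *)
Definition scale_const : R := 4 * C * (Kpsi + Klap) `^ q * expR (3 * delta) + 1.

Let r2 : 0 <= 6%:R / r ^+ 2.
Proof. by rewrite divr_ge0// exprn_ge0// ltW. Qed.

Let Kpsi0 : 0 <= Kpsi.
Proof. by rewrite mulr_ge0// addr_ge0// mulr_ge0. Qed.

Let Klap0 : 0 <= Klap.
Proof.
apply: mulr_ge0; first by apply: addr_ge0 => //; exact: ltW.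
by apply: mulr_ge0; [apply: mulr_ge0 => //; exact: ltW|exact: expR_ge0].
Qed.

Let Kexp0 : 0 <= Kexp.
Proof.
apply: mulr_ge0; first by apply: addr_ge0 => //; exact: ltW.
by apply: mulr_ge0 => //; exact: expR_ge0.
Qed.

Section truncation.
Context (N : R).
Hypothesis Nrho : rho + j <= N.
Let a := cutoff_val x0 j rho alpha N.
Notation xi := (interp a).
Notation lap_xi := (interp_laplacian mu omega a).
Notation psi := (cutoff n T).
Notation psi2 := (cutoff2 n T).

(** Outside of the cylinder, both terms of the remainder are of order [1 / rho],
    except for an error due to the truncation; Young's inequality then trades
    the power of [u] for the weight. *)
Lemma remainder_le (lam : R) x (t : R) : 0 < lam -> 0 <= t ->
  weak_remainder mu omega a T n u x t <=
  lam * (h x t * `|u x t| `^ sigma * (xi x * psi t) * (~~ cylinder x t)%:R) +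
  lam `^ (- p) * rate `^ q * expR (3 * delta) *
    (weight x t * ((t <= 2 * T) && ~~ cylinder x t)%:R) +
  Kexp * (expR (- alpha * d x) * `|u x t| * (t <= 2 * T)%R%:R * (N - j < d x)%R%:R).
Proof.
move=> lam0 t0.
have xi0 : 0 <= xi x := interp_cutoff_val_ge0 _ _ _ _ _ x.
have psi0 : 0 <= psi t := cutoff_ge0 _ _ _.
have hpos := ltW (h0 x t0).
have hu0 : 0 <= h x t * `|u x t| `^ sigma by rewrite mulr_ge0 ?powR_ge0.
have A0 (b : bool) : 0 <= lam * (h x t * `|u x t| `^ sigma * (xi x * psi t) * b%:R).
  by apply: mulr_ge0; [exact: ltW|apply: mulr_ge0 => //; apply: mulr_ge0 => //; exact: mulr_ge0].
have B0 (b : bool) : 0 <= lam `^ (- p) * rate `^ q * expR (3 * delta) * (weight x t * b%:R).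
  by rewrite !mulr_ge0 ?powR_ge0 ?expR_ge0.
have E0 : 0 <= expR (- alpha * d x) * `|u x t| by rewrite mulr_ge0 ?expR_ge0.
have D0 (b c : bool) : 0 <= Kexp * (expR (- alpha * d x) * `|u x t| * b%:R * c%:R).
  by apply: mulr_ge0; [exact: Kexp0|rewrite mulr_ge0// mulr_ge0].
have pos b1 b2 b3 b4 : 0 <=
    lam * (h x t * `|u x t| `^ sigma * (xi x * psi t) * (b1 : bool)%:R) +
    lam `^ (- p) * rate `^ q * expR (3 * delta) * (weight x t * (b2 : bool)%:R) +
    Kexp * (expR (- alpha * d x) * `|u x t| * (b3 : bool)%:R * (b4 : bool)%:R).
  by rewrite addr_ge0// addr_ge0.
rewrite /weak_remainder; case t2 : (t <= 2 * T); last first.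
  have tT : 2 * T <= t by move/negbT: t2; rewrite -ltNge; exact: ltW.
  rewrite (cutoff2_late n T0 tT) (cutoff_late n T0 tT) normr0 !mul0r addr0 mulr0.
  by have := pos (~~ cylinder x t) false false (N - j < d x);
    rewrite (cutoff_late n T0 tT).
case St : (cylinder x t).
  have /andP[dx tT] := St.
  rewrite (cutoff2_early n T0 (ltW tT)) normr0 mul0r add0r.
  rewrite (lap_xi_ball mu omega connected_G len_rj delta0 rho0 j0 Nrho alpha_rho dx).
  by rewrite normr0 mulr0 mulr0; exact: pos.
rewrite /= mulr1 mulr1.
set z := Num.max 0 (cutoff_base T t).
have z01 : 0 <= z <= 1 by rewrite le_max lexx ge_max ler01 cutoff_base_le1.
have psiE : psi t = z ^+ n.+3 by [].
have /andP[z0 z1] := z01.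
have zn0 : 0 <= z ^+ n.+1 by rewrite exprn_ge0.
have ps2 : `|psi2 t| <= Kpsi / rho * z ^+ n.+1.
  have := cutoff2_bound n T0 t; rewrite TT -/Kpsi -/z => /le_trans; apply.
  by rewrite mulrAC.
have young := young_cutoff (lam := lam) (k := rate) (v := `|u x t|) sigma1 lam0
  (divr_ge0 (addr_ge0 Kpsi0 Klap0) (ltW rho0)) z01 (h0 x t0) (normr_ge0 _) np.
have xiE := xi_le x0 connected_G len_rj N delta0 rho0 rhoj j0 alpha_rho x.
have key : `|u x t| * (rate * z ^+ n.+1 * xi x) <=
    lam * (h x t * `|u x t| `^ sigma * (xi x * psi t)) +
    lam `^ (- p) * rate `^ q * expR (3 * delta) * weight x t.
  have -> : `|u x t| * (rate * z ^+ n.+1 * xi x) = xi x * (`|u x t| * rate * z ^+ n.+1) by ring.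
  apply: le_trans (ler_wpM2l xi0 young) _.
  rewrite mulrDr psiE; apply: lerD.
    by rewrite le_eqVlt; apply/orP; left; apply/eqP; ring.
  apply: (@le_trans _ _ (expR (3 * delta) * expR (- alpha * d x) *
      (lam `^ (- p) * rate `^ q * h x t `^ (- p)))).
    by apply: ler_wpM2r xiE; rewrite !mulr_ge0 ?powR_ge0.
  by rewrite le_eqVlt; apply/orP; left; apply/eqP; rewrite /weight; ring.
have psiz : psi t <= z ^+ n.+1.
  by rewrite psiE -[n.+3]/(2 + n.+1)%N exprD ler_piMl// exprn_ile1.
have first : `|psi2 t| * xi x <= Kpsi / rho * z ^+ n.+1 * xi x by rewrite ler_wpM2r.
have kapE : rate * z ^+ n.+1 * xi x = Kpsi / rho * z ^+ n.+1 * xi x +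
    Klap / rho * z ^+ n.+1 * xi x by rewrite /rate; ring.
have [dN|dN] := leP (d x) (N - j).
  rewrite mulr0 mulr0 addr0; apply: le_trans key; apply: ler_wpM2l => //.
  rewrite kapE; apply: lerD => //.
  have lap1 := lap_xi_le connected_G lfin mu0 omega_ge0 omega_C0 C00 r0 len_rj
    delta0 rho0 rhoj j0 alpha_rho dN.
  apply: (@le_trans _ _ (z ^+ n.+1 * (Klap / rho * xi x))); last first.
    by rewrite le_eqVlt; apply/orP; left; apply/eqP; ring.
  by apply: ler_pM.
rewrite mulr1 mulr1.
have lap2 := lap_xi_le_exp x0 connected_G lfin mu0 omega_ge0 omega_C0 C00 r0 len_rj
  N delta0 rho0 rhoj j0 alpha_rho x.
have k0 : 0 <= Klap / rho * z ^+ n.+1 * xi x.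
  by rewrite mulr_ge0// mulr_ge0// divr_ge0// ltW.
have second : psi t * `|lap_xi x| <= Kexp * expR (- alpha * d x).
  apply: le_trans lap2; rewrite -[leRHS]mul1r ler_wpM2r//; exact: cutoff_le1.
rewrite mulrDr; apply: lerD.
  apply: le_trans key; apply: ler_wpM2l => //; rewrite kapE.
  by apply: le_trans first _; rewrite lerDl.
have -> : Kexp * (expR (- alpha * d x) * `|u x t|) =
  `|u x t| * (Kexp * expR (- alpha * d x)) by ring.
exact: ler_wpM2l.
Qed.

Notation Phi x t := (h x t * `|u x t| `^ sigma).
Notation ball_mass := (gi (fun x => (EFin \o u1)^\+ x * (d x < rho)%R%:R%:E)%E).

Let xi0 x : 0 <= xi x. Proof. exact: interp_cutoff_val_ge0. Qed.

(** The negative part of [u1] has a finite integral and can be kept on the whole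
    graph, whereas its positive part, whose integral may be infinite, is kept on
    the ball where [xi = 1]. *)
Lemma ball_mass_le (m : R) : graph_integrable mu (fun x => u1 x * xi x) ->
  gi (EFin \o u1)^\-%E = m%:E ->
  (ball_mass <= graph_int mu (fun x => (u1 x * xi x)%R) + m%:E)%E.
Proof.
move=> int_u1 <-.
have [/fineK P1 /fineK P2] := graph_integrable_parts mu0 int_u1.
have m_u1 : graph_measurable u1 := u1_X.1.
have le1 : (ball_mass <= gi (EFin \o (fun x => u1 x * xi x)%R)^\+)%E.
  apply: (le_graph_int_ge0 mu0).
  - move=> e; apply: emeasurable_funM; first exact: (graph_emeasurable_pos m_u1).
    apply/measurable_EFinP; apply: measurable_funTS.
    apply: (measurableT_comp (m_lt rho)); apply: continuous_measurable_fun.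
    exact: gdist_pt_continuous.
  - exact: (graph_emeasurable_pos int_u1.1).
  - by move=> x; apply: mule_ge0 => //; rewrite lee_fin.
  - move=> x; rewrite !funepos_EFin -EFinM lee_fin.
    have [dx|_] := ltP (d x) rho; last by rewrite mulr0 le_max lexx orbT.
    by rewrite mulr1 (xi_ball connected_G len_rj delta0 rho0 j0 Nrho alpha_rho dx) mulr1.
have le2 : (gi (EFin \o (fun x => u1 x * xi x)%R)^\- <= gi (EFin \o u1)^\-)%E.
  apply: (le_graph_int_ge0 mu0).
  - exact: (graph_emeasurable_neg int_u1.1).
  - exact: (graph_emeasurable_neg m_u1).
  - by [].
  - move=> x; rewrite !funeneg_EFin lee_fin.
    have x1 := xi_le1 x0 j rho alpha N x; have x_ge0 := xi0 x.
    rewrite ge_max; apply/andP; split; last by rewrite le_max lexx orbT.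
    rewrite le_max; have [u_pos|u_neg] := leP 0 (u1 x).
      by apply/orP; right; rewrite oppr_le0; exact: mulr_ge0.
    by apply/orP; left; rewrite -mulNr; apply: ler_piMr => //; rewrite oppr_ge0 ltW.
rewrite /graph_int; apply: le_trans le1 _.
rewrite -P1 -P2 in le2 *; move: le2; case: (gi (EFin \o u1)^\-%E) => [s| |] le2.
- by rewrite -EFinN -!EFinD lee_fin; move: le2; rewrite lee_fin; lra.
- by rewrite -EFinN -EFinD addey ?leey.
- by rewrite leeNy_eq in le2.
Qed.

Let m_Phi : st_measurable (fun x t => Phi x t).
Proof.
apply: st_measurableM h_meas _.
exact: (st_measurable_comp (measurable_powR sigma) (st_measurable_abs m_u)).
Qed.

Let m_S : st_measurable (fun (_ : gp) t => (t <= 2 * T)%R%:R).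
Proof. exact: st_measurable_time. Qed.

Lemma st_int_ge0_remainder_le (lam : R) : 0 < lam ->
  (st_int_ge0 mu (fun x t => (weak_remainder mu omega a T n u x t)%:E) <=
   lam%:E * st_int_ge0 mu (fun x t => (Phi x t * (xi x * psi t) * (~~ cylinder x t)%:R)%:E) +
   (4 * C * rho `^ q * (lam `^ (- p) * rate `^ q * expR (3 * delta)))%:E +
   Kexp%:E * st_int_ge0 mu (fun x t =>
     (expR (- alpha * d x) * `|u x t| * (t <= 2 * T)%R%:R * (N - j < d x)%R%:R)%:E))%E.
Proof.
move=> lam0.
set c2 := lam `^ (- p) * rate `^ q * expR (3 * delta).
have c20 : 0 <= c2 by rewrite !mulr_ge0 ?powR_ge0 ?expR_ge0.
have Phi0 x t : 0 <= t -> 0 <= Phi x t.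
  by move=> t0; apply: mulr_ge0; [exact: ltW (h0 x t0)|exact: powR_ge0].
have m1 := st_measurableM (st_measurableM m_Phi (st_measurable_cutoff a T n))
  st_measurable_cylinderC.
have m2 : st_measurable (fun x t => weight x t * ((t <= 2 * T) && ~~ cylinder x t)%:R).
  apply: (st_measurableM st_measurable_weight).
  have -> : (fun x t => ((t <= 2 * T) && ~~ cylinder x t)%:R : R) =
      (fun x t => (t <= 2 * T)%R%:R * (~~ cylinder x t)%:R).
    by apply/funext => x; apply/funext => t; rewrite -natrM mulnb.
  exact: st_measurableM m_S st_measurable_cylinderC.
have m3 := st_measurableM (st_measurableM (st_measurableM m_exp (st_measurable_abs m_u)) m_S)
  (m_dk (m_gt (N - j))).
have mw : st_measurable (weak_remainder mu omega a T n u).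
  exact: (st_measurable_weak_remainder omega T n xi0 u_X).
apply: le_trans (le_st_int_ge0_combination mu0 mw m1 m2 m3 (ltW lam0) c20 Kexp0 _ _ _ _ _) _.
- move=> x t t0; rewrite /weak_remainder; apply: mulr_ge0 => //.
  by apply: addr_ge0; apply: mulr_ge0 => //; exact: cutoff_ge0.
- move=> x t t0; apply: mulr_ge0 => //; apply: mulr_ge0; first exact: Phi0.
  by apply: mulr_ge0 => //; exact: cutoff_ge0.
- by move=> x t t0; apply: mulr_ge0 => //; exact: weight_ge0.
- by move=> x t t0; do 3 apply: mulr_ge0 => //; exact: expR_ge0.
- by move=> x t t0; exact: remainder_le.
- apply: leeD => //; apply: leeD => //.
  have -> : (4 * C * rho `^ q * c2)%:E = (c2%:E * (4 * C * rho `^ q)%:E)%E.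
    by rewrite -EFinM mulrC.
  by apply: lee_wpmul2l; [rewrite lee_fin|exact: st_int_ge0_weight].
Qed.

End truncation.

Notation Phi x t := (h x t * `|u x t| `^ sigma).
Notation ball_mass := (gi (fun x => (EFin \o u1)^\+ x * (d x < rho)%R%:R%:E)%E).

(** [X] is the integral of [h * |u| ^ sigma] against the test function.  The two upper
    bounds differ in the estimate of the part outside of the cylinder, by [X] itself
    or by the integral without the test function.  For [N] large the truncation
    error is as small as desired, and the powers of [rho] cancel: the constant
    depends neither on [rho] nor on [lam]. *)
Lemma scale_inequality (lam m : R) : 0 < lam -> gi (EFin \o u1)^\-%E = m%:E ->
  exists X : \bar R,
   [/\ (st_int_ge0 mu (fun x t => (Phi x t)%:E * (cylinder x t)%:R%:E) <= X)%E, (X < +oo)%E,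
       (X + ball_mass <= lam%:E * X + (scale_const * lam `^ (- p) + m)%:E)%E &
       (X + ball_mass <=
          lam%:E * st_int_ge0 mu (fun x t => (Phi x t)%:E * (~~ cylinder x t)%:R%:E) +
          (scale_const * lam `^ (- p) + m)%:E)%E].
Proof.
move=> lam0 u1m.
have lamp0 : 0 < lam `^ (- p) by exact: powR_gt0.
have Kexp1 : 0 < Kexp + 1 by rewrite ltr_wpDl.
have eps0 : 0 < lam `^ (- p) / (Kexp + 1) by exact: divr_gt0.
have S0 : 0 < 2 * T by rewrite mulr_gt0.
pose E x t := expR (- alpha * d x) * `|u x t| * (t <= 2 * T)%R%:R.
have mE : st_measurable E.
  apply: st_measurableM; last exact: st_measurable_time.
  exact: st_measurableM m_exp (st_measurable_abs m_u).
have E0 x t : 0 <= t -> (0 <= (E x t)%:E)%E.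
  by move=> _; rewrite lee_fin !mulr_ge0// expR_ge0.
have mEk (k : R -> bool) : measurable_fun setT (fun t => (k t)%:R : R) ->
    st_emeasurable (fun x t => (E x t)%:E * (k (d x))%:R%:E)%E.
  move=> mk; apply: (st_measurable_EFin (f := fun x t => E x t * (k (d x))%:R)).
  exact: st_measurableM mE (m_dk mk).
have [N' N'rho tail] := st_int_ge0_tail mu0 (D := fun x => d x) (st_measurable_EFin mE)
  (fun n => mEk (fun t => t <= n%:R) (m_le n%:R))
  (fun n => mEk (fun t => n%:R < t) (m_gt n%:R)) E0 (X_norm_st_int_ge0_fin S0 u_X) rho eps0.
(* So that the region [N - j < d x] of the truncation error is that of [tail]. *)
pose N : R := N'%:R + j.
have Nrho : rho + j <= N by rewrite lerD2r.
pose a := cutoff_val x0 j rho alpha N.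
have xi0 x : 0 <= interp a x by exact: interp_cutoff_val_ge0.
have N0 : 0 <= N by rewrite addr_ge0.
have Nj0 : 0 < N + j + 1 by rewrite ltr_wpDl// addr_ge0.
have [fv fe] := finite_balls Nj0.
pose vs : seq (vertex G) := finmap.enum_fset
  (fset_set [set v | gball (Vtx x0) (N + j + 1) (Vtx v)]).
pose es : seq (edge G) := finmap.enum_fset
  (fset_set [set e | exists s, gball (Vtx x0) (N + j + 1) (Inner e s)]).
have in_vs v : d (Vtx v) <= N + j -> v \in vs.
  move=> dv; have := in_fset_set fv v; rewrite mem_set//.
  by rewrite /= /gball/=; apply: le_lt_trans dv _; rewrite ltrDl.
have avs v : a v != 0 -> v \in vs.
  move=> /cutoff_val_neq0 dv; apply: in_vs; apply: le_trans dv _.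
  by rewrite lerDl.
have advs v w : a v != 0 -> adj v w -> w \in vs.
  move=> /cutoff_val_neq0 dv vw; apply: in_vs.
  have := gdist_adj x0 connected_G len_rj vw; move/ler_normlW => dvw.
  by move: dv dvw; lra.
have aes e : (a (initial e) != 0) || (a (final e) != 0) -> e \in es.
  move=> ae.
  (* Finiteness of a ball is about the edges with an inner point in the ball. *)
  have mid : 0 < len e / 2 < len e.
    by have := len_gt0 e; move=> ?; apply/andP; split; lra.
  have dm : d (pt e (len e / 2)) <= N + j.
    case/orP: ae => /cutoff_val_neq0 dv.
      by have := gdist_initial x0 connected_G len_rj mid; move/ler_normlW; move: dv; lra.
    by have := gdist_final x0 connected_G len_rj mid; move/ler_normlW; move: dv; lra.
  have := in_fset_set fe e; rewrite mem_set//=.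
  exists (exist (fun s => 0 < s < len e) _ mid); rewrite -pt_inner /gball/=.
  by apply: le_lt_trans dm _; rewrite ltrDl.
have e0 x : 0 <= expR (- alpha * d x) by exact: expR_ge0.
pose K := expR (3 * delta) + Kexp.
have xiK x : interp a x <= K * expR (- alpha * d x).
  apply: le_trans (xi_le x0 connected_G len_rj N delta0 rho0 rhoj j0 alpha_rho x) _.
  by rewrite ler_wpM2r// lerDl.
have lapK x : `|interp_laplacian mu omega a x| <= K * expR (- alpha * d x).
  apply: le_trans (lap_xi_le_exp x0 connected_G lfin mu0 omega_ge0 omega_C0 C00 r0 len_rj
    N delta0 rho0 rhoj j0 alpha_rho x) _.
  by rewrite ler_wpM2r// lerDr expR_ge0.
have [int_u1 weak] := weak_inequality mu0 omega_sym omega_ge0 omega_adj connected_G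
  n T0 xi0 (fun x => xi_support connected_G len_rj j0 (x := x)) (finite_balls Nj0)
  (finmap.fset_uniq _) (finmap.fset_uniq _) avs advs aes xiK lapK h0 u_sol u_X u1_X h_meas.
have rem_fin := weak_remainder_fin mu0 connected_G n T0 xi0 xiK lapK u_X.
have rem_le := st_int_ge0_remainder_le Nrho lam0.
have mass := ball_mass_le Nrho int_u1 u1m.
have g_fin := graph_int_fin_num mu0 int_u1.
set X := st_int_ge0 _ _ in weak; set W := st_int_ge0 _ _ in weak rem_fin rem_le.
set g := graph_int _ _ in weak mass g_fin.
pose Y := st_int_ge0 mu (fun x t =>
  (Phi x t * (interp a x * cutoff n T t) * (~~ cylinder x t)%:R)%:E).
have Phi0 x t : 0 <= t -> 0 <= Phi x t.
  by move=> t0; apply: mulr_ge0; [exact: ltW (h0 x t0)|exact: powR_ge0].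
have m_Phi := st_measurableM h_meas
  (st_measurable_comp (measurable_powR sigma) (st_measurable_abs m_u)).
have m_c := st_measurable_cutoff a T n.
have c01 x t : 0 <= interp a x * cutoff n T t <= 1.
  have c0 := cutoff_ge0 n T t; have c1 := cutoff_le1 n T t.
  apply/andP; split; first exact: mulr_ge0.
  by rewrite mulr_ile1//; exact: xi_le1.
have X_cyl : (st_int_ge0 mu (fun x t => (Phi x t)%:E * (cylinder x t)%:R%:E) <= X)%E.
  apply: (le_st_int_ge0 mu0).
  - exact: (st_measurable_EFin (st_measurableM m_Phi st_measurable_cylinder)).
  - exact: (st_measurable_EFin (st_measurableM m_Phi m_c)).
  - by move=> x t t0; rewrite -EFinM lee_fin; apply: mulr_ge0 => //; exact: Phi0.
  - move=> x t t0; rewrite -EFinM lee_fin; apply: ler_wpM2l; first exact: Phi0.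
    case cyl : (cylinder x t); last by have /andP[] := c01 x t.
    have /andP[dx tT] := cyl; rewrite (cutoff_early n T0 (ltW tT)) mulr1.
    by rewrite (xi_ball connected_G len_rj delta0 rho0 j0 Nrho alpha_rho dx).
have mY := st_measurable_EFin (st_measurableM (st_measurableM m_Phi m_c) st_measurable_cylinderC).
have Phic0 x t : 0 <= t -> 0 <= Phi x t * (interp a x * cutoff n T t).
  by move=> t0; apply: mulr_ge0; [exact: Phi0|have /andP[] := c01 x t].
have Y0 x t : 0 <= t ->
    (0 <= (Phi x t * (interp a x * cutoff n T t) * (~~ cylinder x t)%:R)%:E)%E.
  by move=> t0; rewrite lee_fin; apply: mulr_ge0 => //; exact: Phic0.
have Y_X : (Y <= X)%E.
  apply: (le_st_int_ge0 mu0 mY (st_measurable_EFin (st_measurableM m_Phi m_c)) Y0) => x t t0.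
  rewrite lee_fin -[leRHS]mulr1; apply: ler_wpM2l; first exact: Phic0.
  by case: (~~ _).
have Y_cyl : (Y <= st_int_ge0 mu (fun x t => (Phi x t)%:E * (~~ cylinder x t)%:R%:E))%E.
  apply: (le_st_int_ge0 mu0 mY
    (st_measurable_EFin (st_measurableM m_Phi st_measurable_cylinderC)) Y0) => x t t0.
  rewrite lee_fin; apply: ler_wpM2r => //.
  by rewrite -[leRHS]mulr1; apply: ler_wpM2l; [exact: Phi0|have /andP[] := c01 x t].
have const : 4 * C * rho `^ q * (lam `^ (- p) * rate `^ q * expR (3 * delta)) +
    Kexp * (lam `^ (- p) / (Kexp + 1)) <= scale_const * lam `^ (- p).
  have kapq : rate `^ q * rho `^ q = (Kpsi + Klap) `^ q.
    have KK := addr_ge0 Kpsi0 Klap0.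
    rewrite -powRM ?(ltW rho0)//; last exact: divr_ge0 (ltW rho0).
    by rewrite /rate divfK// gt_eqF.
  have -> : scale_const * lam `^ (- p) =
      4 * C * rho `^ q * (lam `^ (- p) * rate `^ q * expR (3 * delta)) + lam `^ (- p).
    by rewrite /scale_const -kapq; ring.
  apply: lerD => //.
  rewrite mulrCA -[leRHS]mulr1; apply: ler_wpM2l; first exact: ltW.
  by rewrite ler_pdivrMr// mul1r lerDl.
have main : (X + ball_mass <= lam%:E * Y + (scale_const * lam `^ (- p) + m)%:E)%E.
  apply: le_trans (leeD (lexx X) mass) _.
  rewrite [leLHS]addeA EFinD [leRHS]addeA; apply: leeD; last exact: lexx.
  apply: le_trans weak _; apply: le_trans rem_le _.
  rewrite -addeA; apply: leeD; first exact: lexx.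
  move: tail; rewrite -[N'%:R](addrK j) -/N => tail.
  apply: le_trans (leeD (lexx _) (lee_wpmul2l _ tail)) _; first by rewrite lee_fin.
  by rewrite -EFinM -EFinD lee_fin.
have lam_ge0 : (0 <= lam%:E)%E by rewrite lee_fin; exact: ltW.
exists X; split; first exact: X_cyl.
- have : (X + g < +oo)%E := le_lt_trans weak rem_fin.
  rewrite -(fineK g_fin); case: (X) => [s| |].
  + by move=> _; exact: ltry.
  + by rewrite addye// ltxx.
  + by move=> _; exact: (lt_trans (ltNyr 0) (ltry 0)).
- exact: le_trans main (leeD (lee_wpmul2l lam_ge0 Y_X) (lexx _)).
- exact: le_trans main (leeD (lee_wpmul2l lam_ge0 Y_cyl) (lexx _)).
Qed.

End fixed_scale.

(** * Vanishing of the solution *)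

Section vanishing.
Context (R : realType) (G : metricGraph R) (mu : vertex G -> R).
Hypothesis mu0 : forall x, 0 < mu x.
Notation leb := (@lebesgue_measure R).
Notation gi := (graph_int_ge0 mu).

Lemma ae_graph_int_eq0 (F : gpoint G -> R -> \bar R) : st_emeasurable F ->
  (forall x t, 0 <= t -> (0 <= F x t)%E) -> st_int_ge0 mu F = 0%E ->
  {ae leb, forall t : R, 0 <= t -> gi (F^~ t) = 0%E}.
Proof.
move=> mF F0 sti0.
have mD : measurable `[(0 : R), +oo[ by exact: measurable_itv.
have /(ae_eq_integral_abs leb mD (measurable_graph_int_ge0 mu0 mF F0)) :
    (\int[leb]_(t in `[0%R, +oo[) `|gi (F^~ t)| = 0)%E.
  rewrite -sti0 /st_int_ge0; apply: eq_integral => t; rewrite inE/= in_itv/= andbT => t0.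
  by rewrite gee0_abs// graph_int_ge0_ge0// => x; exact: F0.
apply: (@filterS _ _ (ae_filter_ringOfSetsType leb)) => t H t0.
by apply: H; rewrite /= in_itv/= t0.
Qed.

Lemma graph_int_eq0 (F : gpoint G -> \bar R) : graph_emeasurable F -> (forall x, (0 <= F x)%E) ->
  gi F = 0%E -> (forall v, F (Vtx v) = 0%E) /\
  forall e, {ae leb, forall s, s \in `]0%R, len e[ -> F (pt e s) = 0%E}.
Proof.
move=> mF F0; rewrite graph_int_ge0E => gi0.
have V0 : (0 <= \esum_(x in [set: vertex G]) ((mu x)%:E * F (Vtx x)))%E.
  by apply: esum_ge0 => x _; rewrite mule_ge0// lee_fin ltW.
have E0 : (0 <= \esum_(e in [set: edge G]) \int[leb]_(s in `]0%R, len e[) F (pt e s))%E.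
  by apply: esum_ge0 => e _; exact: integral_ge0.
move/eqP: gi0; rewrite padde_eq0// => /andP[/eqP Vz /eqP Ez]; split.
  move=> v; apply/eqP; rewrite eq_le F0 andbT.
  have := le_esum_term (fun x : vertex G => ((mu x)%:E * F (Vtx x))%E) v.
  by rewrite Vz pmule_rle0// lte_fin.
move=> e; have mD : measurable `]0%R, len e[ by exact: measurable_itv.
have /(ae_eq_integral_abs leb mD (mF e)) :
    (\int[leb]_(s in `]0%R, len e[) `|F (pt e s)| = 0)%E.
  have -> : (\int[leb]_(s in `]0%R, len e[) `|F (pt e s)| =
      \int[leb]_(s in `]0%R, len e[) F (pt e s))%E.
    by apply: eq_integral => s _; rewrite gee0_abs.
  apply/eqP; rewrite eq_le integral_ge0// andbT -Ez.
  exact: (le_esum_term (fun e : edge G => \int[leb]_(s in `]0%R, len e[) F (pt e s))%E e).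
by apply: (@filterS _ _ (ae_filter_ringOfSetsType leb)) => s H s_in; exact: H.
Qed.

(** A nonempty open interval is not negligible. *)
Lemma continuous_ae_eq0 (l : R) (f : R -> R) : {within `[0, l], continuous f} ->
  {ae leb, forall s, s \in `]0%R, l[ -> f s = 0} -> forall s, 0 < s < l -> f s = 0.
Proof.
move=> cf [A [mA A0 NA]] s s_in.
have l0 : 0 < l by have /andP[s0 sl] := s_in; exact: lt_trans sl.
have [cfi _ _] := (continuous_within_itvP f l0).1 cf.
apply: contrapT => /eqP fs0.
have : \forall t \near s, f t != 0 /\ t \in `]0, l[.
  have cs : f @ s --> f s by apply: cfi; rewrite in_itv.
  have H := cvgr_neq0 _ cs fs0.
  near=> t; split; near: t; first exact: H.
  by apply: near_in_itvoo; rewrite in_itv.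
case/nbhs_ballP => eps /= eps0 sub.
have : (leb `](s - eps)%R, (s + eps)%R[ <= leb A)%E.
  apply: le_measure; [by rewrite inE; exact: measurable_itv|by rewrite inE|].
  move=> t /=; rewrite in_itv/= => t_in; apply: NA => /= H.
  have [] := sub t; first by rewrite /ball/= ltr_distlC.
  by move=> ft t_l; move/eqP: ft; apply; exact: H.
rewrite A0 lebesgue_measure_itv/= lte_fin ltrD2l gtrN// -EFinB lee_fin.
by rewrite opprB addrC subrKA; lra.
Unshelve. all: by end_near.
Qed.

End vanishing.

(** * Letting the scale tend to infinity *)

Lemma cvg_ball_mass (R : realType) (G : metricGraph R) (mu : vertex G -> R)
    (mu0 : forall x, 0 < mu x) (x0 : vertex G) (f : gpoint G -> R) :
  graph_connected G -> graph_measurable f ->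
  (fun k => graph_int_ge0 mu
     (fun x => (EFin \o f)^\+ x * (gdist x (Vtx x0) < k%:R)%R%:R%:E)%E) @ \oo -->
  graph_int_ge0 mu (EFin \o f)^\+%E.
Proof.
move=> cG mf; apply: (cvg_graph_int_ge0 mu0).
- move=> k e; apply: emeasurable_funM; first exact: (graph_emeasurable_pos mf).
  apply/measurable_EFinP; apply: measurable_funTS.
  apply: (@measurableT_comp _ _ _ _ _ _ (fun t : R => (t < k%:R)%R%:R : R)).
    apply: nonincreasing_measurable => // s t st; rewrite ler_nat.
    by have [tk|] := ltP t k%:R; [rewrite (le_lt_trans st tk)|].
  by apply: continuous_measurable_fun; exact: gdist_pt_continuous.
- by move=> k x; apply: mule_ge0 => //; rewrite lee_fin.
- move=> x k l kl /=; apply: lee_wpmul2l => //; rewrite lee_fin ler_nat.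
  have [xk|] := ltP (gdist x (Vtx x0)) k%:R; last by [].
  by rewrite (lt_le_trans xk)// ler_nat.
- move=> x; apply: cvg_near_cst; exists (Num.bound (gdist x (Vtx x0))) => // k /= bk.
  have d0 := gdist_ge0 cG x (Vtx x0).
  by rewrite (lt_le_trans (archi_boundP d0)) ?ler_nat// mule1.
Qed.

Lemma powR_le_eps (R : realType) (c p eps : R) : 0 < c -> 0 < p -> 0 < eps ->
  exists2 lam : R, 0 < lam & c * lam `^ (- p) <= eps.
Proof.
move=> c0 p0 eps0; exists ((eps / c) `^ (- p^-1)); first by rewrite powR_gt0// divr_gt0.
rewrite -powRrM mulrNN mulVf ?gt_eqF// powRr1 ?divr_ge0 ?(ltW eps0) ?(ltW c0)//.
by rewrite mulrC divfK// gt_eqF.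
Qed.

Theorem theorem2p14 (R : realType) (G : metricGraph R)
    (mu : vertex G -> R) (omega : vertex G -> vertex G -> R)
    (x0 : vertex G) (C0 sigma delta C : R)
    (h : gpoint G -> R -> R) (u0 u1 : gpoint G -> R) (u : gpoint G -> R -> R) :
  let lens := range (@len R G) in
  let R0 := Num.max (2 * sup lens) 1 in
  let B r := gball (Vtx x0) r in
  let weight r t (x : gpoint G) :=
    (h x t `^ (- (sigma - 1)^-1) * expR (- (delta / r) * gdist x (Vtx x0)))%:E in
  infinite_set [set: vertex G] ->
  graph_connected G ->
  locally_finite G ->
  has_ubound lens ->
  0 < inf lens ->
  (exists xs : nat -> vertex G,
     (fun n => gdist (Vtx x0) (Vtx (xs n))) @ \oo --> +oo) ->
  (forall r, 0 < r -> finite_part (B r)) ->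
  (forall x, 0 < mu x) ->
  (forall x y, 0 <= omega x y) ->
  (forall x y, omega x y = omega y x) ->
  (forall x y, 0 < omega x y <-> adj x y) ->
  0 < C0 ->
  (forall x, \sum_(y \in [set y | adj x y]) omega x y <= C0 * mu x) ->
  1 < sigma ->
  0 < delta ->
  st_measurable h ->
  (forall x t, 0 <= t -> 0 < h x t) ->
  0 < C ->
  (forall r, R0 <= r ->
    let T := Num.sqrt r in
    let bound := (C * r `^ (sigma / (sigma - 1)))%:E in
    [/\ (\int[@lebesgue_measure R]_(t in `[T, (2 * T)%R])
           vertex_int mu (B r) (weight r t) <= bound)%E,
        (\int[@lebesgue_measure R]_(t in `[T, (2 * T)%R])
           edge_int (B r) (weight r t) <= bound)%E,
        (\int[@lebesgue_measure R]_(t in `[0%R, (2 * T)%R])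
           vertex_int mu (~` B r) (weight r t) <= bound)%E &
        (\int[@lebesgue_measure R]_(t in `[0%R, (2 * T)%R])
           edge_int (~` B r) (weight r t) <= bound)%E]) ->
  very_weak_solution mu omega sigma h u0 u1 u ->
  (0 <= graph_int mu u1)%E ->
  (forall r, R0 <= r ->
    [/\ in_X mu x0 (delta / r) u0,
        in_X mu x0 (delta / r) u1 &
        in_L1loc_X mu x0 (delta / r) u]) ->
  {ae (@lebesgue_measure R), forall t, 0 <= t -> forall x : gpoint G, u x t = 0}.
Proof.
move=> lens R0 B weight _ cG lfin lens_ub inf0 _ finB mu0 omega0 omega_sym omega_adj
  C00 omega_C0 sigma1 delta0 mh h0 C_gt0 bounds sol u1_ge0 inX.
pose r := inf lens; pose j := sup lens.
have len_rj (e : edge G) : r <= len e <= j.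
  apply/andP; split; last by apply: ub_le_sup => //; exists e.
  by apply: ge_inf; [exists 0 => _ [e' _ <-]; exact: ltW (len_gt0 e')|exists e].
(* Without edges, the supremum has its default value [0]. *)
have j0 : 0 <= j.
  have [[_ [e _ _]]|/nonemptyPn lens0] := pselect (lens !=set0).
    by have /andP[_ ej] := len_rj e; exact: le_trans (ltW (len_gt0 e)) ej.
  by rewrite /j lens0 sup0.
have R0_ge1 : 1 <= R0 by rewrite /R0 le_max lexx orbT.
have R0_ge0 : 0 <= R0 := le_trans ler01 R0_ge1.
pose k0 := Num.bound R0.
have k0P k : (k0 <= k)%N -> R0 <= k%:R.
  by move=> kk; apply: ltW; apply: lt_le_trans (archi_boundP R0_ge0) _; rewrite ler_nat.
have p0 : 0 < (sigma - 1)^-1 by rewrite invr_gt0 subr_gt0.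
pose n := Num.bound (2 / (sigma - 1)).
have np : 2 / (sigma - 1) <= n.+1%:R.
  apply: ltW; apply: lt_le_trans (archi_boundP _) _; last by rewrite ler_nat.
  by rewrite mulr_ge0// ltW.
have [_ [mu1 _] [m_u _]] := inX R0 (lexx _).
have Phi0 x t : 0 <= t -> 0 <= h x t * `|u x t| `^ sigma.
  by move=> t0; apply: mulr_ge0; [exact: ltW (h0 x t t0)|exact: powR_ge0].
have m_Phi : st_measurable (fun x t => h x t * `|u x t| `^ sigma).
  apply: (st_measurableM mh).
  exact: (st_measurable_comp (measurable_powR sigma) (st_measurable_abs m_u)).
have Phi0E x t : 0 <= t -> (0 <= (h x t * `|u x t| `^ sigma)%:E)%E.
  by move=> t0; rewrite lee_fin; exact: Phi0.
have pos1 : (0 <= graph_int_ge0 mu (EFin \o u1)^\+)%E by exact: graph_int_ge0_ge0.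
have neg1 : (0 <= graph_int_ge0 mu (EFin \o u1)^\-)%E by exact: graph_int_ge0_ge0.
have [m neg1E mP] : exists2 m, graph_int_ge0 mu (EFin \o u1)^\-%E = m%:E &
    (m%:E <= graph_int_ge0 mu (EFin \o u1)^\+)%E.
  move: u1_ge0; rewrite /graph_int; case: (graph_int_ge0 mu (EFin \o u1)^\-%E) neg1.
  - by move=> m _ H; exists m => //; rewrite -sube_ge0.
  - by move=> _; rewrite addeNy leeNy_eq.
  - by [].
pose c := scale_const C0 j r sigma delta C n.
have c0 : 0 < c.
  by rewrite /c /scale_const ltr_wpDl// !mulr_ge0 ?powR_ge0 ?expR_ge0// ltW.
have sti0 : st_int_ge0 mu (fun x t => (h x t * `|u x t| `^ sigma)%:E) = 0%E.
  apply: (st_int_ge0_eq0_of_tail_bound mu0 (S := fun k => cylinder x0 k%:R)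
    (kappa := fun lam => c * lam `^ (- (sigma - 1)^-1)) (k0 := k0)
    (st_measurable_EFin m_Phi) Phi0E _ _ _ _ _ (cvg_ball_mass mu0 x0 cG mu1) mP).
  - move=> k; apply: st_measurable_EFin.
    exact: (st_measurableM m_Phi (st_measurable_cylinder x0 cG k%:R)).
  - move=> k; apply: st_measurable_EFin.
    exact: (st_measurableM m_Phi (st_measurable_cylinderC x0 cG k%:R)).
  - move=> k x t /andP[xk tk]; apply/andP; split.
      by apply: lt_le_trans xk _; rewrite ler_nat.
    by apply: lt_le_trans tk _; rewrite ler_wsqrtr// ler_nat.
  - move=> x t t0; have d0 := gdist_ge0 cG x (Vtx x0).
    exists (Num.bound (gdist x (Vtx x0) + t ^+ 2)).
    have H := archi_boundP (addr_ge0 d0 (sqr_ge0 t)).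
    apply/andP; split; first by apply: le_lt_trans H; rewrite lerDl sqr_ge0.
    have tH : t ^+ 2 < (Num.bound (gdist x (Vtx x0) + t ^+ 2))%:R :> R.
      by apply: le_lt_trans H; rewrite lerDr.
    apply: (@le_lt_trans _ _ (Num.sqrt (t ^+ 2))); first by rewrite sqrtr_sqr ler_norm.
    by rewrite ltr_sqrt// (le_lt_trans (sqr_ge0 t) tH).
  - move=> k; apply: graph_int_ge0_ge0 => // x.
    by apply: mule_ge0 => //; rewrite lee_fin.
  - by move=> eps; exact: powR_le_eps.
  - move=> lam k lam0 /k0P R0k; have k_gt0 : 0 < k%:R :> R.
      by apply: lt_le_trans R0k; exact: lt_le_trans R0_ge1.
    have [_ Xu1 Xu] := inX _ R0k.
    have jk : 2 * j <= k%:R.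
      by apply: le_trans R0k; rewrite /R0 le_max lexx.
    exact: (scale_inequality cG lfin finB mu0 omega0 omega_sym omega_adj C00 omega_C0
      inf0 j0 len_rj sigma1 delta0 mh h0 sol k_gt0 jk Xu1 Xu (bounds _ R0k) np lam0 neg1E).
have Phi_u x t : 0 <= t -> (h x t * `|u x t| `^ sigma)%:E = 0%E -> u x t = 0.
  move=> t0 [/eqP]; rewrite mulf_eq0 gt_eqF ?h0//= powR_eq0 normr_eq0 => /andP[/eqP].
  by [].
apply: (@filterS _ _ (ae_filter_ringOfSetsType _) _ _ _
  (ae_graph_int_eq0 mu0 (st_measurable_EFin m_Phi) Phi0E sti0)) => t Phit t0.
have [vert edg] := graph_int_eq0 mu0 (st_emeasurable_section (st_measurable_EFin m_Phi) t0)
  (fun x => Phi0E x t t0) (Phit t0).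
have [_ /(_ t t0)[Dt _] _] := sol.
move=> [v|e [s s_in]]; first by apply: Phi_u => //; exact: vert.
have [ct _ _ _] := Dt e.
rewrite -pt_inner; apply: (continuous_ae_eq0 ct) s_in.
apply: (@filterS _ _ (ae_filter_ringOfSetsType _) _ _ _ (edg e)) => s' H s'_in.
by apply: Phi_u => //; exact: H.
Qed.
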